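(* Let $0<\gamma<\beta_1$ and $0<\beta_2$. There exists $\beta=\beta(\gamma,\beta_1,\beta_2)>0$ with the following property. Let $C_1,C_2>0$ be constants. For $A>1$ large enough and $\epsilon,\sigma,\delta,r_0>0$ small enough (i.e. there is $A_0>1$ such that for each $A\ge A_0$ there are positive thresholds such that the following holds whenever $\epsilon,\sigma,\delta,r_0>0$ are below them; $A_0$ and the thresholds depend only on $\gamma,\beta_1,\beta_2,C_1,C_2$ and, for the thresholds, $A$), the following holds. Let $\Sigma\subseteq\mathbb{R}^4$ be a closed set containing $0$ and let $\mathcal{C}$ be a KP cone based at $0$ such that: (E0) for $x\in B(0,r_0)\cap\Sigma$ and $0<r\le 2r_0$, $\vartheta^C_\Sigma(x,r)<\epsilon$; (E1) for $0<r\le2r_0$, $D^{0,r}(\Sigma,\mathcal{C})\le\min(\sigma,C_1r^{\beta_1})$; (E2) for $x\in\Sigma\cap B(0,r_0)\setminus\{0\}$ and $0<r\le16\frac{|x|^{1+\gamma}}{A}$, $\theta^P_\Sigma(x,r)\le\min(\delta,C_2r^{\beta_2})$. Then $\Sigma$ admits a $C^{1,\beta}$ parametrization by $\mathcal{C}$: there exist neighborhoods $U$ of $0$ and $U'$ of $0$ in $\mathbb{R}^4$ and a diffeomorphism $\varphi\in C^{1,\beta}(U\to U')$ such that $\varphi(\mathcal{C}\cap U)=\Sigma\cap U'$. Further, $\varphi(0)=0$, $D_0\varphi=\mathrm{Id}$, and $U\cap\mathcal{C}\supseteq B(0,r_0)\cap\mathcal{C}$.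
   Context: $B(x,r)$ denotes the closed ball in $\mathbb{R}^4$. A KP cone based at $y\in\mathbb{R}^4$ is a set $\mathcal{C}$ such that in some orthonormal coordinates $(x_1,\dots,x_4)$ centered at the origin $\mathcal{C}-y=\{x_4^2=x_1^2+x_2^2+x_3^2\}$. A KP cone is a KP cone based at some point. For sets $A,B\subseteq\mathbb{R}^4$ meeting $B(x,r)$, $d^{x,r}(A,B)=\frac1r\sup_{a\in A\cap B(x,r)}\inf_{b\in B\cap B(x,r)}|a-b|$ and $D^{x,r}(A,B)=\max(d^{x,r}(A,B),d^{x,r}(B,A))$. For $x\in\Sigma$, $r>0$: $\theta_\Sigma^P(x,r)=\inf\{D^{x,r}(\Sigma,L): L\text{ an affine 3-plane containing }x\}$; $\vartheta_\Sigma^C(x,r)=\inf\{D^{x,r}(\Sigma,\mathcal{C}'):\mathcal{C}'\text{ a KP cone containing }x\}$. A diffeomorphism $\varphi\in C^{1,\beta}(U\to U')$ between open sets is a $C^1$ diffeomorphism whose derivative is Hölder continuous with exponent $\beta$. *)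

(* Defs.v *)
From HB Require Import structures.
From mathcomp Require Export all_boot all_order all_algebra.
From mathcomp Require Export all_classical all_reals all_analysis.
Export Order.TTheory GRing.Theory Num.Theory.
Export numFieldNormedType.Exports.

Set Implicit Arguments.
Unset Strict Implicit.
Unset Printing Implicit Defensive.

Local Open Scope classical_set_scope.
Local Open Scope ring_scope.

(* The library norm on 'rV[R]_4 is the sup norm. It induces the usual topology,
   so the library's [open], [closed] and [differentiable] are the standard
   notions, but lengths and balls need the Euclidean norm. *)
Definition enorm (R : realType) (v : 'rV[R]_4) : R :=
  Num.sqrt (\sum_i v 0 i ^+ 2).

Definition eball (R : realType) (x : 'rV[R]_4) (r : R) : set 'rV[R]_4 :=
  [set y | enorm (y - x) <= r].

(* [sup] and [inf] are real-valued, with junk value 0 on empty or unbounded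
   sets; neither occurs below when A and B both meet [eball x r]. *)
Definition excess (R : realType) (x : 'rV[R]_4) (r : R)
    (A B : set 'rV[R]_4) : R :=
  r^-1 * sup [set inf [set enorm (a - b) | b in B `&` eball x r]
             | a in A `&` eball x r].

Definition bidist (R : realType) (x : 'rV[R]_4) (r : R)
    (A B : set 'rV[R]_4) : R :=
  Num.max (excess x r A B) (excess x r B A).

Definition affine_3plane (R : realType) (L : set 'rV[R]_4) : Prop :=
  exists (p : 'rV[R]_4) (V : {vspace 'rV[R]_4}),
    \dim V = 3%N /\ L = [set p + v | v in [set` V]].

(* The coordinates of z in the orthonormal basis formed by the columns of Q are
   the entries of z *m Q. The numerals index 'I_4, from 0 to 3. *)
Definition kp_cone_at (R : realType) (y : 'rV[R]_4)
    (C : set 'rV[R]_4) : Prop :=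
  exists Q : 'M[R]_4, Q *m Q^T = 1%:M /\
    C = [set z | let x := (z - y) *m Q in
                 x 0 3 ^+ 2 = x 0 0 ^+ 2 + x 0 1 ^+ 2 + x 0 2 ^+ 2].

Definition kp_cone (R : realType) (C : set 'rV[R]_4) : Prop :=
  exists y, kp_cone_at y C.

Definition thetaP (R : realType) (S : set 'rV[R]_4) (x : 'rV[R]_4) (r : R) : R :=
  inf [set bidist x r S L | L in [set L | affine_3plane L /\ L x]].

Definition varthetaC (R : realType) (S : set 'rV[R]_4) (x : 'rV[R]_4) (r : R) : R :=
  inf [set bidist x r S C | C in [set C | kp_cone C /\ C x]].

Definition C1_on (R : realType) (U : set 'rV[R]_4)
    (f : 'rV[R]_4 -> 'rV[R]_4) : Prop :=
  forall x, U x -> differentiable f x /\ {for x, continuous (jacobian f)}.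

(* Only the values of f on U and of g on V matter, U and V being open. *)
Definition C1_diffeo (R : realType) (U V : set 'rV[R]_4)
    (f : 'rV[R]_4 -> 'rV[R]_4) : Prop :=
  exists g : 'rV[R]_4 -> 'rV[R]_4,
    [/\ C1_on U f, C1_on V g,
        (forall x, U x -> V (f x) /\ g (f x) = x) &
        (forall y, V y -> U (g y) /\ f (g y) = y)].

(* Differences of derivatives are measured in the library norm of 'M[R]_4 (the
   largest absolute value of an entry): using the operator norm instead would
   only change K. *)
Definition hoelder_derivative (R : realType) (beta : R) (U : set 'rV[R]_4)
    (f : 'rV[R]_4 -> 'rV[R]_4) : Prop :=
  exists K : R, forall x y, U x -> U y ->
    `|jacobian f x - jacobian f y| <= K * enorm (x - y) `^ beta.

Definition C1beta_diffeo (R : realType) (beta : R) (U V : set 'rV[R]_4)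
    (f : 'rV[R]_4 -> 'rV[R]_4) : Prop :=
  C1_diffeo U V f /\ hoelder_derivative beta U f.

(* Main.v *)
Require Import Defs.
From mathcomp Require Import ring lra.

(* Let [e] be the axis of the cone [C] and [P x = x - <x, e> e], so that [C] is the
   set [|<x, e>| = |P x|]. Close to a point [x <> 0] of Sigma, (E1) and the
   smoothness of [C] show that Sigma is flat at the scale [|x| `^ (1 + g)], for any
   [g] between [gamma] and [beta1], with a normal close to that of [C]; from that
   scale downwards (E2) makes the normals at dyadic scales converge geometrically.
   Hence each half of Sigma is a graph [<x, e> = |z| + f z] over [z = P x], and
   [f] has an expansion [|f y - f x - <y - x, G x>| <= K |y - x| `^ (1 + beta)],
   uniformly near 0: by flatness when [|y - x|] is smaller than [|x| `^ (1 + g)],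
   and otherwise because [f x = O(|x| `^ (1 + g + a))] for some [a > 0], whence
   [beta = a / (1 + g)]. Such a uniform expansion already contains the Hoelder
   continuity of [G]. The functions [f] of the two halves are glued, by means of
   the cosine of the angle with [e], to one function [w] on the whole space, and
   [x |-> x + w x * e] maps [C] to Sigma near 0. Precomposing with
   [x |-> x / (1 + M |x|)], which preserves [C] and is tangent to the identity at
   0, gives a map defined everywhere, so that [U] can be the whole space. *)

Set Implicit Arguments.
Unset Strict Implicit.
Unset Printing Implicit Defensive.

Local Open Scope classical_set_scope.
Local Open Scope ring_scope.

(** * Euclidean geometry *)

(** The obstacle is that (E2) is silent at [x] above the scale [|x| ^ (1 + gamma)], so no single
    scale serves all points near 0 and each tangent plane must be tied to the cone separately. The
    tie is made at [s = |x| ^ (1 + g)]: there (E1) costs [s |x| ^ a], the curvature of the cone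
    costs [s ^ 2 / |x| = s |x| ^ g], and both are small relative to [s]. Hence the requirement
    [a <= g]. Normals are scaled to have component 1 along [e]. This fixes their sign, makes any two
    of them differ by a vector orthogonal to [e], and turns the gradient of [f] into the normal of
    the cone minus that of Sigma. That Sigma has no holes, so that there is a point over every small
    [z], rests on the two-sided distance: tangent planes are approximated by points of Sigma, which
    rules out a nearest point that is not above [z]. Gluing with a function singular at 0 is
    harmless because [f] and [G] vanish at 0 to orders [1 + beta] and [beta]. Since the chart moves
    points only along [e], inverting it is a one-dimensional problem on each line parallel to [e],
    solved by the intermediate value theorem. *)

Section MatrixNorm.
Context {R : realType}.

Lemma mx_norm_le m n (A : 'M[R]_(m, n)) (c : R) : 0 <= c ->
  (forall i j, `|A i j| <= c) -> `|A| <= c.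
Proof.
move=> c0 Ac; rewrite [leLHS]/Num.norm/= mx_normrE.
by apply: bigmax_le => // -[i j] _ /=.
Qed.

Lemma mx_entry_le m n (A : 'M[R]_(m, n)) i j : `|A i j| <= `|A|.
Proof.
rewrite [leRHS]/Num.norm/= mx_normrE.
by apply: (le_trans _ (le_bigmax _ _ (i, j))).
Qed.

End MatrixNorm.

Section Euclid.
Context {R : realType}.
Implicit Types (u v w x y e : 'rV[R]_4) (a b c t : R).

Definition dot u v : R := \sum_i u 0 i * v 0 i.

Lemma dotC u v : dot u v = dot v u.
Proof. by apply: eq_bigr => i _; rewrite mulrC. Qed.

Lemma dotDl u v w : dot (u + v) w = dot u w + dot v w.
Proof. by rewrite -big_split; apply: eq_bigr => i _; rewrite mxE mulrDl. Qed.

Lemma dotZl a u v : dot (a *: u) v = a * dot u v.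
Proof. by rewrite mulr_sumr; apply: eq_bigr => i _; rewrite mxE mulrA. Qed.

Lemma dotDr u v w : dot u (v + w) = dot u v + dot u w.
Proof. by rewrite !(dotC u) dotDl. Qed.

Lemma dotZr a u v : dot u (a *: v) = a * dot u v.
Proof. by rewrite !(dotC u) dotZl. Qed.

Lemma dotNl u v : dot (- u) v = - dot u v.
Proof. by rewrite -scaleN1r dotZl mulN1r. Qed.

Lemma dotNr u v : dot u (- v) = - dot u v.
Proof. by rewrite !(dotC u) dotNl. Qed.

Lemma dot0l u : dot 0 u = 0.
Proof. by rewrite -(scale0r 0) dotZl mul0r. Qed.

Lemma dot0r u : dot u 0 = 0.
Proof. by rewrite dotC dot0l. Qed.

Definition dotE := (dotDl, dotDr, dotNl, dotNr, dotZl, dotZr, dot0l, dot0r).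

Lemma dot_mul_rV (A : 'M[R]_4) u v : dot (u *m A) v = dot u (v *m A^T).
Proof.
rewrite /dot; under eq_bigr do rewrite mxE mulr_suml.
rewrite exchange_big; apply: eq_bigr => i _; rewrite mxE mulr_sumr.
by apply: eq_bigr => j _; rewrite !mxE; ring.
Qed.

Lemma enorm_ge0 u : 0 <= enorm u. Proof. exact: sqrtr_ge0. Qed.

Lemma sqr_enorm u : enorm u ^+ 2 = dot u u.
Proof.
rewrite sqr_sqrtr; last by apply: sumr_ge0 => i _; exact: sqr_ge0.
by apply: eq_bigr.
Qed.

Lemma enormE u : enorm u = Num.sqrt (dot u u).
Proof. by rewrite -sqr_enorm sqrtr_sqr ger0_norm ?enorm_ge0. Qed.

Lemma enorm0 : enorm (0 : 'rV[R]_4) = 0.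
Proof. by rewrite enormE dot0l sqrtr0. Qed.

Lemma norm_le_enorm u : `|u| <= enorm u.
Proof.
apply: mx_norm_le => [|i j]; first exact: enorm_ge0.
rewrite -[leLHS]ger0_norm // -ler_sqr ?nnegrE ?enorm_ge0 ?normr_ge0 //.
rewrite sqr_enorm normr_id real_normK ?num_real // /dot (bigD1 j) //= (ord1 i) -expr2.
by rewrite lerDl sumr_ge0 // => k _; rewrite -expr2 sqr_ge0.
Qed.

Lemma enorm_le_norm u : enorm u <= 2 * `|u|.
Proof.
rewrite -ler_sqr ?nnegrE ?enorm_ge0 ?mulr_ge0 // sqr_enorm.
apply: (@le_trans _ _ (\sum_(i < 4) `|u| ^+ 2)); last first.
  by rewrite sumr_const card_ord -[leLHS]mulr_natr; lra.
apply: ler_sum => i _; rewrite -expr2 -[leLHS]real_normK ?num_real //.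
by rewrite ler_sqr ?nnegrE // mx_entry_le.
Qed.

Lemma enorm_eq0 u : enorm u = 0 -> u = 0.
Proof.
move=> u0; apply/normr0_eq0/eqP; rewrite eq_le normr_ge0 andbT.
by rewrite -u0 norm_le_enorm.
Qed.

Lemma enorm_gt0 u : u != 0 -> 0 < enorm u.
Proof.
move=> u0; rewrite lt_def enorm_ge0 andbT; apply: contra_neq u0.
exact: enorm_eq0.
Qed.

Lemma dot_le u v : `|dot u v| <= enorm u * enorm v.
Proof.
rewrite -ler_sqr ?nnegrE ?mulr_ge0 ?enorm_ge0 ?normr_ge0 //.
rewrite real_normK ?num_real // exprMn !sqr_enorm.
have [->|v0] := eqVneq v 0; first by rewrite !dot0r expr0n mulr0.
have vv : 0 < dot v v by rewrite -sqr_enorm exprn_gt0 ?enorm_gt0.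
have := sqr_ge0 (enorm (dot v v *: u - dot u v *: v)).
rewrite sqr_enorm !dotE (dotC v u).
set A := dot u u; set B := dot u v; set D := dot v v => H.
have {}H : 0 <= D * (A * D - B ^+ 2).
  by apply: le_trans H _; rewrite le_eqVlt; apply/orP; left; apply/eqP; ring.
by rewrite pmulr_rge0 // subr_ge0 in H.
Qed.

Lemma enormD u v : enorm (u + v) <= enorm u + enorm v.
Proof.
rewrite -ler_sqr ?nnegrE ?addr_ge0 ?enorm_ge0 //.
rewrite sqr_enorm !dotE sqrrD !sqr_enorm (dotC v u).
by have := ler_norm (dot u v); have := dot_le u v; lra.
Qed.

Lemma enormZ a u : enorm (a *: u) = `|a| * enorm u.
Proof.
by rewrite !enormE !dotE mulrA -expr2 sqrtrM ?sqr_ge0 // sqrtr_sqr.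
Qed.

Lemma enormN u : enorm (- u) = enorm u.
Proof. by rewrite -scaleN1r enormZ normrN1 mul1r. Qed.

Lemma enormB u v : enorm (u - v) = enorm (v - u).
Proof. by rewrite -enormN opprB. Qed.

Lemma enorm_sub u v : enorm (u - v) <= enorm u + enorm v.
Proof. by rewrite -(enormN v) enormD. Qed.

Lemma enorm_tri w u v : enorm (u - v) <= enorm (u - w) + enorm (w - v).
Proof. by rewrite -[u - v](subrKA w) enormD. Qed.

Lemma enorm_dist u v : `|enorm u - enorm v| <= enorm (u - v).
Proof.
rewrite ler_norml; apply/andP; split.
  by have := enormD (v - u) u; rewrite subrK enormB; lra.
by have := enormD (u - v) v; rewrite subrK; lra.
Qed.

Lemma enorm_le_sqr u c : 0 <= c -> dot u u <= c ^+ 2 -> enorm u <= c.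
Proof. by move=> c0; rewrite -sqr_enorm ler_sqr // nnegrE // enorm_ge0. Qed.

(** This supplies the curvature terms of the cone. Since [(|u + v| - |u|) (|u + v| + |u|) = 2 <v, u>
    + |v| ^ 2], the remainder is an exact quotient with denominator [|u| + |u + v|], and its
    numerator is at most [2 |v| ^ 2]. *)
Lemma enorm_expand u v : u != 0 ->
  `|enorm (u + v) - enorm u - dot v u / enorm u| <= 2 * enorm v ^+ 2 / enorm u.
Proof.
move=> u0; have a0 := enorm_gt0 u0; have := enorm_ge0 (u + v).
have s2 := sqr_enorm (u + v); rewrite !dotE (dotC u v) -!sqr_enorm in s2.
have vu := dot_le v u; have := enorm_dist (u + v) u; rewrite addrAC subrr add0r.
have := enorm_ge0 v.
set a := enorm u in a0 s2 vu *; set b := enorm (u + v) in s2 *.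
set c := enorm v in s2 vu *; set d := dot v u in s2 vu *.
move=> c0 bac b0.
have ab : 0 < a + b by lra.
have -> : b - a - d / a = ((a - b) * (d / a) + c ^+ 2) / (a + b).
  have -> : c ^+ 2 = (b - a) * (b + a) - d * 2 by lra.
  by field; apply/andP; split; apply: lt0r_neq0.
rewrite normrM normfV (gtr0_norm ab) ler_pdivrMr //.
apply: (@le_trans _ _ (2 * c ^+ 2)); last first.
  rewrite mulrDr divfK ?lt0r_neq0 // lerDl.
  by rewrite mulr_ge0 ?divr_ge0 ?mulr_ge0 ?sqr_ge0 // ltW.
apply: le_trans (ler_normD _ _) _; rewrite normrM normrM normfV (gtr0_norm a0).
have d_le : `|d| / a <= c by rewrite ler_pdivrMr.
rewrite (ger0_norm (sqr_ge0 c)) distrC mulrDl mul1r lerD2r expr2.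
by apply: ler_pM => //; rewrite divr_ge0 // ltW.
Qed.

End Euclid.

(** * Powers and normals *)

Section Powers.
Context {R : realType}.
Implicit Types (a b t s : R).

Lemma powRDp t a b : 0 < a -> 0 < b -> t `^ (a + b) = t `^ a * t `^ b.
Proof. by move=> a0 b0; rewrite powRD // gt_eqF // addr_gt0. Qed.

Lemma powR1D t a : 0 <= t -> 0 < a -> t `^ (1 + a) = t * t `^ a.
Proof. by move=> t0 a0; rewrite powRDp // powRr1. Qed.

Lemma ler_powRl s t a : 0 <= a -> 0 <= s -> s <= t -> s `^ a <= t `^ a.
Proof. by move=> a0 s0 st; rewrite ge0_ler_powR // nnegrE // (le_trans s0). Qed.

Lemma ler_powRr t a b : 0 <= t <= 1 -> 0 < a <= b -> t `^ b <= t `^ a.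
Proof.
move=> /andP[t0 t1] /andP[a0 ab]; move: t0; rewrite le_eqVlt => /predU1P[<-|t0].
  by rewrite !powR0 // gt_eqF // (lt_le_trans a0).
by rewrite ger_powR // t0.
Qed.

Lemma powR_small a K eta : 0 < a -> 0 <= K -> 0 < eta ->
  exists2 rho : R, 0 < rho <= 1 & forall t, 0 <= t <= rho -> K * t `^ a <= eta.
Proof.
(* [K + 1] replaces [K] as a divisor because [K] may vanish. *)
move=> a0 K0 eta0; have K1 : 0 < K + 1 by lra.
pose d := (eta / (K + 1)) `^ a^-1.
have d0 : 0 < d by rewrite powR_gt0 // divr_gt0.
exists (Num.min 1 d).
  by rewrite lt_min ltr01 d0 /= ge_min lexx.
move=> t /andP[t0]; rewrite le_min => /andP[_ td].
have tK : t `^ a <= eta / (K + 1).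
  apply: le_trans (ler_powRl (ltW a0) t0 td) _.
  by rewrite -powRrM mulVf ?gt_eqF // powRr1 // divr_ge0 // ltW.
apply: le_trans (ler_wpM2l K0 tK) _.
by rewrite mulrA ler_pdivrMr // mulrC ler_wpM2l //; lra.
Qed.

End Powers.

Section Normals.
Context {R : realType}.
Implicit Types (u v w x y e n N : 'rV[R]_4) (a c t r : R).

Definition perp e x := x - dot x e *: e.

Lemma perpE e x : x = perp e x + dot x e *: e.
Proof. by rewrite subrK. Qed.

Section Unit.
Variables (e : 'rV[R]_4) (e1 : dot e e = 1).

Lemma enorm_unit : enorm e = 1.
Proof. by rewrite enormE e1 sqrtr1. Qed.

Lemma dot_perp x : dot (perp e x) e = 0.
Proof. by rewrite !dotE e1; ring. Qed.

Lemma dot_perpl x n : dot n e = 0 -> dot x n = dot (perp e x) n.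
Proof. by move=> ne; rewrite /perp dotDl dotNl dotZl (dotC e) ne mulr0 subr0. Qed.

Lemma perp_id x : dot x e = 0 -> perp e x = x.
Proof. by rewrite /perp => ->; rewrite scale0r subr0. Qed.

Lemma perpB x y : perp e (x - y) = perp e x - perp e y.
Proof.
by rewrite /perp !dotE; apply/rowP => i; rewrite !mxE; ring.
Qed.

Lemma perpD x y : perp e (x + y) = perp e x + perp e y.
Proof. by rewrite /perp !dotE; apply/rowP => i; rewrite !mxE; ring. Qed.

Lemma perpZ c : perp e (c *: e) = 0.
Proof. by rewrite /perp !dotE e1 mulr1 subrr. Qed.

Lemma perp_add x c : perp e (x + c *: e) = perp e x.
Proof. by rewrite perpD perpZ addr0. Qed.

Lemma pythagoras x : enorm x ^+ 2 = enorm (perp e x) ^+ 2 + dot x e ^+ 2.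
Proof. by rewrite !sqr_enorm /perp !dotE (dotC e x) e1; ring. Qed.

Lemma enorm_perp x : enorm (perp e x) <= enorm x.
Proof.
by apply: enorm_le_sqr (enorm_ge0 _) _; rewrite pythagoras -sqr_enorm lerDl sqr_ge0.
Qed.

Lemma dot_unit_le x : `|dot x e| <= enorm x.
Proof. by have := dot_le x e; rewrite enorm_unit mulr1. Qed.

Lemma enorm_scale_unit c : enorm (c *: e) = `|c|.
Proof. by rewrite enormZ enorm_unit mulr1. Qed.

(** With [n = m / <m, e>] and [d = N - n], the vector [d - <d, n> e] lies in the plane of [m], and
    its product with [N] is exactly [|d| ^ 2] because [N] and [n] both have component 1 along [e].
    Its length is at most [7/2 |d|], so the hypothesis gives [|d| ^ 2 <= 7/2 c |d|]. *)
Lemma normal_close N m c : dot N e = 1 -> enorm N <= 2 -> m != 0 ->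
    0 <= c <= 16^-1 ->
    (forall v, dot v m = 0 -> `|dot v N| <= c * enorm v) ->
  dot m e != 0 /\ enorm ((dot m e)^-1 *: m - N) <= 4 * c.
Proof.
move=> Ne N2; wlog m1 : m / dot m m = 1.
  move=> wl m0 c01 vN; have M0 := enorm_gt0 m0; pose k := (enorm m)^-1.
  have k0 : k != 0 by rewrite invr_eq0 gt_eqF.
  have [||//|v|] := wl (k *: m).
  - by rewrite !dotE -sqr_enorm /k expr2 mulrA mulrACA mulVf ?mulr1 ?mulVf ?gt_eqF.
  - by rewrite scaler_eq0 negb_or k0.
  - by rewrite dotE => /eqP; rewrite mulf_eq0 (negPf k0) => /eqP; exact: vN.
  rewrite dotZl mulf_eq0 negb_or k0 /= => me0.
  by rewrite scalerA invfM mulrAC mulVf // mul1r.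
move=> _ /andP[c0 c16] vN; set mu := dot m e.
(* Testing on the component of [e] in the plane of [m] keeps [mu] away from 0; the [2/5] below is a
   lower bound for [(1 - 16^-1) / 2]. *)
have muN : 1 - c <= mu * dot m N.
  have /vN : dot (e - mu *: m) m = 0 by rewrite !dotE m1 (dotC e) /mu; ring.
  rewrite !dotE (dotC e N) Ne.
  have : enorm (e - mu *: m) <= 1.
    apply: enorm_le_sqr => //; rewrite !dotE e1 m1 (dotC e m) -/mu.
    by have := sqr_ge0 mu; lra.
  move=> /(ler_wpM2l c0); rewrite mulr1 => h1 /le_trans/(_ h1).
  by rewrite ler_norml; lra.
have m1' : enorm m = 1 by rewrite enormE m1 sqrtr1.
have dmN : `|dot m N| <= 2.
  by apply: le_trans (dot_le _ _) _; rewrite m1' mul1r.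
have mu25 : 2/5 <= `|mu|.
  have : 1 - c <= `|mu| * 2.
    apply: le_trans muN (le_trans (ler_norm _) _).
    by rewrite normrM ler_wpM2l.
  lra.
have mu0 : mu != 0 by rewrite -normr_gt0; lra.
split => //; have [n nE] : exists n, n = mu^-1 *: m by exists (mu^-1 *: m).
rewrite -nE; have n25 : enorm n <= 5/2.
  by rewrite nE enormZ m1' mulr1 normfV invf_ple ?posrE; lra.
have ne : dot n e = 1 by rewrite nE dotE -/mu mulVf.
have [d dE] : exists d, d = N - n by exists (N - n).
have de : dot d e = 0 by rewrite dE !dotE Ne ne subrr.
have vm : dot (d - dot d n *: e) m = 0.
  have : dot (d - dot d n *: e) n = 0 by rewrite !dotE (dotC e n) ne; ring.
  by rewrite {2}nE dotZr => /eqP; rewrite mulf_eq0 invr_eq0 (negPf mu0) => /eqP.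
have v_le : enorm (d - dot d n *: e) <= 7/2 * enorm d.
  apply: le_trans (enorm_sub _ _) _; rewrite enorm_scale_unit.
  have := dot_le d n; have := ler_wpM2l (enorm_ge0 d) n25; lra.
have := vN _ vm.
have -> : dot (d - dot d n *: e) N = enorm d ^+ 2.
  rewrite -[N](subrK n) -dE sqr_enorm !dotE (dotC e d) de (dotC e n) ne; ring.
rewrite ger0_norm ?sqr_ge0 // => h; rewrite enormB -dE.
have := le_trans h (ler_wpM2l c0 v_le); have := enorm_ge0 d.
rewrite le_eqVlt => /predU1P[<-|d0]; first by rewrite mulr_ge0.
by rewrite mulrCA expr2 mulrA ler_pM2r //; lra.
Qed.

End Unit.
End Normals.

(** * Tangent planes *)

Section Geometric.
Context {R : realType}.
Implicit Types (q r s t a D : R).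

Lemma expr_small q t : 0 <= q < 1 -> 0 < t -> exists j : nat, q ^+ j < t.
Proof.
move=> /andP[q0 q1] t0.
have /cvg_expr /cvgr0Pnorm_lt/(_ _ t0)[j _ /(_ j (leqnn j))] : `|q| < 1.
  by rewrite ger0_norm.
by move=> h; exists j; apply: le_lt_trans (ler_norm _) h.
Qed.

(** The spare factor 2 between [t] and the dyadic scale leaves room for tilting a vector of length
    [t] into a neighbouring plane without leaving the range of that scale. *)
Lemma dyadic_scale s t : 0 < t -> t <= s / 2 ->
  exists j : nat, t <= s / 2 ^+ j / 2 /\ s / 2 ^+ j <= 4 * t.
Proof.
move=> t0 ts; have s0 : 0 < s by lra.
have ex : exists j : nat, s / 2 ^+ j <= 4 * t.
  have [||j] := @expr_small 2^-1 (4 * t / s); first by lra.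
    by rewrite divr_gt0 // mulr_gt0.
  by rewrite ltr_pdivlMr // exprVn mulrC => /ltW; exists j.
case: (ex_minnP ex) => -[|j] sj min_j.
  by exists 0%N; rewrite expr0 divr1 in sj *; split.
exists j.+1; split => //.
have : ~~ (s / 2 ^+ j <= 4 * t) by apply/negP => /min_j; rewrite ltnn.
by rewrite -ltNge exprS invfM mulrCA; lra.
Qed.

Lemma geometric_limit (u : nat -> 'rV[R]_4) D q : 0 <= q < 1 ->
    (forall j, enorm (u j.+1 - u j) <= D * q ^+ j) ->
  exists l, forall j, enorm (l - u j) <= D * q ^+ j / (1 - q).
Proof.
move=> q01 uD; have /andP[q0 q1] := q01; have q1' : 0 < 1 - q by lra.
have D0 : 0 <= D.
  by have := uD 0%N; rewrite expr0 mulr1; exact: le_trans (enorm_ge0 _).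
have uij i j : enorm (u (i + j)%N - u j) <= D * q ^+ j / (1 - q).
  (* The exact partial sum is needed for the induction on [i]; the bound by the full series is not
     inductive. *)
  apply: (@le_trans _ _ (D * q ^+ j * (1 - q ^+ i) / (1 - q))); last first.
    rewrite ler_wpM2r ?invr_ge0 ?(ltW q1') // ler_piMr ?mulr_ge0 ?exprn_ge0 //.
    by rewrite gerBl exprn_ge0.
  elim: i => [|i IH]; first by rewrite subrr enorm0 expr0 subrr mulr0 mul0r.
  rewrite addSn; apply: le_trans (enorm_tri (u (i + j)%N) _ _) _.
  apply: le_trans (lerD (uD _) IH) _; rewrite le_eqVlt; apply/orP; left.
  by apply/eqP; rewrite exprD exprS; field; rewrite gt_eqF.
have cu : cauchy (u @ \oo).
  apply: cauchy_exP => eps eps0.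
  have [j jeps] : exists j, D * q ^+ j / (1 - q) < eps.
    have [|j] := @expr_small q (eps * (1 - q) / (D + 1)) q01.
      by rewrite divr_gt0 ?mulr_gt0 //; lra.
    rewrite ltr_pdivlMr; last lra.
    move=> qj; exists j; rewrite ltr_pdivrMr //; apply: le_lt_trans qj.
    by rewrite mulrC ler_wpM2l ?exprn_ge0 //; lra.
  exists (u j), j => // i /= ji; rewrite -ball_normE /=.
  rewrite distrC; apply: le_lt_trans (norm_le_enorm _) _.
  by apply: le_lt_trans jeps; rewrite -(subnK ji).
have /cvg_ex[l /= ul] : cvg (u @ \oo) by exact: cauchy_cvg.
exists l => j; apply/ler_addgt0Pl => eps eps0.
have eps2 : 0 < eps / 2 by lra.
move/cvgrPdist_le : ul => /(_ _ eps2)[N _ Nu].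
apply: le_trans (enorm_tri (u (N + j)%N) _ _) _; apply: lerD (uij _ _).
apply: le_trans (enorm_le_norm _) _.
by have := Nu (N + j)%N (leq_addr _ _) => /=; lra.
Qed.

End Geometric.

(** * Topology expressed through the Euclidean norm *)

Section Continuity.
Context {R : realType}.
Implicit Types (c z x y e : 'rV[R]_4).

Lemma nbhs_enormP x (A : set 'rV[R]_4) :
  nbhs x A <-> exists2 d : R, 0 < d & forall y, enorm (y - x) < d -> A y.
Proof.
split=> [/nbhs_ballP[d d0 dA]|[d d0 dA]].
  exists d => // y yx; apply: dA; rewrite -ball_normE /= distrC.
  exact: le_lt_trans (norm_le_enorm _) yx.
apply/nbhs_ballP; exists (d / 2) => /=; first by rewrite divr_gt0.
move=> y; rewrite -ball_normE /= distrC => yx; apply: dA.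
by apply: le_lt_trans (enorm_le_norm _) _; lra.
Qed.

Lemma continuous_enormP (V : normedModType R) (f : 'rV[R]_4 -> V) x :
  {for x, continuous f} <-> forall eps, 0 < eps ->
    exists2 d : R, 0 < d & forall y, enorm (y - x) < d -> `|f y - f x| <= eps.
Proof.
split=> [/cvgrPdist_le cf eps eps0|cf].
  by have /nbhs_enormP[d d0 dA] := cf _ eps0; exists d => // y /dA; rewrite distrC.
apply/(@cvgrPdist_le _ _ _ _ (nbhs_filter x)) => eps eps0; have [d d0 dA] := cf _ eps0.
by apply/nbhs_enormP; exists d => // y /dA; rewrite distrC.
Qed.

Lemma lipschitz_continuous (V : normedModType R) (f : 'rV[R]_4 -> V) (k : R) :
  (forall x y, `|f x - f y| <= k * enorm (x - y)) -> continuous f.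
Proof.
move=> fk x; apply/continuous_enormP => eps eps0.
have k1 : 0 < `|k| + 1 by rewrite ltr_wpDl.
exists (eps / (`|k| + 1)); first by rewrite divr_gt0.
move=> y; rewrite ltr_pdivlMr // => yx; apply: le_trans (fk y x) _.
apply: le_trans (ltW yx); rewrite mulrC ler_wpM2l ?enorm_ge0 //.
by apply: le_trans (ler_norm k) _; rewrite lerDl.
Qed.

Lemma closed_eball c (r : R) : closed (eball c r).
Proof.
rewrite (_ : eball c r = (fun x => enorm (x - c)) @^-1` [set t | t <= r]) //.
apply: closed_comp; last exact: closed_le.
move=> x _; apply: (@lipschitz_continuous _ _ 1) => {}x y; rewrite mul1r.
by apply: le_trans (enorm_dist _ _) _; rewrite opprB addrA subrK.
Qed.

Lemma compact_closed_eball (A : set 'rV[R]_4) c (r : R) :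
  closed A -> compact (A `&` eball c r).
Proof.
move=> cA; apply: bounded_closed_compact; last first.
  by apply: closedI => //; exact: closed_eball.
exists (r + enorm c); split; first exact: num_real.
move=> M rM x [_ xc]; apply: le_trans (norm_le_enorm _) (ltW (le_lt_trans _ rM)).
by have := enormD (x - c) c; rewrite subrK; rewrite /eball /= in xc; lra.
Qed.

End Continuity.

(** Two nearly equal legs of a right triangle are close to [h / sqrt 2], and [1 / sqrt 2 > 2/3]:
    otherwise both legs would be below [7/10 h], and [2 * 49/100 < 1]. *)
Lemma legs_balanced (R : realType) (h b c : R) : 0 <= b -> 0 <= c ->
  h ^+ 2 = c ^+ 2 + b ^+ 2 -> `|b - c| <= h / 10 / 10 / 10 -> 2 * h <= 3 * b.
Proof.
rewrite ler_norml => b0 c0 E /andP[bc1 bc2]; rewrite leNgt; apply/negP => hb.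
have c7 : c ^+ 2 < (7/10 * h) ^+ 2 by rewrite ltr_sqr ?nnegrE //; lra.
have b7 : b ^+ 2 < (7/10 * h) ^+ 2 by rewrite ltr_sqr ?nnegrE //; lra.
have := sqr_ge0 h; rewrite exprMn in b7 c7; lra.
Qed.

(** By homogeneity. Flatness gives information only on vectors whose length is the current scale. *)
Lemma dot_scale (R : realType) (m N : 'rV[R]_4) (s c : R) : 0 < s ->
    (forall v, dot v m = 0 -> enorm v = s -> `|dot v N| <= c * s) ->
  forall v, dot v m = 0 -> `|dot v N| <= c * enorm v.
Proof.
move=> s0 sN v vm.
have [->|v0] := eqVneq v 0; first by rewrite !dotE normr0 enorm0 mulr0.
have nv := enorm_gt0 v0; pose k := s / enorm v.
have k0 : 0 < k by rewrite divr_gt0.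
have kE : k * enorm v = s by rewrite divfK ?gt_eqF.
have /sN : dot (k *: v) m = 0 by rewrite dotE vm mulr0.
rewrite enormZ gtr0_norm // kE => /(_ erefl).
by rewrite dotZl normrM gtr0_norm // => h; rewrite -(ler_pM2l k0) [leRHS]mulrCA kE.
Qed.

(* (E1) and (E2) for one half of the cone with axis [e], the constants being
   absorbed into the exponents: [nc_slope] and [nc_dense] are the two inclusions
   of (E1), and [nc_flat] is (E2) with a unit normal in place of the plane. *)
Record near_cone (R : realType) (S : set 'rV[R]_4) (e : 'rV[R]_4)
    (g a rho : R) : Prop := NearCone {
  nc_unit : dot e e = 1;
  nc_closed : closed S;
  nc_origin : S 0;
  nc_slope : forall x r, S x -> 0 < r <= rho -> enorm x <= 2 * r ->
    `| `|dot x e| - enorm (perp e x)| <= r `^ (1 + g + a);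
  nc_dense : forall z, dot z e = 0 -> 0 < enorm z <= rho ->
    exists2 x, S x & enorm (x - (z + enorm z *: e)) <= enorm z `^ (1 + g + a);
  nc_flat : forall x r, S x -> 0 < enorm x <= rho -> 0 < r <= enorm x `^ (1 + g) ->
    exists2 n, dot n n = 1 &
      (forall y, S y -> enorm (y - x) <= r -> `|dot (y - x) n| <= r `^ (1 + a)) /\
      (forall v, dot v n = 0 -> enorm v <= r -> exists2 y, S y &
         enorm (y - x) <= r /\ enorm (y - x - v) <= r `^ (1 + a)) }.

Section Sheet.
Context {R : realType}.
Variables (S : set 'rV[R]_4) (e : 'rV[R]_4) (g a rho : R).
Hypothesis nc : near_cone S e g a rho.
Hypotheses (a0 : 0 < a) (a1 : a <= 1) (ag : a <= g).
Hypothesis rho1 : rho <= 1.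

(* Sum of the geometric series of the errors [(2^-j) `^ a] made at dyadic scales. *)
Definition lam : R := (1 - 2^-1 `^ a)^-1.
(** Three decimals suffice to control the normals; five make the constant [256] of the tangent
    expansion harmless, as [256 / 10 ^ 5 <= 10 ^ -2]. *)
Hypothesis very_small : lam * rho `^ a <= 1/10/10/10/10/10.

Implicit Types (x y z v w n m p : 'rV[R]_4) (r s t : R).

Let small : lam * rho `^ a <= 1/10/10/10.
Proof. by have := very_small; lra. Qed.
Let e1 : dot e e = 1 := nc_unit nc.
Let g0 : 0 < g := lt_le_trans a0 ag.

Let q_bound : 0 < (2^-1 : R) `^ a < 1.
Proof.
rewrite powR_gt0 ?invr_gt0 //=.
by have := @gt0_ltr_powR _ a a0 2^-1 1; rewrite powR1; apply; rewrite ?nnegrE; lra.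
Qed.

Lemma lam_ge1 : 1 <= lam.
Proof. by have /andP[q0 q1] := q_bound; rewrite invf_cp1 ?posrE ?subr_gt0 //; lra. Qed.

Let lam1 := lam_ge1.

Lemma powR_small_scale t : 0 <= t <= rho -> lam * t `^ a <= 1/10/10/10.
Proof.
move=> /andP[t0 tr]; apply: le_trans small.
by apply: ler_wpM2l; [exact: le_trans lam1|exact: ler_powRl (ltW a0) _ _].
Qed.

Lemma powR_small_scale1 t : 0 <= t <= rho -> t `^ a <= 1/10/10/10.
Proof.
move=> /powR_small_scale; apply: le_trans.
by rewrite ler_peMl ?powR_ge0.
Qed.

Let tg t : 0 <= t <= rho -> t `^ g <= t `^ a.
Proof. by move=> /andP[t0 tr]; rewrite ler_powRr ?a0 ?t0 //= (le_trans tr). Qed.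

Lemma scale_le t : 0 <= t <= rho -> t `^ (1 + g) <= t / 10 / 10 / 10.
Proof.
move=> ht; have /andP[t0 tr] := ht; rewrite powR1D //.
have := tg ht; have := powR_small_scale1 ht => h1 h2.
by have := ler_wpM2l t0 (le_trans h2 h1); lra.
Qed.

Lemma scaleD t : t `^ (1 + g + a) = t `^ (1 + g) * t `^ a.
Proof. by rewrite powRDp // addr_gt0. Qed.

Lemma sheet_near x : S x -> 0 < enorm x <= rho ->
  [/\ `| `|dot x e| - enorm (perp e x)| <= enorm x `^ (1 + g + a),
      2 * enorm x <= 3 * `|dot x e|, 2 * enorm x <= 3 * enorm (perp e x) &
      enorm (perp e x) <= enorm x].
Proof.
move=> Sx xr; have /andP[x0 xr'] := xr; have xr0 : 0 <= enorm x <= rho by rewrite ltW.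
have sl : `| `|dot x e| - enorm (perp e x)| <= enorm x `^ (1 + g + a).
  by apply: (nc_slope nc) => //; lra.
have := scale_le xr0; have := powR_small_scale1 xr0 => h1 h2.
have h3 : enorm x `^ (1 + g + a) <= enorm x / 10 / 10 / 10.
  by rewrite scaleD -[leRHS]mulr1 ler_pM ?powR_ge0 //; lra.
have := pythagoras e1 x; rewrite -[dot x e ^+ 2]real_normK ?num_real // => E.
have sl' := le_trans sl h3; split => //; last exact: enorm_perp.
  by apply: legs_balanced E sl'; rewrite ?enorm_ge0.
by rewrite distrC in sl'; apply: legs_balanced sl'; rewrite ?enorm_ge0 // E addrC.
Qed.

(** The gradient at [x] of [<x, e> - |P x|], a defining function of the half cone. It depends only
    on the direction of [P x], has component 1 along [e], and has length [sqrt 2]. *)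
Definition cone_normal x := e - (enorm (perp e x))^-1 *: perp e x.

Lemma cone_normalP x : perp e x != 0 ->
  dot (cone_normal x) e = 1 /\ enorm (cone_normal x) <= 3/2.
Proof.
move=> px; have dpx := dot_perp e1 x; have p0 := enorm_gt0 px.
rewrite /cone_normal; move: (perp e x) dpx p0 => p dpx p0.
split; first by rewrite !dotE dpx e1 mulr0 subr0.
apply: enorm_le_sqr; first lra.
rewrite !dotE (dotC e p) dpx e1 -sqr_enorm mulr0 oppr0 addr0 opprK add0r.
have -> : (enorm p)^-1 * ((enorm p)^-1 * enorm p ^+ 2) = 1.
  by field; rewrite gt_eqF.
by lra.
Qed.

(** Both [x] and a point [y] of [S] near [x + v] satisfy (E1) up to [s |x| ^ a], where
    [s = |x| ^ (1 + g)]; subtracting, [v] is almost tangent to the cone. The errors, in units of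
    [s |x| ^ a], are 2 from (E1), 2 from replacing [y] by [x + v], and 3 from the curvature of the
    cone. *)
Lemma top_normal x : S x -> 0 < enorm x <= rho -> 0 < dot x e ->
  forall m, (forall v, dot v m = 0 -> enorm v <= enorm x `^ (1 + g) ->
     exists2 y, S y & enorm (y - x) <= enorm x `^ (1 + g) /\
       enorm (y - x - v) <= (enorm x `^ (1 + g)) `^ (1 + a)) ->
  forall v, dot v m = 0 -> `|dot v (cone_normal x)| <= 8 * enorm x `^ a * enorm v.
Proof.
move=> Sx xr xe m mS; have /andP[x0 xr'] := xr.
have xr0 : 0 <= enorm x <= rho by rewrite ltW.
have [sx de pe pX] := sheet_near Sx xr; rewrite (gtr0_norm xe) in sx de.
set X := enorm x in xr xr' x0 xr0 sx mS de pe pX *.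
set s := X `^ (1 + g) in mS; have s0 : 0 < s by rewrite powR_gt0.
have sX : s <= X / 10 / 10 / 10 by exact: scale_le.
apply: (dot_scale s0) => v vm vs.
have [|y Sy [yx yxv]] := mS v vm; first by rewrite vs.
have y2 : enorm y <= 2 * X.
  by have := enormD (y - x) x; rewrite subrK -/X; lra.
have := nc_slope nc Sy xr y2.
(* [y] lies on the same half as [x], since [|y - x| <= s] is far below [<x, e>]; this removes the
   absolute value from (E1). *)
have ye : 0 < dot y e.
  have := dot_unit_le e1 (y - x); rewrite !dotE ler_norml => /andP[]. lra.
rewrite (gtr0_norm ye) => sy.
have pnz : perp e x != 0.
  by apply/eqP => p0; move: pe; rewrite p0 enorm0; lra.
have p0 := enorm_gt0 pnz.
have := @enorm_expand _ (perp e x) (perp e v) pnz.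
have dperp w : dot (perp e w) (perp e x) = dot w (perp e x).
  by rewrite {1}/perp !dotDl dotNl dotZl (dotC e) (dot_perp e1) mulr0 subr0.
have pv := enorm_perp e1 v; rewrite vs in pv.
have pv2 : 2 * enorm (perp e v) ^+ 2 / enorm (perp e x) <= 3 * s * X `^ a.
  rewrite ler_pdivrMr //; apply: (@le_trans _ _ (2 * s ^+ 2)).
    by rewrite ler_pM2l // ler_sqr ?nnegrE ?enorm_ge0 // ltW.
  rewrite expr2 {2}/s (powR1D (ltW x0) g0).
  have := tg xr0 => h; have := powR_ge0 X g => h'.
  have : X * X `^ g <= (3/2 * enorm (perp e x)) * X `^ a by apply: ler_pM => //; lra.
  move=> /(ler_wpM2l (ltW s0)). lra.
move=> /le_trans/(_ pv2); rewrite -perpD dperp.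
have sa : s `^ (1 + a) <= s * X `^ a.
  by rewrite (powR1D (ltW s0) a0) ler_pM2l // ler_powRl ?(ltW a0) ?(ltW s0) //; lra.
have d1 : `|dot (y - x - v) e| <= s * X `^ a.
  exact: le_trans (dot_unit_le e1 _) (le_trans yxv sa).
have d2 : `|enorm (perp e y) - enorm (perp e (x + v))| <= s * X `^ a.
  apply: le_trans (enorm_dist _ _) _; rewrite -perpB opprD addrA.
  exact: le_trans (enorm_perp e1 _) (le_trans yxv sa).
move: sx sy d1 d2; rewrite scaleD -/s !dotDl !dotNl.
rewrite /cone_normal dotDr dotNr dotZr.
have -> : (enorm (perp e x))^-1 * dot v (perp e x) = dot v (perp e x) / enorm (perp e x) by rewrite mulrC.
set A := dot v (perp e x) / _; set B := s * X `^ a; rewrite -!mulrA [X `^ a * s]mulrC -/B.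
by rewrite !ler_norml; lra.
Qed.


Definition dense_along x r m := forall v, dot v m = 0 -> enorm v <= r ->
  exists2 y, S y & enorm (y - x) <= r /\ enorm (y - x - v) <= r `^ (1 + a).

(** The content of [nc_flat] at one scale, for a normal with component 1 along [e] in place of a
    unit normal. The bound 2 on its length is the price of this scaling and accounts for the factor
    2 in the flatness. *)
Definition tangent_at x r n := [/\ dot n e = 1, enorm n <= 2,
  forall y, S y -> enorm (y - x) <= r -> `|dot (y - x) n| <= 2 * r `^ (1 + a) &
  dense_along x r n].

(** Inductive step for the normals: the plane given by (E2) at scale [r] is oriented by a vector [N]
    already known, which is the normal of the cone at the top scale and the normal of the previous
    scale below it. *)
Lemma tangent_of_normal x r N c : S x -> 0 < enorm x <= rho ->
    0 < r <= enorm x `^ (1 + g) -> dot N e = 1 ->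
    0 <= c <= 16^-1 -> enorm N + 4 * c <= 2 ->
    (forall m, dense_along x r m ->
       forall v, dot v m = 0 -> `|dot v N| <= c * enorm v) ->
  exists2 n, tangent_at x r n & enorm (n - N) <= 4 * c.
Proof.
move=> Sx xr rs Ne c01 Nc mN; have [m mm [m_flat m_dense]] := nc_flat nc Sx xr rs.
have m0 : m != 0.
  by apply/eqP => m0; move: mm; rewrite m0 !dotE => /esym/eqP; rewrite oner_eq0.
have /andP[c0 _] := c01.
have [|me mc] := normal_close e1 Ne _ m0 c01 (mN m m_dense); first by lra.
exists ((dot m e)^-1 *: m) => //.
have n2 : enorm ((dot m e)^-1 *: m) <= 2.
  by have := enormD ((dot m e)^-1 *: m - N) N; rewrite subrK; lra.
have m1 : enorm m = 1 by rewrite enormE mm sqrtr1.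
split => //; first by rewrite dotE mulVf.
  move=> y Sy yx; rewrite dotZr normrM; move: n2; rewrite enormZ m1 mulr1 => n2.
  by rewrite ler_pM // m_flat.
move=> v; rewrite dotZr => /eqP; rewrite mulf_eq0 invr_eq0 (negPf me) => /eqP.
exact: m_dense.
Qed.

(** Vectors of the finer plane are approximated by points of [S], and these lie in the slab of the
    coarser one. Relative to the length [r / 2], the slab contributes [4 r ^ a] and the
    approximation [2 r ^ a]. *)
Lemma tangent_half x r n m : 0 < r -> tangent_at x r n -> dense_along x (r / 2) m ->
  forall v, dot v m = 0 -> `|dot v n| <= 6 * r `^ a * enorm v.
Proof.
move=> r0 [ne n2 n_flat _] m_dense; have r20 : 0 < r / 2 by lra.
apply: (dot_scale r20) => v vm vr.
have [|y Sy [yx yxv]] := m_dense v vm; first by rewrite vr.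
have h1 : `|dot (y - x) n| <= 2 * r `^ (1 + a) by apply: n_flat => //; lra.
have h2 : `|dot (y - x - v) n| <= r / 2 * r `^ a * 2.
  apply: le_trans (dot_le _ _) _; apply: ler_pM => //; rewrite ?enorm_ge0 //.
  apply: le_trans yxv _; rewrite (powR1D (ltW r20) a0) ler_pM2l //.
  by rewrite ler_powRl ?(ltW a0) ?(ltW r20) //; lra.
rewrite (powR1D (ltW r0) a0) in h1.
have -> : dot v n = dot (y - x) n - dot (y - x - v) n by rewrite !dotE; ring.
by have := ler_normB (dot (y - x) n) (dot (y - x - v) n); lra.
Qed.

Lemma tangent_compare x r n n' : 0 < r <= rho -> tangent_at x r n ->
  tangent_at x (r / 2) n' -> enorm (n' - n) <= 24 * r `^ a.
Proof.
move=> /andP[r0 rr] Tn [n'e _ _ n'_dense]; have [ne n2 _ _] := Tn.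
have rr0 : 0 <= r <= rho by rewrite ltW.
have c01 : 0 <= 6 * r `^ a <= 16^-1.
  by have := powR_small_scale1 rr0; have := powR_ge0 r a; lra.
have n'0 : n' != 0.
  by apply/eqP => n0; move: n'e; rewrite n0 !dotE => /esym/eqP; rewrite oner_eq0.
have [_] := normal_close e1 ne n2 n'0 c01 (tangent_half r0 Tn n'_dense).
by rewrite n'e invr1 scale1r; lra.
Qed.

Let q : R := 2^-1 `^ a.

Lemma powR_dyadic s j : 0 <= s -> (s / 2 ^+ j) `^ a = s `^ a * q ^+ j.
Proof.
move=> s0; rewrite -exprVn powRM ?exprn_ge0 ?invr_ge0 //; congr (_ * _).
have q2 : 0 <= 2^-1 :> R by rewrite invr_ge0.
by rewrite -(powR_mulrn j q2) -(powR_mulrn j (powR_ge0 _ _)) powRAC.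
Qed.

Let lamK : lam * (1 - q) = 1.
Proof. by have /andP[q0 q1] := q_bound; rewrite mulVf // gt_eqF // subr_gt0. Qed.

(** The distance to the normal of the cone is carried along the induction because it is what keeps
    [|n|] low enough for the next plane to be oriented. [32 = 4 * 8] comes from [top_normal] and
    [24 = 4 * 6] from [tangent_half], through [normal_close]. *)
Lemma tangent_chain x j : S x -> 0 < enorm x <= rho -> 0 < dot x e ->
  exists2 n, tangent_at x (enorm x `^ (1 + g) / 2 ^+ j) n &
    enorm (n - cone_normal x) <= 32 * enorm x `^ a +
      24 * lam * (enorm x `^ (1 + g)) `^ a * (1 - q ^+ j).
Proof.
move=> Sx xr xe; have /andP[x0 xr'] := xr.
have xr0 : 0 <= enorm x <= rho by rewrite ltW.
have [sx de pe pX] := sheet_near Sx xr.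
have pnz : perp e x != 0.
  by apply/eqP => p0; move: pe; rewrite p0 enorm0; lra.
have [Ne N32] := cone_normalP pnz.
have := powR_small_scale1 xr0; have := powR_small_scale xr0; have := scale_le xr0.
set X := enorm x in xr xr' x0 xr0 sx de pe pX *; set N := cone_normal x in Ne N32 *.
move=> sX lX aX; have X0 := powR_ge0 X a.
set s := X `^ (1 + g) in sX *; have s0 : 0 < s by rewrite powR_gt0.
have [q0 q1] : 0 < q /\ q < 1 by apply/andP.
have sa : s `^ a <= X `^ a by rewrite ler_powRl ?(ltW a0) ?(ltW s0) //; lra.
have sa0 := powR_ge0 s a.
have lsa : lam * s `^ a <= lam * X `^ a by rewrite ler_wpM2l // (le_trans ler01).
have lsa0 : 0 <= lam * s `^ a by rewrite mulr_ge0 // (le_trans ler01).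
elim: j => [|j [n Tn nN]].
  rewrite expr0 divr1 subrr mulr0 addr0.
  have [||||n Tn nN] := @tangent_of_normal x s N (8 * X `^ a) Sx xr _ Ne.
  - by rewrite s0 lexx.
  - by lra.
  - by lra.
  - by move=> m; exact: top_normal.
  by exists n => //; lra.
have -> : s / 2 ^+ j.+1 = s / 2 ^+ j / 2 by rewrite exprS invfM mulrCA mulrC.
have rja := powR_dyadic j (ltW s0).
have [r rE] : exists r, r = s / 2 ^+ j by exists (s / 2 ^+ j).
have r0 : 0 < r by rewrite rE divr_gt0 // exprn_gt0.
have rs : r <= s.
  by rewrite rE ler_pdivrMr ?exprn_gt0 // ler_peMr ?(ltW s0) // exprn_ege1 // ler1n.
rewrite -rE in Tn rja *; clear rE.
have [ne n2 _ _] := Tn.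
have qj0 : 0 < q ^+ j by rewrite exprn_gt0.
have qj1 : q ^+ j <= 1 by rewrite exprn_ile1 ?(ltW q0) ?(ltW q1).
have rjs' : r `^ a <= s `^ a by rewrite rja ler_piMr.
have ra0 := powR_ge0 r a.
(* Since [lam (1 - q) = 1], the partial sums of the geometric series grow by exactly the error at
   scale [j]. *)
have qlam : 24 * lam * s `^ a * (1 - q ^+ j.+1) =
    24 * lam * s `^ a * (1 - q ^+ j) + 24 * r `^ a.
  rewrite rja exprS -[s `^ a * q ^+ j in RHS]mul1r -[X in _ + 24 * (X * _)]lamK.
  by ring.
have lq : lam * s `^ a * (1 - q ^+ j) <= lam * s `^ a by rewrite ler_piMr // gerBl ltW.
(* [56 = 32 + 24]; the bound leaves the margin below 2 that [tangent_of_normal] asks for. *)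
have n_bound : enorm n <= 3/2 + 56/10/10/10.
  by have := enormD (n - N) N; rewrite subrK; lra.
have [||||n' Tn' n'n] := @tangent_of_normal x (r / 2) n (6 * r `^ a) Sx xr _ ne.
- by rewrite divr_gt0 //=; apply: le_trans rs; lra.
- by lra.
- by lra.
- by move=> m; exact: tangent_half.
exists n' => //; apply: le_trans (enorm_tri n _ _) _.
by rewrite qlam; lra.
Qed.

Lemma powR_scale4 t r : 0 < r -> r <= 4 * t ->
  r `^ a <= 4 * t `^ a /\ r * r `^ a <= 16 * t `^ (1 + a).
Proof.
move=> r0 rt; have t0 : 0 < t by lra.
have ra : r `^ a <= 4 * t `^ a.
  apply: le_trans (ler_powRl (ltW a0) (ltW r0) rt) _.
  rewrite powRM ?(ltW t0) // ler_wpM2r ?powR_ge0 //.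
  by rewrite -[leRHS]powRr1 // ler_powR // ler1n.
split => //; rewrite (powR1D (ltW t0) a0).
have -> : 16 * (t * t `^ a) = 4 * t * (4 * t `^ a) by ring.
by apply: ler_pM rt ra; rewrite ?powR_ge0 ?ltW.
Qed.

(** At a scale [r] comparable to [|y - x|], flatness costs [2 r ^ (1 + a)] and passing from [u] to
    the limit normal [n] costs [12 lam r ^ (1 + a)]; then [r ^ (1 + a) <= 16 |y - x| ^ (1 + a)]. *)
Lemma tangent_close_dot x r u n y : tangent_at x r u ->
    enorm (n - u) <= 24 * lam * r `^ a -> 0 < r <= rho ->
    enorm (y - x) <= r / 2 -> r <= 4 * enorm (y - x) -> S y ->
  `|dot (y - x) n| <= 256 * lam * enorm (y - x) `^ (1 + a).
Proof.
move=> [_ _ u_flat _] un /andP[r0 rr]; set t := enorm (y - x) => tr rt Sy.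
have tr' : t <= r by lra.
have h1 := u_flat y Sy tr'; rewrite (powR1D (ltW r0) a0) in h1.
have h2 : `|dot (y - x) (n - u)| <= r / 2 * (24 * lam * r `^ a).
  by apply: le_trans (dot_le _ _) _; rewrite ler_pM ?enorm_ge0.
have [_ h3] := powR_scale4 r0 rt; have ta0 := powR_ge0 t (1 + a).
have h5 := ler_wpM2r ta0 lam1; rewrite mul1r in h5.
have h6 := ler_wpM2l (le_trans ler01 lam1) h3.
have -> : dot (y - x) n = dot (y - x) u + dot (y - x) (n - u).
  by rewrite -dotDr [u + _]addrC subrK.
by apply: le_trans (ler_normD _ _) _; lra.
Qed.

Lemma tangent_close_dense x r u n v : tangent_at x r u ->
    enorm (n - u) <= 24 * lam * r `^ a -> 0 < r <= rho ->
    enorm v <= r / 2 -> r <= 4 * enorm v -> dot v n = 0 ->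
  exists2 y, S y & enorm (y - x - v) <= 256 * lam * enorm v `^ (1 + a).
Proof.
move=> [ue _ _ u_dense] un /andP[r0 rr]; set t := enorm v => tr rt vn.
have r1 : lam * r `^ a <= 1 / 10 / 10 / 10 by apply: powR_small_scale; rewrite (ltW r0).
have vu : `|dot v u| <= r / 2 * (24 * lam * r `^ a).
  have -> : dot v u = - dot v (n - u) by rewrite dotDr dotNr vn sub0r opprK.
  by rewrite normrN; apply: le_trans (dot_le _ _) _; rewrite ler_pM ?enorm_ge0.
have h6 := ler_wpM2l (ltW r0) r1.
(* [v] belongs to the limit plane; sliding it along [e] puts it into the plane of scale [r], at a
   cost of [|<v, u>| = |<v, n - u>|]. *)
have [||y Sy [_ yxv]] := u_dense (v - dot v u *: e).
- by rewrite dotDl dotNl dotZl (dotC e) ue mulr1 subrr.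
- by apply: le_trans (enorm_sub _ _) _; rewrite (enorm_scale_unit e1) -/t; lra.
exists y => //; have -> : y - x - v = (y - x - (v - dot v u *: e)) - dot v u *: e.
  by apply/rowP => i; rewrite !mxE; ring.
apply: le_trans (enorm_sub _ _) _; rewrite (enorm_scale_unit e1).
rewrite (powR1D (ltW r0) a0) in yxv.
have [_ h3] := powR_scale4 r0 rt; have ta0 := powR_ge0 t (1 + a).
have h5 := ler_wpM2r ta0 lam1; rewrite mul1r in h5.
have h7 := ler_wpM2l (le_trans ler01 lam1) h3.
by lra.
Qed.

(* The tangent plane is the limit of the planes of [tangent_chain]. *)
Lemma tangent_exists x : S x -> 0 < enorm x <= rho -> 0 < dot x e ->
  exists n, [/\ dot n e = 1, enorm n <= 2,
    enorm (n - cone_normal x) <= 56 * lam * enorm x `^ a,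
    forall y, S y -> enorm (y - x) <= enorm x `^ (1 + g) / 2 ->
      `|dot (y - x) n| <= 256 * lam * enorm (y - x) `^ (1 + a) &
    forall v, dot v n = 0 -> enorm v <= enorm x `^ (1 + g) / 2 ->
      exists2 y, S y & enorm (y - x - v) <= 256 * lam * enorm v `^ (1 + a)].
Proof.
move=> Sx xr xe; have /andP[x0 xr'] := xr.
have xr0 : 0 <= enorm x <= rho by rewrite ltW.
have [sx de pe pX] := sheet_near Sx xr.
have pnz : perp e x != 0.
  by apply/eqP => p0; move: pe; rewrite p0 enorm0; lra.
have [Ne N32] := cone_normalP pnz.
have := powR_small_scale1 xr0; have := powR_small_scale xr0; have := scale_le xr0.
have chain j := tangent_chain j Sx xr xe.
set X := enorm x in xr xr' x0 xr0 sx de pe pX chain *.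
set N := cone_normal x in Ne N32 chain *.
move=> sX lX aX; have X0 := powR_ge0 X a.
set s := X `^ (1 + g) in sX chain *; have s0 : 0 < s by rewrite powR_gt0.
have [q0 q1] : 0 < q /\ q < 1 by apply/andP.
have /boolp.choice[u u_chain] : forall j, exists n, tangent_at x (s / 2 ^+ j) n /\
    enorm (n - N) <= 32 * X `^ a + 24 * lam * s `^ a * (1 - q ^+ j).
  by move=> j; have [n] := chain j; exists n.
have rj0 j : 0 < s / 2 ^+ j by rewrite divr_gt0 // exprn_gt0.
have rjs j : s / 2 ^+ j <= s.
  by rewrite ler_pdivrMr ?exprn_gt0 // ler_peMr ?(ltW s0) // exprn_ege1 // ler1n.
have rja j := powR_dyadic j (ltW s0).
have [||n un] := @geometric_limit _ u (24 * s `^ a) q; first by rewrite ltW.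
  move=> j.
  rewrite -mulrA -rja; apply: tangent_compare (u_chain j).1 _.
    by rewrite rj0 /=; apply: le_trans (rjs j) _; lra.
  have -> : s / 2 ^+ j / 2 = s / 2 ^+ j.+1 by rewrite exprS invfM mulrCA mulrC.
  exact: (u_chain j.+1).1.
have {}un j : enorm (n - u j) <= 24 * lam * (s / 2 ^+ j) `^ a.
  by have := un j; rewrite rja -/lam /lam; lra.
have sa : s `^ a <= X `^ a by rewrite ler_powRl ?(ltW a0) ?(ltW s0) //; lra.
have lam0 : 0 <= lam := le_trans ler01 lam1.
have lsa := ler_wpM2l lam0 sa.
have nN : enorm (n - N) <= 56 * lam * X `^ a.
  have := un 0%N; have [_] := u_chain 0%N; rewrite expr0 divr1 subrr mulr0 addr0.
  by have := enorm_tri (u 0%N) n N; have := ler_wpM2r X0 lam1; lra.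
have n2 : enorm n <= 2 by have := enormD (n - N) N; rewrite subrK; lra.
have ne : dot n e = 1.
  have h j : `|dot n e - 1| <= 24 * lam * (s / 2 ^+ j) `^ a.
    have [[uje _ _ _] _] := u_chain j.
    have -> : dot n e - 1 = dot (n - u j) e by rewrite dotDl dotNl uje.
    exact: le_trans (dot_unit_le e1 _) (un j).
  apply/eqP; rewrite -subr_eq0 -normr_le0; apply/ler_addgt0Pl => eps eps0.
  have [|j] := @expr_small _ q (eps / (24 * lam * s `^ a + 1)) (introT andP (conj (ltW q0) q1)).
    by rewrite divr_gt0 // ltr_wpDl // !mulr_ge0 ?powR_ge0.
  rewrite ltr_pdivlMr; last by rewrite ltr_wpDl // !mulr_ge0 ?powR_ge0.
  move=> qj; apply: le_trans (h j) _; rewrite rja addr0.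
  have qj0 : 0 <= q ^+ j by rewrite exprn_ge0 ?ltW.
  by lra.
have pick t : 0 < t -> t <= s / 2 -> exists j r, [/\ t <= r / 2, r <= 4 * t,
    r = s / 2 ^+ j & 0 < r <= rho].
  move=> t0 ts; have [j [tj jt]] := dyadic_scale t0 ts.
  exists j, (s / 2 ^+ j); split => //.
  by rewrite rj0 /=; apply: le_trans (rjs j) _; lra.
exists n; split; [exact: ne|exact: n2|exact: nN| |].
  move=> y Sy; rewrite -/X -/s => ys.
  have [->|yx] := eqVneq y x.
    rewrite subrr dot0l normr0 enorm0 powR0 ?mulr0 ?lexx //.
    by rewrite gt_eqF // addr_gt0.
  have t0 : 0 < enorm (y - x) by rewrite enorm_gt0 // subr_eq0.
  have [j [r [tr rt rE rr]]] := pick _ t0 ys.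
  have [Tj _] := u_chain j; have unj := un j; rewrite -rE in Tj unj.
  exact: tangent_close_dot Tj unj rr tr rt Sy.
move=> v vn; rewrite -/X -/s => vs.
have [->|v0] := eqVneq v 0.
  exists x; first exact: Sx.
  rewrite subrr subr0 enorm0 powR0 ?mulr0 ?lexx //.
  by rewrite gt_eqF // addr_gt0.
have t0 := enorm_gt0 v0.
have [j [r [tr rt rE rr]]] := pick _ t0 vs.
have [Tj _] := u_chain j; have unj := un j; rewrite -rE in Tj unj.
exact: tangent_close_dense Tj unj rr tr rt vn.
Qed.

Lemma tangent_error_small t : 0 <= t <= rho ->
  256 * lam * t `^ (1 + a) <= t / 10 / 10.
Proof.
move=> /andP[t0 tr]; rewrite (powR1D t0 a0).
have lam0 : 0 <= lam := le_trans ler01 lam1.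
have := ler_wpM2l lam0 (ler_powRl (ltW a0) t0 tr) => h.
by have := ler_wpM2l t0 (le_trans h very_small); lra.
Qed.

End Sheet.

(** * Each half is a graph *)

Section PowerScale.
Context {R : realType}.
Implicit Types (c t b : R).

Lemma powR1_scale_le c t b : 1 <= c -> 0 <= t -> 0 <= b <= 1 ->
  (c * t) `^ b <= c * t `^ b.
Proof.
move=> c1 t0 /andP[b0 b1]; have c0 : 0 <= c := le_trans ler01 c1.
by rewrite powRM // ler_wpM2r ?powR_ge0 // -[leRHS]powRr1 // ler_powR.
Qed.

Lemma powR2_scale_le c t b : 1 <= c -> 0 <= t -> 0 < b <= 1 ->
  (c * t) `^ (1 + b) <= c ^+ 2 * t `^ (1 + b).
Proof.
move=> c1 t0 /andP[b0 b1]; have c0 : 0 <= c := le_trans ler01 c1.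
rewrite !powR1D ?mulr_ge0 // expr2.
have -> : c * c * (t * t `^ b) = c * t * (c * t `^ b) by ring.
by rewrite ler_wpM2l ?mulr_ge0 // powR1_scale_le // ltW.
Qed.

End PowerScale.

Record small_cone (R : realType) (S : set 'rV[R]_4) (e : 'rV[R]_4)
    (g a rho : R) : Prop := SmallCone {
  sc_near : near_cone S e g a rho;
  sc_a : 0 < a <= 1;
  sc_g : a <= g;
  sc_rho : 0 < rho <= 1;
  sc_small : lam a * rho `^ a <= 1/10/10/10/10/10 }.

Lemma lam_gt0 (R : realType) (a : R) : 0 < a -> 0 < lam a.
Proof.
move=> a0; rewrite invr_gt0 subr_gt0.
by have := @gt0_ltr_powR _ a a0 2^-1 1; rewrite powR1; apply; rewrite ?nnegrE; lra.
Qed.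

(** [y - x] is parallel to [e], and (E1) makes it shorter than [|x| ^ (1 + g) / 2], so the tangent
    plane at [x] applies. As [n] has component 1 along [e], flatness reads
    [|y - x| <= |y - x| / 100]. *)
Lemma sheet_unique (R : realType) (S : set 'rV[R]_4) (e : 'rV[R]_4) (g a rho : R)
    (x y : 'rV[R]_4) : small_cone S e g a rho ->
  S x -> S y -> 0 < enorm x <= rho -> 0 < enorm y <= rho ->
  0 < dot x e -> 0 < dot y e -> perp e x = perp e y -> x = y.
Proof.
move=> [nc /andP[a0 a1] ag /andP[rho0 rho1] tiny] Sx Sy xr yr xe ye xy.
have e1 := nc_unit nc; have /andP[x0 xr'] := xr.
have xr0 : 0 <= enorm x <= rho by rewrite ltW.
have [sx _ _ px] := sheet_near nc a0 ag rho1 tiny Sx xr.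
have [_ _ py _] := sheet_near nc a0 ag rho1 tiny Sy yr.
have sy : `| `|dot y e| - enorm (perp e y)| <= enorm x `^ (1 + g + a).
  by apply: (nc_slope nc Sy xr); rewrite -xy in py; clear -py px x0; lra.
have [n [ne _ _ n_flat _]] := tangent_exists nc a0 a1 ag rho1 tiny Sx xr xe.
have yxE : y - x = dot (y - x) e *: e.
  by rewrite {1}(perpE e (y - x)) perpB -xy subrr add0r.
have nE : enorm (y - x) = `|dot (y - x) e|.
  by rewrite yxE !dotE enormZ enorm_unit // e1 !mulr1.
have aX := powR_small_scale1 a0 tiny xr0; have sX := scale_le a0 ag rho1 tiny xr0.
have s0 := powR_ge0 (enorm x) (1 + g).
have d2 : enorm (y - x) <= 2 * (enorm x `^ (1 + g) * enorm x `^ a).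
  rewrite nE dotDl dotNl; move: sx sy.
  rewrite -xy (gtr0_norm xe) (gtr0_norm ye) (scaleD a0 ag).
  have -> : dot y e - dot x e = (dot y e - enorm (perp e x)) -
    (dot x e - enorm (perp e x)) by ring.
  move=> sx sy; apply: le_trans (ler_normB _ _) (le_trans (lerD sy sx) _).
  by clear; lra.
have d3 : enorm (y - x) <= enorm x `^ (1 + g) / 2.
  by apply: le_trans d2 _; have := ler_wpM2l s0 aX; clear -s0; lra.
have := n_flat y Sy d3; rewrite {1}yxE dotZl (dotC e) ne mulr1 -nE => h.
have yx0 := enorm_ge0 (y - x).
have yx_rho : 0 <= enorm (y - x) <= rho.
  by rewrite yx0 /=; clear -d3 sX xr' x0; lra.
have h' := le_trans h (tangent_error_small a0 tiny yx_rho).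
apply/esym/eqP; rewrite -subr_eq0; apply/eqP/enorm_eq0.
by clear -h' yx0; lra.
Qed.

(** (E1) provides only a point [p0] within [eta = |z| ^ (1 + g + a)] of the point [c] of the cone
    over [z]. The penalty [1/8 |p - p0|] keeps a minimizer [p] within [8 eta] of [p0], hence within
    [9 eta] of [c], well inside the ball and away from 0, where tangent planes are available. *)
Lemma sheet_exists (R : realType) (S : set 'rV[R]_4) (e : 'rV[R]_4) (g a rho : R)
    (z : 'rV[R]_4) : small_cone S e g a rho ->
    dot z e = 0 -> 0 < enorm z -> 2 * enorm z <= rho ->
  exists2 t, S (z + t *: e) & `|t - enorm z| <= 9 * enorm z `^ (1 + g + a).
Proof.
move=> [nc /andP[a0 a1] ag /andP[rho0 rho1] tiny] ze z0 zr.
have e1 := nc_unit nc; have g0 : 0 < g := lt_le_trans a0 ag.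
have zr1 : 0 < enorm z <= rho by rewrite z0 /=; lra.
have zr0 : 0 <= enorm z <= rho by rewrite ltW //=; lra.
have [p0 Sp0 p0c] := nc_dense nc ze zr1.
have [c cE] : exists c, c = z + enorm z *: e by eexists.
have [eta etaE] : exists eta, eta = enorm z `^ (1 + g + a) by eexists.
rewrite -etaE -cE in p0c *.
have scz := scale_le a0 ag rho1 tiny zr0; have acz := powR_small_scale1 a0 tiny zr0.
have eta_s : eta <= enorm z `^ (1 + g) / 10 / 10 / 10.
  rewrite etaE (scaleD a0 ag); have := ler_wpM2l (powR_ge0 (enorm z) (1 + g)) acz; lra.
have eta0 : 0 <= eta by rewrite etaE; exact: powR_ge0.
have ec : 7/5 * enorm z <= enorm c.
  rewrite -ler_sqr ?nnegrE ?enorm_ge0 ?mulr_ge0 ?enorm_ge0 //.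
  rewrite [leRHS]sqr_enorm cE !dotE (dotC e z) ze e1 -sqr_enorm.
  by have := sqr_ge0 (enorm z); lra.
have c2 : enorm c <= 2 * enorm z.
  by rewrite cE; apply: le_trans (enormD _ _) _; rewrite (enorm_scale_unit e1) ger0_norm ?enorm_ge0 //; lra.
have pc_perp : perp e c = z by rewrite cE (perp_add e1) (perp_id ze).
(* A minimizer of [Phi] lies over [z]: from any other point, a step along its
   tangent plane decreases [Phi]. *)
pose Phi p := enorm (perp e p - z) + 1/8 * enorm (p - p0).
have Phi_cont : continuous Phi.
  apply: (@lipschitz_continuous _ _ _ 2) => x y.
  have h1 := enorm_dist (perp e x - z) (perp e y - z).
  have -> : Phi x - Phi y = (enorm (perp e x - z) - enorm (perp e y - z)) +
     1/8 * (enorm (x - p0) - enorm (y - p0)) by rewrite /Phi; ring.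
  have h2 := enorm_dist (x - p0) (y - p0).
  have E w : x - w - (y - w) = x - y by rewrite opprB addrA subrK.
  have E' w : perp e x - w - (perp e y - w) = perp e (x - y).
    by rewrite perpB opprB addrA subrK.
  rewrite E in h2; rewrite E' in h1; have := enorm_perp e1 (x - y) => h3.
  apply: le_trans (ler_normD _ _) _; rewrite normrM (ger0_norm (_ : 0 <= 1 / 8)) ?divr_ge0 //.
  by have := enorm_ge0 (x - y); clear -h1 h2 h3; lra.
have A0 : (S `&` eball c (enorm z / 2)) !=set0.
  by exists p0; split => //; rewrite /eball /=; lra.
have cK : compact (S `&` eball c (enorm z / 2)).
  by apply: compact_closed_eball; exact: nc_closed nc.
have [p pA p_min] := EVT_min_rV A0 cK (continuous_subspaceT Phi_cont).
rewrite inE in pA; have [Sp _] := pA.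
have Phi0 : Phi p <= eta.
  have p0A : p0 \in S `&` eball c (enorm z / 2).
    by rewrite inE; split => //; rewrite /eball /=; lra.
  apply: le_trans (p_min _ p0A) _.
  rewrite /Phi subrr enorm0 mulr0 addr0 -{1}pc_perp -perpB.
  exact: le_trans (enorm_perp e1 _) p0c.
have d0 := enorm_ge0 (perp e p - z); have pp0 := enorm_ge0 (p - p0).
have pc : enorm (p - c) <= 9 * eta.
  by have := enorm_tri p0 p c; rewrite /Phi in Phi0; lra.
have p_ge : enorm z <= enorm p by have := enorm_dist p c; rewrite ler_norml => /andP[]; lra.
have p_le : enorm p <= rho.
  have c32 : enorm c <= 3/2 * enorm z.
    apply: enorm_le_sqr; first by rewrite mulr_ge0 ?enorm_ge0.
    rewrite cE !dotE (dotC e z) ze e1 -sqr_enorm.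
    by have := sqr_ge0 (enorm z); lra.
  by have := enorm_dist p c; rewrite ler_norml => /andP[]; lra.
have pe0 : dot (p - c) e <= 9 * eta /\ - (9 * eta) <= dot (p - c) e.
  have := le_trans (dot_unit_le e1 (p - c)) pc.
  by rewrite ler_norml => /andP[].
have ce : dot c e = enorm z by rewrite cE !dotE ze e1; ring.
have pe : 0 < dot p e by rewrite dotDl dotNl ce in pe0; lra.
have pr : 0 < enorm p <= rho by rewrite p_le andbT; lra.
suff dE : perp e p - z = 0.
  exists (dot p e); first by rewrite -(subr0_eq dE) -perpE.
  by rewrite -ce -dotNl -dotDl; apply: le_trans (dot_unit_le e1 _) pc.
apply/eqP; apply: contraT => dn0; have dpos := enorm_gt0 dn0.
have [n [ne n2 _ _ n_dense]] := tangent_exists nc a0 a1 ag rho1 tiny Sp pr pe.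
set w := z - perp e p; have wd : enorm w = enorm (perp e p - z) by rewrite enormB.
have we : dot w e = 0 by rewrite /w dotDl dotNl ze (dot_perp e1) subr0.
(* The tangent vector at [p] with horizontal part exactly [w], the displacement still missing to
   reach [z]. *)
pose v := w - dot w n *: e.
have vn : dot v n = 0 by rewrite /v dotDl dotNl dotZl (dotC e) ne mulr1 subrr.
have v3 : enorm v <= 3 * enorm w.
  apply: le_trans (enorm_sub _ _) _; rewrite (enorm_scale_unit e1).
  by have := dot_le w n; have := ler_wpM2l (enorm_ge0 w) n2; clear; lra.
have szp : enorm z `^ (1 + g) <= enorm p `^ (1 + g).
  by rewrite ler_powRl ?enorm_ge0 // addr_ge0 // ltW.
have wz : enorm w <= eta by rewrite wd; rewrite /Phi in Phi0; clear -Phi0 pp0; lra.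
have w0 := enorm_ge0 w; have zs0 := powR_ge0 (enorm z) (1 + g).
have [|p' Sp' p'p] := n_dense v vn; first by clear -v3 wz eta_s szp zs0; lra.
have v_rho : 0 <= enorm v <= rho by rewrite enorm_ge0 /=; clear -v3 wz eta_s scz zr z0; lra.
have p'v := le_trans p'p (tangent_error_small a0 tiny v_rho).
have p'A : p' \in S `&` eball c (enorm z / 2).
  rewrite inE; split => //; rewrite /eball /=.
  have -> : p' - c = (p' - p - v) + (v + (p - c)).
    by apply/rowP => i; rewrite !mxE; ring.
  have := enormD (p' - p - v) (v + (p - c)); have := enormD v (p - c); have v0 := enorm_ge0 v.
  by clear -p'v v0 v3 wz pc eta_s scz z0; lra.
have p'perp : perp e p' - z = perp e (p' - p - v).
  by rewrite !perpB !(perpZ e1) (perp_id ze); apply/rowP => i; rewrite !mxE; ring.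
have p'p0 : enorm (p' - p0) <= enorm (p' - p - v) + enorm v + enorm (p - p0).
  have -> : p' - p0 = (p' - p - v) + v + (p - p0).
    by apply/rowP => i; rewrite !mxE; ring.
  by have := enormD (p' - p - v + v) (p - p0); have := enormD (p' - p - v) v; clear; lra.
(* The step gains [|w|] in the first term of [Phi]. It loses at most [3/8 |w|] in the penalty and a
   few hundredths of [|w|] in the approximation, which contradicts minimality. *)
have := p_min _ p'A; rewrite /Phi p'perp.
by have := enorm_perp e1 (p' - p - v); rewrite wd in v3; clear -p'v v3 dpos p'p0; lra.
Qed.

(** The left side equals [<y - x, n>] minus the second-order remainder of [|P x|]: the first is
    small by flatness, the second by [enorm_expand]. As only the horizontal distance [d] is
    controlled, [|y - x|] has to be bounded by it in two rounds. *)
Lemma sheet_taylor (R : realType) (S : set 'rV[R]_4) (e : 'rV[R]_4) (g a rho : R)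
    (x y n : 'rV[R]_4) : small_cone S e g a rho ->
    S x -> S y -> 0 < enorm x <= rho ->
    0 < dot x e -> 0 < dot y e -> enorm y <= 2 * enorm x ->
    dot n e = 1 -> enorm (n - cone_normal e x) <= 56 * lam a * enorm x `^ a ->
    (forall y, S y -> enorm (y - x) <= enorm x `^ (1 + g) / 2 ->
      `|dot (y - x) n| <= 256 * lam a * enorm (y - x) `^ (1 + a)) ->
    8 * enorm (perp e (y - x)) <= enorm (perp e x) `^ (1 + g) ->
  `|(dot y e - enorm (perp e y)) - (dot x e - enorm (perp e x)) -
      dot (y - x) (cone_normal e x - n)|
    <= 256 * 16 * lam a * enorm (perp e (y - x)) `^ (1 + a) +
       2 * enorm (perp e (y - x)) ^+ 2 / enorm (perp e x).
Proof.
move=> [nc /andP[a0 a1] ag /andP[rho0 rho1] tiny] Sx Sy xr xe ye yx ne nN n_flat d8.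
have e1 := nc_unit nc; have /andP[x0 xr'] := xr.
have xr0 : 0 <= enorm x <= rho by rewrite ltW.
have [sx _ pe px] := sheet_near nc a0 ag rho1 tiny Sx xr.
have sy := nc_slope nc Sy xr yx.
rewrite (gtr0_norm xe) in sx; rewrite (gtr0_norm ye) in sy.
have [d dE] : exists d, d = enorm (perp e (y - x)) by eexists.
rewrite -dE in d8 *; have d0 : 0 <= d by rewrite dE; exact: enorm_ge0.
have p0 : 0 < enorm (perp e x) by clear -x0 pe; lra.
have pnz : perp e x != 0.
  by apply/eqP => E; move: p0; rewrite E enorm0 ltxx.
have [Ne _] := cone_normalP nc pnz.
have pxs : enorm (perp e x) `^ (1 + g) <= enorm x `^ (1 + g).
  by rewrite ler_powRl ?enorm_ge0 // addr_ge0 // ltW // (lt_le_trans a0).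
have sX := scale_le a0 ag rho1 tiny xr0.
have sD := scaleD a0 ag (enorm x).
have aX := powR_small_scale1 a0 tiny xr0; have laX := powR_small_scale a0 tiny xr0.
have [s sE] : exists s, s = enorm x `^ (1 + g) by eexists.
have s0 : 0 <= s by rewrite sE powR_ge0.
rewrite -sE in sX pxs n_flat sD.
have sa : enorm x `^ (1 + g + a) <= s / 10 / 10 / 10.
  by rewrite sD; have := ler_wpM2l s0 aX; clear; lra.
have qp : `|enorm (perp e y) - enorm (perp e x)| <= d.
  by rewrite dE perpB; exact: enorm_dist.
have D : dot (y - x) e = dot y e - dot x e by rewrite dotDl dotNl.
have t_le : enorm (y - x) <= d + `|dot (y - x) e|.
  rewrite dE {1}(perpE e (y - x)); apply: le_trans (enormD _ _) _.
  by rewrite (enorm_scale_unit e1).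
(* First round: (E1) bounds the vertical displacement crudely, just enough to bring [y] into the
   range of the tangent plane at [x]. *)
have De : `|dot (y - x) e| <= d + s / 10 / 10 / 5.
  rewrite D; have -> : dot y e - dot x e = (enorm (perp e y) - enorm (perp e x)) +
    ((dot y e - enorm (perp e y)) - (dot x e - enorm (perp e x))) by ring.
  apply: le_trans (ler_normD _ _) (lerD qp _); apply: le_trans (ler_normB _ _) _.
  by apply: le_trans (lerD sy sx) _; clear -sa; lra.
have ts : enorm (y - x) <= s / 2 by clear -t_le De d8 pxs s0; lra.
have tr : 0 <= enorm (y - x) <= rho.
  by rewrite enorm_ge0 /=; clear -ts sX xr' x0; lra.
have n_y := n_flat y Sy ts.
have t_small := tangent_error_small a0 tiny tr.
have NnE : dot (y - x) (cone_normal e x - n) = dot (perp e (y - x)) (cone_normal e x - n).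
  by apply: dot_perpl; rewrite dotDl dotNl Ne ne subrr.
have G_le : `|dot (y - x) (cone_normal e x - n)| <= d / 10.
  rewrite NnE; apply: le_trans (dot_le _ _) _; rewrite -dE ler_wpM2l //.
  by rewrite enormB; clear -nN laX; lra.
have NE : dot (y - x) (cone_normal e x) =
    dot (y - x) e - dot (perp e (y - x)) (perp e x) / enorm (perp e x).
  rewrite /cone_normal dotDr dotNr dotZr [_^-1 * _]mulrC; congr (_ - _ / _).
  by rewrite (dot_perpl _ (dot_perp e1 x)).
have nE : dot (y - x) n = dot (y - x) (cone_normal e x) -
  dot (y - x) (cone_normal e x - n) by rewrite [in RHS]dotDr dotNr; ring.
have w_le : `|dot (perp e (y - x)) (perp e x) / enorm (perp e x)| <= d.
  by rewrite normrM normfV (gtr0_norm p0) ler_pdivrMr // dE; exact: dot_le.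
(* Second round: flatness shows that the slope is bounded. The factor 4 becomes the [16] of the
   statement. *)
have t4 : enorm (y - x) <= 4 * d.
  have De' : `|dot (y - x) e| <= enorm (y - x) / 10 / 10 + d / 10 + d.
    have -> : dot (y - x) e = dot (y - x) n + dot (y - x) (cone_normal e x - n) +
      dot (perp e (y - x)) (perp e x) / enorm (perp e x) by rewrite nE NE; ring.
    apply: le_trans (ler_normD _ _) (lerD _ w_le).
    exact: le_trans (ler_normD _ _) (lerD (le_trans n_y t_small) G_le).
  by clear -De' t_le d0; lra.
have lam0 : 0 <= 256 * lam a by rewrite mulr_ge0 ?ler0n // ltW // lam_gt0.
have n_d : `|dot (y - x) n| <= 256 * 16 * lam a * d `^ (1 + a).
  apply: le_trans n_y _.
  have h : enorm (y - x) `^ (1 + a) <= 16 * d `^ (1 + a).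
    apply: le_trans (_ : (4 * d) `^ (1 + a) <= _).
      by rewrite ler_powRl ?enorm_ge0 // addr_ge0 // ltW.
    apply: le_trans (powR2_scale_le _ d0 _) _; rewrite ?ler1n ?a0 //.
    by rewrite -natrX.
  by have := ler_wpM2l lam0 h; clear; lra.
have := @enorm_expand _ (perp e x) (perp e (y - x)) pnz.
rewrite -perpD [x + _]addrC subrK -dE.
have -> : dot y e - enorm (perp e y) - (dot x e - enorm (perp e x)) -
    dot (y - x) (cone_normal e x - n) =
  dot (y - x) n - (enorm (perp e y) - enorm (perp e x) -
     dot (perp e (y - x)) (perp e x) / enorm (perp e x)).
  by rewrite nE NE D; ring.
by move=> hB; apply: le_trans (ler_normB _ _) (lerD n_d hB).
Qed.

(** * Height function of a half *)

Definition taylor_on (R : realType) (r b K : R) (f : 'rV[R]_4 -> R)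
    (G : 'rV[R]_4 -> 'rV[R]_4) :=
  forall x y, enorm x <= r -> enorm y <= r ->
    `|f y - f x - dot (y - x) (G x)| <= K * enorm (y - x) `^ (1 + b).

Section SheetFunction.
Context {R : realType}.
Implicit Types (S : set 'rV[R]_4) (e x y z n : 'rV[R]_4) (g a rho d p q : R).

(** [f] is defined on the whole space, constant along [e], so that it can be evaluated at points of
    the cone and have a gradient in the ambient space. Off the range of [sheet_exists] its value is
    0. *)
Lemma sheet_height S e g a rho : small_cone S e g a rho ->
  exists f : 'rV[R]_4 -> R,
    [/\ forall x y, perp e x = perp e y -> f x = f y,
        forall x, perp e x = 0 -> f x = 0 &
        forall x, 0 < enorm (perp e x) -> 2 * enorm (perp e x) <= rho ->
          S (perp e x + (enorm (perp e x) + f x) *: e) /\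
          `|f x| <= 9 * enorm (perp e x) `^ (1 + g + a)].
Proof.
move=> sc; have e1 := nc_unit (sc_near sc).
have /boolp.choice[f0 f0P] : forall z, exists t, (z = 0 -> t = 0) /\
    (dot z e = 0 -> 0 < enorm z -> 2 * enorm z <= rho ->
     S (z + (enorm z + t) *: e) /\ `|t| <= 9 * enorm z `^ (1 + g + a)).
  move=> z; have [->|z0] := eqVneq z 0.
    by exists 0; split => // _; rewrite enorm0 ltxx.
  have [[ze zr]|nz] := pselect (dot z e = 0 /\ 2 * enorm z <= rho); last first.
    by exists 0; split => // ze _ zr; case: nz.
  have [t St tz] := sheet_exists sc ze (enorm_gt0 z0) zr.
  exists (t - enorm z); split => [E|_ _ _]; first by rewrite E eqxx in z0.
  have -> : enorm z + (t - enorm z) = t by ring.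
  by split.
exists (fun x => f0 (perp e x)); split => [x y -> //|x px|x px pr].
  exact: (f0P (perp e x)).1.
by apply: (f0P (perp e x)).2; rewrite ?(dot_perp e1).
Qed.

Lemma powR_ge1 a d : 0 <= a -> 1 <= d -> 1 <= d `^ a.
Proof. by move=> a0 d1; have := ler_powRl a0 ler01 d1; rewrite powR1. Qed.

(** For [b = a / (1 + g)], [(1 + g) (1 + b) = 1 + g + a] and [(1 + g) b = a]. *)
Lemma powR_far g a p d : 0 < a -> a <= g -> 0 <= p -> p `^ (1 + g) <= d ->
  p `^ (1 + g + a) <= d `^ (1 + a / (1 + g)) /\ p `^ a <= d `^ (a / (1 + g)).
Proof.
move=> a0 ag p0 pd; have g0 : 0 < 1 + g by lra.
have b0 : 0 < a / (1 + g) by rewrite divr_gt0.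
have E : (1 + g) * (a / (1 + g)) = a by rewrite mulrCA divff ?mulr1 // gt_eqF.
split.
  have -> : 1 + g + a = (1 + g) * (1 + a / (1 + g)) by rewrite mulrDr mulr1 E.
  by rewrite powRrM ler_powRl ?powR_ge0 // addr_ge0 // ltW.
by rewrite -{1}E powRrM ler_powRl ?powR_ge0 // ltW.
Qed.

(** The curvature of the cone blows up like [1 / p], but it is felt only up to the distance
    [p ^ (1 + g)]: with [b = a / (1 + g)], [d ^ (1 - b) <= p ^ (1 + g - a) <= p], because [a <= g]
    and [p <= 1]. *)
Lemma sqr_div_le g a p d : 0 < a -> a <= g -> 0 < p <= 1 -> 0 <= d ->
  d <= p `^ (1 + g) -> d ^+ 2 / p <= d `^ (1 + a / (1 + g)).
Proof.
move=> a0 ag /andP[p0 p1] d0 dp; have g0 : 0 < 1 + g by lra.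
have b0 : 0 < a / (1 + g) by rewrite divr_gt0.
have b1 : a / (1 + g) < 1 by rewrite ltr_pdivrMr //; lra.
have {}dp : d `^ (1 - a / (1 + g)) <= p.
  apply: (@le_trans _ _ ((p `^ (1 + g)) `^ (1 - a / (1 + g)))).
    by rewrite ler_powRl // subr_ge0 ltW.
  rewrite -powRrM mulrBr mulr1 mulrCA divff ?gt_eqF // mulr1 -[leRHS]powRr1 ?(ltW p0) //.
  by rewrite ler_powRr ?(ltW p0) //= ltr01 /=; lra.
rewrite ler_pdivrMr //.
have -> : d ^+ 2 = d `^ (1 + a / (1 + g)) * d `^ (1 - a / (1 + g)).
  rewrite -powRDp ?subr_gt0 ?addr_gt0 //.
  have -> : 1 + a / (1 + g) + (1 - a / (1 + g)) = 2%:R by ring.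
  by rewrite powR_mulrn.
by rewrite ler_wpM2l ?powR_ge0.
Qed.

(** The gradient is computed at the point [X x] of [S] over [P x], whose norm lies between [|P x|]
    and [3 |P x|]. Hence the restriction to [4 |P x| <= rho] and the factor 3 in the bound. *)
Lemma sheet_gradient S e g a rho (f : 'rV[R]_4 -> R) :
    small_cone S e g a rho ->
    (forall x, 0 < enorm (perp e x) -> 2 * enorm (perp e x) <= rho ->
       S (perp e x + (enorm (perp e x) + f x) *: e) /\
       `|f x| <= 9 * enorm (perp e x) `^ (1 + g + a)) ->
  exists G : 'rV[R]_4 -> 'rV[R]_4,
    (forall x, perp e x = 0 -> G x = 0) /\
    forall x, 0 < enorm (perp e x) -> 4 * enorm (perp e x) <= rho ->
      [/\ dot (G x) e = 0, enorm (G x) <= 56 * 3 * lam a * enorm (perp e x) `^ a &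
      forall y, 0 < enorm (perp e y) -> 4 * enorm (perp e y) <= rho ->
        8 * enorm (perp e (y - x)) <= enorm (perp e x) `^ (1 + g) ->
        `|f y - f x - dot (y - x) (G x)| <=
          256 * 16 * lam a * enorm (perp e (y - x)) `^ (1 + a) +
          2 * enorm (perp e (y - x)) ^+ 2 / enorm (perp e x)].
Proof.
move=> sc fP; have [nc /andP[a0 a1] ag /andP[rho0 rho1] tiny] := sc.
have e1 := nc_unit nc.
pose X x := perp e x + (enorm (perp e x) + f x) *: e.
have XP x : 0 < enorm (perp e x) -> 4 * enorm (perp e x) <= rho ->
    [/\ S (X x), `|f x| <= enorm (perp e x) / 10, perp e (X x) = perp e x,
        dot (X x) e = enorm (perp e x) + f x &
        enorm (perp e x) <= enorm (X x) <= 3 * enorm (perp e x)].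
  move=> p0 pr; have [|SX fx] := fP x p0; first by clear -p0 pr; lra.
  have pX : perp e (X x) = perp e x by rewrite /X (perp_add e1) (perp_id (dot_perp e1 x)).
  have fx' : `|f x| <= enorm (perp e x) / 10.
    have pr0 : 0 <= enorm (perp e x) <= rho by rewrite ltW //=; clear -p0 pr; lra.
    apply: le_trans fx _; rewrite (scaleD a0 ag).
    have h1 := scale_le a0 ag rho1 tiny pr0; have h2 := powR_small_scale1 a0 tiny pr0.
    have := ler_pM (powR_ge0 _ _) (powR_ge0 _ _) h1 h2.
    by clear -p0; lra.
  have dX : dot (X x) e = enorm (perp e x) + f x.
    by rewrite /X dotDl dotZl e1 mulr1 (dot_perp e1) add0r.
  split; [exact: SX|exact: fx'|exact: pX|exact: dX|apply/andP; split].
    by rewrite -{1}pX; exact: enorm_perp.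
  apply: le_trans (enormD _ _) _; rewrite (enorm_scale_unit e1).
  have := ler_normD (enorm (perp e x)) (f x); rewrite (gtr0_norm p0).
  by clear -fx' p0; lra.
have /boolp.choice[G GP] : forall x, exists Gx, (perp e x = 0 -> Gx = 0) /\
   (0 < enorm (perp e x) -> 4 * enorm (perp e x) <= rho ->
      [/\ dot Gx e = 0, enorm Gx <= 56 * 3 * lam a * enorm (perp e x) `^ a &
      forall y, 0 < enorm (perp e y) -> 4 * enorm (perp e y) <= rho ->
        8 * enorm (perp e (y - x)) <= enorm (perp e x) `^ (1 + g) ->
        `|f y - f x - dot (y - x) Gx| <=
          256 * 16 * lam a * enorm (perp e (y - x)) `^ (1 + a) +
          2 * enorm (perp e (y - x)) ^+ 2 / enorm (perp e x)]); last first.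
  exists G; split => x; first exact: (GP x).1.
  exact: (GP x).2.
move=> x; have [px0|pxn] := eqVneq (perp e x) 0.
  by exists 0; split => // ; rewrite px0 enorm0 ltxx.
have p0 := enorm_gt0 pxn.
have [pr|pr] := leP (4 * enorm (perp e x)) rho; last first.
  by exists 0; split => // _; rewrite leNgt pr.
have [SX fx pX dX /andP[X1 X3]] := XP x p0 pr.
have Xr : 0 < enorm (X x) <= rho.
  by apply/andP; split; clear -X1 X3 pr p0; lra.
have Xe : 0 < dot (X x) e.
  by move: fx; rewrite dX ler_norml => /andP[]; clear -p0; lra.
have [n [ne n2 nN n_flat _]] := tangent_exists nc a0 a1 ag rho1 tiny SX Xr Xe.
have NE : cone_normal e (X x) = cone_normal e x by rewrite /cone_normal pX.
have [Ne _] := cone_normalP nc pxn.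
exists (cone_normal e x - n); split => [E|_ _]; first by rewrite E eqxx in pxn.
have Ge : dot (cone_normal e x - n) e = 0 by rewrite dotDl dotNl Ne ne subrr.
split; [exact: Ge| |].
  rewrite enormB -NE; apply: le_trans nN _.
  have -> : 56 * 3 * lam a * enorm (perp e x) `^ a =
    56 * lam a * (3 * enorm (perp e x) `^ a) by ring.
  rewrite ler_wpM2l ?mulr_ge0 ?ler0n // ?(ltW (lam_gt0 a0)) //.
  apply: le_trans (ler_powRl (ltW a0) (enorm_ge0 _) X3) _.
  by apply: powR1_scale_le; rewrite ?ler1n ?(ltW p0) ?(ltW a0) ?a1.
move=> y q0 qr d8; have [SY fy pY dY /andP[Y1 Y3]] := XP y q0 qr.
have Ye : 0 < dot (X y) e.
  by move: fy; rewrite dY ler_norml => /andP[]; clear -q0; lra.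
have pYX : perp e (X y - X x) = perp e (y - x) by rewrite !perpB pX pY.
have YX : enorm (X y) <= 2 * enorm (X x).
  have qp : enorm (perp e y) <= enorm (perp e x) + enorm (perp e x) / 10 / 10.
    have := enorm_dist (perp e y) (perp e x); rewrite -perpB ler_norml => /andP[_].
    have pr0 : 0 <= enorm (perp e x) <= rho by rewrite ltW //=; clear -p0 pr; lra.
    by have := scale_le a0 ag rho1 tiny pr0; clear -d8 p0; lra.
  have YXE : X y = X x + (perp e (y - x) + (enorm (perp e y) - enorm (perp e x) +
      (f y - f x)) *: e).
    by rewrite /X perpB; apply/rowP => i; rewrite !mxE; ring.
  rewrite YXE; apply: le_trans (enormD _ _) _.
  have h1 := enormD (perp e (y - x))
    ((enorm (perp e y) - enorm (perp e x) + (f y - f x)) *: e).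
  rewrite (enorm_scale_unit e1) in h1.
  have h2 := ler_normD (enorm (perp e y) - enorm (perp e x)) (f y - f x).
  have h3 := ler_normB (f y) (f x).
  have h4 := enorm_dist (perp e y) (perp e x); rewrite -perpB in h4.
  have pr0 : 0 <= enorm (perp e x) <= rho by rewrite ltW //=; clear -p0 pr; lra.
  have h5 := scale_le a0 ag rho1 tiny pr0.
  by clear -h1 h2 h3 h4 h5 fx fy qp d8 X1 p0; lra.
have := @sheet_taylor _ S e g a rho (X x) (X y) n sc SX SY Xr Xe Ye YX ne nN n_flat.
rewrite pYX NE dX dY pX pY => /(_ d8).
have -> : dot (X y - X x) (cone_normal e x - n) = dot (y - x) (cone_normal e x - n).
  by rewrite (dot_perpl _ Ge) pYX -(dot_perpl _ Ge).
by rewrite [enorm _ + f y]addrC addrK [enorm _ + f x]addrC addrK.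
Qed.

Lemma sheet_function S e g a rho : small_cone S e g a rho ->
  exists (f : 'rV[R]_4 -> R) (G : 'rV[R]_4 -> 'rV[R]_4) (K : R),
    [/\ forall x y, perp e x = perp e y -> f x = f y,
        forall x, 2 * enorm (perp e x) <= rho ->
          S (perp e x + (enorm (perp e x) + f x) *: e),
        forall y, S y -> 4 * enorm y <= rho -> 0 < dot y e ->
          dot y e = enorm (perp e y) + f y,
        f 0 = 0 /\ G 0 = 0 &
        0 <= K /\ taylor_on (rho / 4) (a / (1 + g)) K f G].
Proof.
move=> sc; have [nc /andP[a0 a1] ag /andP[rho0 rho1] tiny] := sc.
have e1 := nc_unit nc; have perp0 : perp e 0 = 0 by rewrite (perp_id (dot0l e)).
have [f [f_perp f0 fP]] := sheet_height sc.
have [G [G0 GP]] := sheet_gradient sc fP.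
have g1 : 0 < 1 + g by clear -a0 ag; lra.
have b0 : 0 < a / (1 + g) by rewrite divr_gt0.
have b1 : a / (1 + g) <= 1 by rewrite ler_pdivrMr //; clear -ag; lra.
set b := a / (1 + g) in b0 b1 *; have b01 : 0 < b <= 1 by rewrite b0.
(* At large distance [d], both [|P x| ^ (1 + g)] and [|P y| ^ (1 + g)] are at most [c d]: [8] is the
   threshold in [sheet_gradient], and [|P y| <= 2 max(|P x|, d)] costs [2 ^ (1 + g)]. *)
pose c := 2 `^ (1 + g) * 8.
have c1 : 1 <= c.
  rewrite /c; have two1 : 1 <= 2 :> R by rewrite ler1n.
  by have := powR_ge1 (ltW g1) two1; clear; lra.
have l0 := lam_gt0 a0.
have c0 : 0 <= c := le_trans ler01 c1.
have [K KE] : exists K, K = 256 * 16 * lam a + 2 + 9 * c ^+ 2 + 9 * c ^+ 2 + 56 * 3 * lam a * c.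
  by eexists.
have K0 : 0 <= K.
  have := mulr_ge0 (ltW l0) c0; have := sqr_ge0 c.
  by rewrite KE; clear -l0; lra.
exists f, G, K; split; first exact: f_perp.
- move=> x pr; have [px0|pxn] := eqVneq (perp e x) 0.
    by rewrite f0 // px0 enorm0 addr0 scale0r addr0; exact: nc_origin nc.
  exact: (fP x (enorm_gt0 pxn) pr).1.
- move=> y Sy yr ye.
  have y0 : 0 < enorm y.
    by have := dot_unit_le e1 y; rewrite (gtr0_norm ye); clear -ye; lra.
  have yr' : 0 < enorm y <= rho by rewrite y0 /=; clear -yr y0; lra.
  have [_ _ p2 py] := sheet_near nc a0 ag rho1 tiny Sy yr'.
  have q0 : 0 < enorm (perp e y) by clear -y0 p2; lra.
  have [|SY fy] := fP y q0; first by clear -py yr y0; lra.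
  set Y := _ + _ *: e in SY.
  have pY : perp e Y = perp e y by rewrite /Y (perp_add e1) (perp_id (dot_perp e1 y)).
  have dY : dot Y e = enorm (perp e y) + f y.
    by rewrite /Y dotDl dotZl e1 mulr1 (dot_perp e1) add0r.
  have fy' : `|f y| <= enorm (perp e y) / 10.
    have pr0 : 0 <= enorm (perp e y) <= rho.
      by rewrite enorm_ge0 /=; clear -py yr y0; lra.
    apply: le_trans fy _; rewrite (scaleD a0 ag).
    have h1 := scale_le a0 ag rho1 tiny pr0; have h2 := powR_small_scale1 a0 tiny pr0.
    have := ler_pM (powR_ge0 _ _) (powR_ge0 _ _) h1 h2.
    by clear -q0; lra.
  have Ye : 0 < dot Y e.
    by move: fy'; rewrite dY ler_norml => /andP[]; clear -q0; lra.
  rewrite -dY; congr dot.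
  apply: (sheet_unique sc) => //.
  apply/andP; split.
    by have := dot_unit_le e1 Y; rewrite (gtr0_norm Ye); clear -Ye; lra.
  apply: le_trans (enormD _ _) _; rewrite (enorm_scale_unit e1) -dY (gtr0_norm Ye) dY.
  by have := ler_norm (f y); clear -fy' py yr y0; lra.
- by split; [rewrite f0 | rewrite G0].
split; first exact: K0.
move=> x y xr yr; set d := enorm (perp e (y - x)).
have p_le := enorm_perp e1 x; have q_le := enorm_perp e1 y.
have d0 : 0 <= d by exact: enorm_ge0.
suff dK : `|f y - f x - dot (y - x) (G x)| <=
    K * d `^ (1 + b).
  apply: le_trans dK (ler_wpM2l K0 (ler_powRl _ d0 (enorm_perp e1 _))).
  by rewrite addr_ge0 // ltW.
have D0 := powR_ge0 d (1 + b).
have lD : 0 <= lam a * d `^ (1 + b) by rewrite mulr_ge0 // ltW.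
have cD : 0 <= c ^+ 2 * d `^ (1 + b) by rewrite mulr_ge0 // exprn_ge0 // (le_trans ler01).
have lcD : 0 <= lam a * c * d `^ (1 + b) by rewrite !mulr_ge0 ?(ltW l0) // (le_trans ler01).
have dr : d <= rho by apply: le_trans (enorm_perp e1 _) _; have := enorm_sub y x; clear -xr yr rho0; lra.
have d1 : d <= 1 := le_trans dr rho1.
have p0 := enorm_ge0 (perp e x); have q0 := enorm_ge0 (perp e y).
have fle z : 4 * enorm (perp e z) <= rho -> `|f z| <= 9 * enorm (perp e z) `^ (1 + g + a).
  move=> zr; have [pz|pz] := eqVneq (perp e z) 0.
    by rewrite (f0 _ pz) normr0; apply: mulr_ge0; [exact: ler0n|exact: powR_ge0].
  by have pz0 := enorm_gt0 pz; apply: (fP z pz0 _).2; clear -zr pz0; lra.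
have pr : 4 * enorm (perp e x) <= rho by clear -p_le xr; lra.
have qr : 4 * enorm (perp e y) <= rho by clear -q_le yr; lra.
have qp : `|enorm (perp e y) - enorm (perp e x)| <= d.
  by rewrite /d perpB; exact: enorm_dist.
(* In the near case [P x = 0] forces [d = 0]; otherwise the error of the tangent plane has exponent
   [1 + a >= 1 + b], and [sqr_div_le] takes care of the curvature. *)
have [near|far] := leP (8 * d) (enorm (perp e x) `^ (1 + g)).
  have [px0|pxn] := eqVneq (perp e x) 0.
    have d00 : d = 0.
      move: near; rewrite px0 enorm0 powR0 ?gt_eqF //; clear -d0; lra.
    have py0 : perp e y = 0 by apply: enorm_eq0; move: qp; rewrite d00 px0 enorm0 subr0 ger0_norm //; clear -q0; lra.
    rewrite (f0 _ px0) (f0 _ py0) (G0 _ px0) dot0r !subr0 normr0.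
    exact: mulr_ge0 K0 D0.
  have pp := enorm_gt0 pxn.
  have pr0 : 0 <= enorm (perp e x) <= rho by rewrite p0 /=; clear -pr pp; lra.
  have sX := scale_le a0 ag rho1 tiny pr0.
  have qq : 0 < enorm (perp e y).
    by move: qp; rewrite ler_norml => /andP[]; clear -near sX pp; lra.
  have [_ _ /(_ y qq qr near)] := GP x pp pr; rewrite -/d => /le_trans; apply.
  have h1 : d `^ (1 + a) <= d `^ (1 + b).
    rewrite ler_powRr ?d0 //= addr_gt0 //= lerD2l /b ler_pdivrMr //.
    by rewrite ler_peMr ?(ltW a0) //; clear -a0 ag; lra.
  have h2 : d ^+ 2 / enorm (perp e x) <= d `^ (1 + b).
    apply: (sqr_div_le a0 ag _ d0); last by clear -near d0; lra.
    by rewrite pp /=; clear -pr rho1 pp; lra.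
  have h3 := ler_wpM2l (ltW l0) h1.
  by rewrite KE; clear -h2 h3 D0 lD cD lcD; lra.
(* In the far case no cancellation is used: [f x], [f y] and [<y - x, G x>] are each
   [O(d ^ (1 + b))]. *)
have p_far : enorm (perp e x) `^ (1 + g) <= c * d.
  apply: le_trans (ltW far) _; rewrite /c -mulrA ler_peMl ?mulr_ge0 ?ler0n //.
  by apply: powR_ge1; [exact: ltW|rewrite ler1n].
have q_far : enorm (perp e y) `^ (1 + g) <= c * d.
  rewrite /c -mulrA.
  have [pd|pd] := leP (enorm (perp e x)) d.
    have q2 : enorm (perp e y) <= 2 * d.
      by move: qp; rewrite ler_norml => /andP[]; clear -pd; lra.
    apply: le_trans (ler_powRl (ltW g1) q0 q2) _.
    rewrite (powRM _ (ler0n _ 2) d0); apply: ler_wpM2l; first exact: powR_ge0.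
    apply: (@le_trans _ _ d); last by clear -d0; lra.
    rewrite -[leRHS](powRr1 d0); apply: ler_powRr; first by rewrite d0.
    by rewrite ltr01 /=; clear -a0 ag; lra.
  have q2 : enorm (perp e y) <= 2 * enorm (perp e x).
    by move: qp; rewrite ler_norml => /andP[]; clear -pd; lra.
  apply: le_trans (ler_powRl (ltW g1) q0 q2) _.
  rewrite (powRM _ (ler0n _ 2) p0); apply: ler_wpM2l (ltW far).
  exact: powR_ge0.
have [p1 p2] := powR_far a0 ag p0 p_far.
have [q1 _] := powR_far a0 ag q0 q_far.
have c2 := powR2_scale_le c1 d0 b01.
have fx := le_trans (fle x pr) (ler_wpM2l (ler0n _ 9) (le_trans p1 c2)).
have fy := le_trans (fle y qr) (ler_wpM2l (ler0n _ 9) (le_trans q1 c2)).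
have Gx : `|dot (y - x) (G x)| <= 56 * 3 * lam a * c * d `^ (1 + b).
  have [px0|pxn] := eqVneq (perp e x) 0.
    by rewrite (G0 _ px0) dot0r normr0; clear -lcD; lra.
  have [Ge Gn _] := GP x (enorm_gt0 pxn) pr.
  rewrite (dot_perpl _ Ge); apply: le_trans (dot_le _ _) _; rewrite -/d.
  rewrite (powR1D d0 b0) mulrCA; apply: (ler_wpM2l d0).
  have b01' : 0 <= b <= 1 by rewrite b1 ltW.
  have := ler_wpM2l (ltW l0) (le_trans p2 (powR1_scale_le c1 d0 b01')).
  move=> h; apply: le_trans Gn _; clear -h; clearbody b c d.
  move: (_ `^ _) (_ `^ _) h => A B h; lra.
apply: le_trans (ler_normB _ _) _; have := ler_normB (f y) (f x).
rewrite KE; clear -fx fy Gx D0 lD; clearbody b c d; lra.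
Qed.

End SheetFunction.

(** * Taylor expansions *)

Section Taylor.
Context {R : realType}.
Implicit Types (f : 'rV[R]_4 -> R) (G : 'rV[R]_4 -> 'rV[R]_4).
Implicit Types (e x y z h v : 'rV[R]_4) (r b c K : R).

(* Comparing the expansions at [x] and [y] of the value at a third point, chosen
   in the direction of [G x - G y]. *)
Lemma taylor_hoelder r b K f G : 0 < b <= 1 -> 0 <= K -> taylor_on r b K f G ->
  forall x y, 4 * enorm x <= r -> 4 * enorm y <= r ->
    enorm (G x - G y) <= 6 * K * enorm (x - y) `^ b.
Proof.
move=> /andP[b0 b1] K0 T x y xr yr.
have [->|vn] := eqVneq (G x - G y) 0.
  by rewrite enorm0; apply: mulr_ge0 (powR_ge0 _ _); apply: mulr_ge0 K0; exact: ler0n.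
have v0 := enorm_gt0 vn; have [v vE] : exists v, v = G x - G y by eexists.
rewrite -vE in vn v0 *.
have [xy|xyn] := eqVneq (x - y) 0.
  by move: v0; rewrite vE (subr0_eq xy) subrr enorm0 ltxx.
have d0 := enorm_gt0 xyn; have [d dE] : exists d, d = enorm (x - y) by eexists.
rewrite -dE in d0 *.
have [h hE] : exists h, h = (d / enorm v) *: v by eexists.
have hd : enorm h = d.
  by rewrite hE enormZ ger0_norm ?divfK ?gt_eqF // divr_ge0 ?enorm_ge0 // ltW.
have hv : dot h v = d * enorm v.
  by rewrite hE dotZl -sqr_enorm expr2 mulrA divfK // gt_eqF.
have xy_le := enorm_sub x y; rewrite -dE in xy_le.
have x_r : enorm x <= r by have := enorm_ge0 x; clear -xr; lra.
have y_r : enorm y <= r by have := enorm_ge0 y; clear -yr; lra.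
have z_r : enorm (y + h) <= r.
  by have := enormD y h; rewrite hd; have := enorm_ge0 y; clear -xr yr xy_le; lra.
have A := T x (y + h) x_r z_r; have B := T y (y + h) y_r z_r; have C := T x y x_r y_r.
have yhy : y + h - y = h by rewrite addrAC subrr add0r.
rewrite yhy hd in B; rewrite (enormB y x) -dE in C.
have A2 : K * enorm (y + h - x) `^ (1 + b) <= 4 * (K * d `^ (1 + b)).
  have zx : enorm (y + h - x) <= 2 * d.
    have -> : y + h - x = h - (x - y) by apply/rowP => i; rewrite !mxE; ring.
    by have := enorm_sub h (x - y); rewrite hd -dE; clear; lra.
  have := ler_powRl (_ : 0 <= 1 + b) (enorm_ge0 _) zx.
  have := @powR2_scale_le _ 2 d b; rewrite ler1n b0 b1 (ltW d0) => /(_ erefl erefl erefl).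
  rewrite -natrX => h1 h2; have /h2 h3 : 0 <= 1 + b by rewrite addr_ge0 // ltW.
  by have := ler_wpM2l K0 (le_trans h3 h1); clear; lra.
have E : dot (y + h - x) (G x) - dot h (G y) - dot (y - x) (G x) = d * enorm v.
  by rewrite -hv vE !(dotDl, dotDr, dotNl, dotNr); ring.
(* [6 = 4 + 1 + 1]: one expansion is over a distance of at most [2 d], the other two over [d]. *)
have : d * enorm v <= d * (6 * K * d `^ b).
  rewrite -E; have -> : d * (6 * K * d `^ b) = 6 * (K * d `^ (1 + b)).
    by rewrite (powR1D (ltW d0) b0); ring.
  move: (le_trans A A2) B C; rewrite !ler_norml => /andP[A1 _] /andP[_ B1] /andP[_ C1].
  by clear -A1 B1 C1; lra.
by rewrite ler_pM2l.
Qed.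

Lemma taylor_sub r b K r' f G : r' <= r -> taylor_on r b K f G -> taylor_on r' b K f G.
Proof. by move=> rr T x y xr yr; apply: T; exact: le_trans rr. Qed.

Lemma taylor_add r b K1 K2 f1 G1 f2 G2 :
  taylor_on r b K1 f1 G1 -> taylor_on r b K2 f2 G2 ->
  taylor_on r b (K1 + K2) (fun x => f1 x + f2 x) (fun x => G1 x + G2 x).
Proof.
move=> T1 T2 x y xr yr; rewrite dotDr mulrDl.
have -> : f1 y + f2 y - (f1 x + f2 x) - (dot (y - x) (G1 x) + dot (y - x) (G2 x)) =
  (f1 y - f1 x - dot (y - x) (G1 x)) + (f2 y - f2 x - dot (y - x) (G2 x)) by ring.
exact: le_trans (ler_normD _ _) (lerD (T1 x y xr yr) (T2 x y xr yr)).
Qed.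

Lemma taylor_scale r b K c f G : taylor_on r b K f G ->
  taylor_on r b (`|c| * K) (fun x => c * f x) (fun x => c *: G x).
Proof.
move=> T x y xr yr; rewrite dotZr -mulrA.
have -> : c * f y - c * f x - c * dot (y - x) (G x) =
  c * (f y - f x - dot (y - x) (G x)) by ring.
by rewrite normrM ler_wpM2l // T.
Qed.

Lemma powR_exchange b c d : 0 < b <= 1 -> 0 <= d -> d <= c -> c `^ b * d <= c * d `^ b.
Proof.
move=> /andP[b0 b1] d0 dc; have c0 : 0 <= c := le_trans d0 dc.
move: b1; rewrite le_eqVlt => /predU1P[->|b1]; first by rewrite !powRr1.
have E t : 0 <= t -> t = t `^ b * t `^ (1 - b).
  by move=> t0; rewrite -powRDp ?subr_gt0 // addrCA subrr addr0 powRr1.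
have -> : c `^ b * d = c `^ b * d `^ b * d `^ (1 - b) by rewrite -mulrA -(E d d0).
have -> : c * d `^ b = c `^ b * d `^ b * c `^ (1 - b) by rewrite {1}(E c c0); ring.
by rewrite ler_wpM2l ?mulr_ge0 ?powR_ge0 // ler_powRl // subr_ge0 ltW.
Qed.

Section Cosine.
Variables (e : 'rV[R]_4) (e1 : dot e e = 1).

(* Homogeneous of degree 0, smooth away from [0], and equal to [1 / sqrt 2] and
   [- 1 / sqrt 2] on the two halves of the cone: it glues the two graphs. *)
Definition cosine x := dot x e / enorm x.
Definition cosine_grad x := (enorm x)^-1 *: e - (dot x e / enorm x ^+ 3) *: x.

Lemma cosine_le1 x : `|cosine x| <= 1.
Proof.
have [->|x0] := eqVneq x 0; first by rewrite /cosine dot0l mul0r normr0 ler01.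
rewrite normrM normfV (gtr0_norm (enorm_gt0 x0)) ler_pdivrMr ?enorm_gt0 // mul1r.
exact: dot_unit_le.
Qed.

Lemma cosine_grad_le x : enorm (cosine_grad x) * enorm x <= 2.
Proof.
have [->|xn] := eqVneq x 0; first by rewrite enorm0 mulr0.
have x0 := enorm_gt0 xn; rewrite -ler_pdivlMr //.
apply: le_trans (enorm_sub _ _) _; rewrite (enorm_scale_unit e1) enormZ.
rewrite normfV (gtr0_norm x0) normrM normfV normrX (gtr0_norm x0).
have -> : `|dot x e| / enorm x ^+ 3 * enorm x = `|dot x e| / enorm x / enorm x.
  by field; rewrite gt_eqF.
have := dot_unit_le e1 x => h.
have : `|dot x e| / enorm x <= 1 by rewrite ler_pdivrMr // mul1r.
have i0 : 0 <= (enorm x)^-1 by rewrite invr_ge0 ltW.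
move=> /(ler_wpM2r i0); rewrite mul1r; clear; lra.
Qed.

(** Expansion of a quotient, with [enorm_expand] for its denominator. Once [h] and [x] are replaced
    by the six real numbers that occur, what remains is algebra; [8 = 2 + (2 + 4)] collects the
    three remainders. *)
Lemma cosine_taylor x h : x != 0 -> 2 * enorm h <= enorm x ->
  `|cosine (x + h) - cosine x - dot h (cosine_grad x)|
    <= 8 * enorm h ^+ 2 / enorm x ^+ 2.
Proof.
move=> xn; have := enorm_expand h xn; have N0 := enorm_gt0 xn.
have := enorm_dist (x + h) x; rewrite [x + h - x]addrAC subrr add0r.
have := dot_le h x; have := dot_unit_le e1 h; have := dot_unit_le e1 x.
rewrite /cosine /cosine_grad dotDl dotDr dotNr !dotZr.
have := enorm_ge0 h.
move: (enorm h) (enorm x) (enorm (x + h)) (dot h x) (dot h e) (dot x e) N0.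
move=> d N M u q t N0 d0 tN qd ud Md HR dN.
have M0 : N / 2 <= M by move: Md; rewrite ler_norml => /andP[]; clear -dN; lra.
have Mpos : 0 < M by clear -M0 N0; lra.
have [Rm RmE] : exists Rm, Rm = M - N - u / N by eexists.
rewrite -RmE in HR.
have iM : M^-1 <= 2 / N.
  by rewrite -[M^-1]mul1r ler_pdivlMr // mulrAC ler_pdivrMr // mul1r; clear -M0; lra.
have iM0 : 0 <= M^-1 by rewrite invr_ge0 ltW.
have dif : `|N - M| / M <= 2 * d / N.
  rewrite distrC mulrC; apply: le_trans (ler_pM iM0 (normr_ge0 _) iM Md) _.
  by rewrite le_eqVlt; apply/orP; left; apply/eqP; ring.
have -> : (t + q) / M - t / N - (N^-1 * q - t / N ^+ 3 * u) =
    q * ((N - M) / M) / N + t * ((- (u / N)) * ((N - M) / M) / N - Rm / M) / N.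
  by rewrite RmE; field; apply/andP; split; rewrite gt_eqF.
have NM : `|(N - M) / M| <= 2 * d / N by rewrite normrM normfV (gtr0_norm Mpos).
have uN : `|u / N| <= d.
  by rewrite normrM normfV (gtr0_norm N0) ler_pdivrMr.
have T1 : `|q * ((N - M) / M) / N| <= 2 * d ^+ 2 / N ^+ 2.
  rewrite normrM normfV (gtr0_norm N0) normrM ler_pdivrMr //.
  apply: le_trans (ler_pM (normr_ge0 _) (normr_ge0 _) qd NM) _.
  by rewrite le_eqVlt; apply/orP; left; apply/eqP; field; rewrite gt_eqF.
have T2 : `|- (u / N) * ((N - M) / M) / N| <= 2 * d ^+ 2 / N ^+ 2.
  rewrite normrM normfV (gtr0_norm N0) normrM normrN ler_pdivrMr //.
  apply: le_trans (ler_pM (normr_ge0 _) (normr_ge0 _) uN NM) _.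
  by rewrite le_eqVlt; apply/orP; left; apply/eqP; field; rewrite gt_eqF.
have T3 : `|Rm / M| <= 4 * d ^+ 2 / N ^+ 2.
  rewrite normrM normfV (gtr0_norm Mpos).
  apply: le_trans (ler_pM (normr_ge0 _) iM0 HR iM) _.
  by rewrite le_eqVlt; apply/orP; left; apply/eqP; field; rewrite gt_eqF.
have T4 : `|t * (- (u / N) * ((N - M) / M) / N - Rm / M) / N| <= 6 * d ^+ 2 / N ^+ 2.
  rewrite normrM normfV (gtr0_norm N0) normrM ler_pdivrMr // mulrC.
  apply: ler_pM => //; apply: le_trans (ler_normB _ _) _.
  by apply: le_trans (lerD T2 T3) _; clear; lra.
by apply: le_trans (ler_normD _ _) _; apply: le_trans (lerD T1 T4) _; clear; lra.
Qed.

(** [cosine] is discontinuous at 0 and its gradient has size [1 / |x|], but [f = O(|x| ^ (1 + b))]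
    and [G = O(|x| ^ b)] compensate. For [2 d <= |x|] the product rule leaves three remainders, and
    [powR_exchange] trades powers of [|x|] for powers of [d]; for larger [d] the four terms are
    bounded separately. *)
Lemma taylor_cosine r b K f G : 0 < b <= 1 -> 0 <= K -> taylor_on r b K f G ->
    f 0 = 0 -> G 0 = 0 ->
  taylor_on (r / 4) b (100 * K) (fun x => cosine x * f x)
    (fun x => cosine x *: G x + f x *: cosine_grad x).
Proof.
move=> b01 K0 T f0 G0 x y xr yr; have /andP[b0 b1] := b01.
have r0 : 0 <= r by have := enorm_ge0 x; clear -xr; lra.
have f_le z : enorm z <= r / 4 -> `|f z| <= K * enorm z `^ (1 + b).
  move=> zr; have := T 0 z; rewrite enorm0 G0 dot0r !subr0 f0 subr0.
  by apply => //; clear -zr r0; lra.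
have G_le z : enorm z <= r / 4 -> enorm (G z) <= 6 * K * enorm z `^ b.
  move=> zr; have := taylor_hoelder b01 K0 T (x := z) (y := 0).
  by rewrite G0 !subr0 enorm0 mulr0 => h; apply: h r0; clear -zr; lra.
have fx := f_le x xr; have fy := f_le y yr; have Gx := G_le x xr.
have rr : r / 4 <= r by clear -r0; lra.
have Txy := T x y (le_trans xr rr) (le_trans yr rr).
rewrite dotDr !dotZr; set d := enorm (y - x) in Txy *.
have d0 : 0 <= d by exact: enorm_ge0.
have db0 := powR_ge0 d b; have D1 := powR1D d0 b0.
have [D DE] : exists D, D = d `^ (1 + b) by eexists.
have D0 : 0 <= D by rewrite DE powR_ge0.
have KD : 0 <= K * D by exact: mulr_ge0.
rewrite -DE in Txy D1 *.
have N0 := enorm_ge0 x; have cx := cosine_le1 x; have cy := cosine_le1 y.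
have gx := cosine_grad_le x.
have sub_one (s t u : R) : `|s| <= 1 -> `|t| <= u -> `|s * t| <= u.
  by move=> s1 tu; rewrite normrM -[leRHS]mul1r ler_pM.
have [near|far] := leP (2 * d) (enorm x).
  have [x0|xn] := eqVneq x 0.
    have d00 : d = 0 by move: near; rewrite x0 enorm0; clear -d0; lra.
    have yx : y = x by apply/eqP; rewrite -subr_eq0; apply/eqP/enorm_eq0.
    rewrite yx !subrr !dot0l !mulr0 addr0 subr0 normr0.
    by clear -KD; lra.
  have Np := enorm_gt0 xn.
  have := cosine_taylor xn near; rewrite [x + _]addrC subrK -/d => ct.
  have dN : d <= enorm x by clear -near d0; lra.
  have ex := powR_exchange b01 d0 dN.
  have dgx : `|dot (y - x) (cosine_grad x)| <= 2 * d / enorm x.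
    rewrite ler_pdivlMr //; apply: le_trans (_ : d * (enorm (cosine_grad x) * enorm x) <= _).
      by rewrite mulrA ler_wpM2r // dot_le.
    by have := ler_wpM2l d0 gx; clear; lra.
  have ct' : `|cosine y - cosine x| <= 6 * d / enorm x.
    have -> : cosine y - cosine x = (cosine y - cosine x - dot (y - x) (cosine_grad x))
      + dot (y - x) (cosine_grad x) by ring.
    apply: le_trans (ler_normD _ _) _; apply: le_trans (lerD ct dgx) _.
    have -> : 8 * d ^+ 2 / enorm x ^+ 2 = 4 * (d / enorm x) * (2 * d / enorm x).
      by field; rewrite gt_eqF.
    have i0 : 0 <= d / enorm x by rewrite divr_ge0.
    have i1 : 2 * d / enorm x <= 1 by rewrite ler_pdivrMr // mul1r.
    by have := ler_wpM2l i0 i1; clear -i0; lra.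
  have -> : cosine y * f y - cosine x * f x -
      (cosine x * dot (y - x) (G x) + f x * dot (y - x) (cosine_grad x)) =
    cosine y * (f y - f x - dot (y - x) (G x)) +
    ((cosine y - cosine x) * dot (y - x) (G x) +
     f x * (cosine y - cosine x - dot (y - x) (cosine_grad x))) by ring.
  have T1 : `|cosine y * (f y - f x - dot (y - x) (G x))| <= K * D by exact: sub_one.
  have exD : enorm x `^ b * d * (d / enorm x) <= D.
    rewrite D1 mulrA ler_pdivrMr // mulrAC -[leRHS]mulrA [d `^ b * _]mulrC.
    by rewrite [leRHS]mulrC ler_wpM2r.
  have T2 : `|(cosine y - cosine x) * dot (y - x) (G x)| <= 36 * (K * D).
    rewrite normrM; apply: le_trans (ler_pM _ _ ct' (dot_le _ _)) _ => //.
    rewrite -/d; apply: (@le_trans _ _ (6 * d / enorm x * (d * (6 * K * enorm x `^ b)))).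
      by rewrite !ler_wpM2l // ?divr_ge0 ?mulr_ge0.
    by have := ler_wpM2l K0 exD; clear; lra.
  have T3 : `|f x * (cosine y - cosine x - dot (y - x) (cosine_grad x))| <= 8 * (K * D).
    rewrite normrM; apply: le_trans (ler_pM _ _ fx ct) _ => //.
    rewrite (powR1D N0 b0).
    have -> : K * (enorm x * enorm x `^ b) * (8 * d ^+ 2 / enorm x ^+ 2) =
      8 * (K * (enorm x `^ b * d * (d / enorm x))) by field; rewrite gt_eqF.
    by have := ler_wpM2l K0 exD; clear; lra.
  apply: le_trans (ler_normD _ _) _; have := ler_normD
    ((cosine y - cosine x) * dot (y - x) (G x))
    (f x * (cosine y - cosine x - dot (y - x) (cosine_grad x))).
  by clear -T1 T2 T3 KD; lra.
have x2 : enorm x <= 2 * d by exact: ltW.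
have y3 : enorm y <= 3 * d.
  by have := enormD (y - x) x; rewrite subrK -/d; clear -x2; lra.
have p0 : 0 <= 1 + b by rewrite addr_ge0 // ltW.
have two1 : 1 <= 2 :> R by rewrite ler1n.
have three1 : 1 <= 3 :> R by rewrite ler1n.
have x2D : enorm x `^ (1 + b) <= 4 * D.
  apply: le_trans (ler_powRl p0 N0 x2) _; rewrite DE.
  by have := powR2_scale_le two1 d0 b01; rewrite -natrX.
have y3D : enorm y `^ (1 + b) <= 9 * D.
  apply: le_trans (ler_powRl p0 (enorm_ge0 y) y3) _; rewrite DE.
  by have := powR2_scale_le three1 d0 b01; rewrite -natrX.
have x2d : d * enorm x `^ b <= 2 * D.
  rewrite D1 mulrCA; apply: (ler_wpM2l d0).
  apply: le_trans (ler_powRl (ltW b0) N0 x2) (powR1_scale_le two1 d0 _).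
  by rewrite b1 ltW.
have T1 : `|cosine y * f y| <= 9 * (K * D).
  by apply: sub_one => //; apply: le_trans fy _; have := ler_wpM2l K0 y3D; clear; lra.
have T2 : `|cosine x * f x| <= 4 * (K * D).
  by apply: sub_one => //; apply: le_trans fx _; have := ler_wpM2l K0 x2D; clear; lra.
have T3 : `|cosine x * dot (y - x) (G x)| <= 12 * (K * D).
  apply: sub_one => //; apply: le_trans (dot_le _ _) _; rewrite -/d.
  by apply: le_trans (ler_wpM2l d0 Gx) _; have := ler_wpM2l K0 x2d; clear; lra.
have T4 : `|f x * dot (y - x) (cosine_grad x)| <= 4 * (K * D).
  rewrite normrM; apply: le_trans (ler_pM _ _ fx (dot_le _ _)) _ => //.
  rewrite -/d (powR1D N0 b0).
  have -> : K * (enorm x * enorm x `^ b) * (d * enorm (cosine_grad x)) =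
    K * (d * enorm x `^ b) * (enorm (cosine_grad x) * enorm x) by ring.
  have k0 : 0 <= K * (d * enorm x `^ b) by rewrite !mulr_ge0 ?powR_ge0.
  apply: le_trans (ler_wpM2l k0 gx) _.
  by have := ler_wpM2l K0 x2d; clear; lra.
apply: le_trans (ler_normB _ _) _.
have := ler_normB (cosine y * f y) (cosine x * f x).
have := ler_normD (cosine x * dot (y - x) (G x)) (f x * dot (y - x) (cosine_grad x)).
by clear -T1 T2 T3 T4 KD; lra.
Qed.

End Cosine.
End Taylor.

(** * Derivatives *)

Section MatrixProduct.
Context {R : realType}.

Lemma mulmx_norm_le m n p (A : 'M[R]_(m, p)) (B : 'M[R]_(p, n)) :
  `|A *m B| <= p%:R * (`|A| * `|B|).
Proof.
apply: mx_norm_le => [|i j]; first by rewrite !mulr_ge0 ?ler0n.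
rewrite mxE; apply: le_trans (ler_norm_sum _ _ _) _.
apply: (@le_trans _ _ (\sum_(k < p) `|A| * `|B|)).
  by apply: ler_sum => k _; rewrite normrM ler_pM ?mx_entry_le.
by rewrite sumr_const card_ord -[leLHS]mulr_natl.
Qed.

Lemma enorm_mulmx_le (u : 'rV[R]_4) (A : 'M[R]_4) :
  enorm (u *m A) <= 8 * `|A| * enorm u.
Proof.
apply: le_trans (enorm_le_norm _) _; have := mulmx_norm_le u A => h.
have := ler_wpM2r (normr_ge0 A) (norm_le_enorm u).
by clear -h; lra.
Qed.

Lemma outer_norm_le (u v : 'rV[R]_4) : `|u^T *m v| <= enorm u * enorm v.
Proof.
apply: le_trans (mulmx_norm_le _ _) _; rewrite mul1r.
apply: ler_pM => //; last exact: norm_le_enorm.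
apply: mx_norm_le => [|i j]; first exact: enorm_ge0.
by rewrite mxE; apply: le_trans (mx_entry_le _ _ _) (norm_le_enorm _).
Qed.

Lemma mulmx_outer (h u v : 'rV[R]_4) : h *m (u^T *m v) = dot h u *: v.
Proof.
rewrite mulmxA; apply/rowP => j; rewrite !mxE big_ord1; congr (_ * _).
by rewrite mxE; apply: eq_bigr => i _; rewrite mxE.
Qed.

Lemma outerB (u v : 'rV[R]_4) : u^T *m u - v^T *m v = (u - v)^T *m u + v^T *m (u - v).
Proof. by rewrite linearB /= mulmxBl mulmxBr addrA subrK. Qed.

Lemma mulmx_subE (A B C D : 'M[R]_4) : A *m B - C *m D = (A - C) *m B + C *m (B - D).
Proof. by rewrite mulmxBl mulmxBr addrA subrK. Qed.

Lemma eq_mulmx_rV (A B : 'M[R]_4) : (forall u : 'rV[R]_4, u *m A = u *m B) -> A = B.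
Proof. by move=> AB; apply/row_matrixP => i; rewrite !rowE. Qed.

End MatrixProduct.

Lemma differentiable_epsilon (R : realType) (V W : normedModType R) (f : V -> W)
    (df : {linear V -> W}) x : continuous df ->
    (forall eps : R, 0 < eps ->
       \forall h \near (0 : V), `|f (h + x) - f x - df h| <= eps * `|h|) ->
  differentiable f x /\ 'd f x = df :> (V -> W).
Proof.
move=> dfc df_eps; have fo : f \o shift x = cst (f x) + df +o_ 0 id.
  apply/eqaddoP => eps eps0; near=> h.
  rewrite [X in `|X| <= _](_ : _ = f (h + x) - f x - df h); last first.
    by rewrite /= -addrA -opprD.
  by near: h; exact: df_eps.
have dE := diff_unique dfc fo; split => //.
by apply/diff_locallyP; rewrite dE.
Unshelve. all: by end_near. Qed.

Section Differentiability.
Context {R : realType}.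
Implicit Types (f g : 'rV[R]_4 -> 'rV[R]_4) (x y z h : 'rV[R]_4).
Implicit Types (A B J : 'M[R]_4) (U V : set 'rV[R]_4).

(** Differentiability in the Euclidean norm. Matrices act on row vectors from the right, as in
    [jacobian], so the chain rule multiplies them in the order in which the maps are applied. *)
Definition has_jacobian f x J := forall eps : R, 0 < eps -> exists2 d : R, 0 < d &
  forall y, enorm (y - x) < d -> enorm (f y - f x - (y - x) *m J) <= eps * enorm (y - x).

Lemma has_jacobianP f x J : has_jacobian f x J -> differentiable f x /\ jacobian f x = J.
Proof.
move=> fJ; pose Jl : {linear 'rV[R]_4 -> 'rV[R]_4} := mulmxr J.
have Jc : continuous Jl.
  apply: (@lipschitz_continuous _ _ _ (4 * `|J|)) => u v /=.
  rewrite -mulmxBl; apply: le_trans (mulmx_norm_le _ _) _.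
  by have := ler_wpM2r (normr_ge0 J) (norm_le_enorm (u - v)); clear; lra.
have [|df dE] := @differentiable_epsilon R _ _ f Jl x Jc.
- move=> eps eps0; apply/nbhs_enormP.
  have eps2 : 0 < eps / 2 by rewrite divr_gt0.
  have [d d0 dJ] := fJ _ eps2; exists d => // h; rewrite subr0 => hd.
  have := dJ (h + x); rewrite addrK => /(_ hd).
  have := norm_le_enorm (f (h + x) - f x - h *m J); have := enorm_le_norm h.
  move=> h1 h2 h3; apply: le_trans h2 (le_trans h3 _).
  by have := ler_wpM2l (ltW eps2) h1; clear; lra.
split => //.
by apply: eq_mulmx_rV => u; rewrite /jacobian mul_rV_lin1 dE.
Qed.

Lemma jacobian_comp f g x : differentiable f x -> differentiable g (f x) ->
  jacobian (g \o f) x = jacobian f x *m jacobian g (f x).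
Proof.
move=> df dg; apply: eq_mulmx_rV => u.
have E (F : 'rV[R]_4 -> 'rV[R]_4) y (v : 'rV[R]_4) : v *m jacobian F y = 'd F y v.
  exact: mul_rV_lin1.
rewrite (E (g \o f) x u) mulmxA (E f x u) (E g (f x)).
exact: (congr1 (fun F => F u) (diff_comp df dg)).
Qed.

Lemma continuous_at_mulmx (F G : 'rV[R]_4 -> 'M[R]_4) x :
  {for x, continuous F} -> {for x, continuous G} ->
  {for x, continuous (fun y => F y *m G y)}.
Proof.
move=> /continuous_enormP cF /continuous_enormP cG; apply/continuous_enormP => eps eps0.
have [d1 d10 G1] := cG 1 ltr01.
pose c := 8 * (`|G x| + 1 + `|F x|).
have c0 : 0 < c by rewrite mulr_gt0 // ltr_wpDr // ltr_wpDl.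
have ec : 0 < eps / c by rewrite divr_gt0.
have [d2 d20 F2] := cF _ ec; have [d3 d30 G3] := cG _ ec.
exists (Num.min d1 (Num.min d2 d3)); first by rewrite !lt_min d10 d20 d30.
move=> y; rewrite !lt_min => /and3P[yd1 yd2 yd3].
rewrite mulmx_subE; apply: le_trans (ler_normD _ _) _.
have h1 := mulmx_norm_le (F y - F x) (G y); have h2 := mulmx_norm_le (F x) (G y - G x).
have Gy : `|G y| <= `|G x| + 1.
  by have := ler_normD (G y - G x) (G x); rewrite subrK; have := G1 y yd1; clear; lra.
have h3 := ler_pM (normr_ge0 _) (normr_ge0 _) (F2 y yd2) Gy.
have h4 := ler_wpM2l (normr_ge0 (F x)) (G3 y yd3).
have h5 : eps / c * (`|G x| + 1) + `|F x| * (eps / c) = eps / 8.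
  rewrite [`|F x| * _]mulrC -mulrDr /c; field.
  by rewrite gt_eqF // ltr_wpDr // ltr_wpDl.
by apply: le_trans (lerD h1 h2) _; clear -h3 h4 h5 eps0; lra.
Qed.

Lemma continuous_at_comp (V : normedModType R) (F : 'rV[R]_4 -> 'rV[R]_4)
    (G : 'rV[R]_4 -> V) x :
  {for x, continuous F} -> {for F x, continuous G} -> {for x, continuous (G \o F)}.
Proof. exact: continuous_comp. Qed.

Lemma continuous_at_eq_on (V : normedModType R) U (F G : 'rV[R]_4 -> V) x :
  open U -> U x -> (forall y, U y -> F y = G y) ->
  {for x, continuous G} -> {for x, continuous F}.
Proof.
move=> oU Ux FG /continuous_enormP cG; apply/continuous_enormP => eps eps0.
have /nbhs_enormP[d d0 dU] := open_nbhs_nbhs (conj oU Ux).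
have [d' d'0 d'G] := cG _ eps0; exists (Num.min d d'); first by rewrite lt_min d0.
by move=> y; rewrite lt_min => /andP[yd yd']; rewrite !FG //; [exact: d'G|exact: dU].
Qed.

Lemma has_jacobian_C1_on f (J : 'rV[R]_4 -> 'M[R]_4) U : open U ->
  (forall x, U x -> has_jacobian f x (J x)) ->
  (forall x, U x -> {for x, continuous J}) -> C1_on U f.
Proof.
move=> oU fJ cJ x Ux; split; first by have [] := has_jacobianP (fJ x Ux).
apply: (continuous_at_eq_on oU Ux _ (cJ x Ux)) => y Uy.
by have [] := has_jacobianP (fJ y Uy).
Qed.

Lemma C1_on_comp f g U V : open U -> C1_on U f -> C1_on V g ->
  (forall x, U x -> V (f x)) -> C1_on U (g \o f).
Proof.
move=> oU fU gV UV x Ux; have [df cf] := fU x Ux; have [dg cg] := gV _ (UV x Ux).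
split; first exact: differentiable_comp.
apply: (@continuous_at_eq_on _ U _ (fun y => jacobian f y *m (jacobian g \o f) y) _ oU Ux).
  move=> y Uy; have [dfy _] := fU y Uy; have [dgy _] := gV _ (UV y Uy).
  exact: jacobian_comp dfy dgy.
apply: (@continuous_at_mulmx (jacobian f) (jacobian g \o f) x cf).
exact: continuous_at_comp (differentiable_continuous df) cg.
Qed.

(** For increments [h] of [g] and [k] of the argument, [h - k J' = - (k - h J) J']; the first-order
    error of [f], small relative to [h], is small relative to [k] by the Lipschitz bound on [g]. *)
Lemma has_jacobian_inverse f g x J J' (L : R) : 0 <= L -> has_jacobian f x J ->
  J *m J' = 1%:M -> g (f x) = x ->
  (\forall y \near f x, f (g y) = y /\ enorm (g y - x) <= L * enorm (y - f x)) ->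
  has_jacobian g (f x) J'.
Proof.
move=> L0 fJ JJ' gx /nbhs_enormP[d0 d00 gL] eps eps0.
pose c := 8 * `|J'| * L + 1.
have c0 : 0 < c by rewrite ltr_wpDl // !mulr_ge0 ?ler0n.
have ec : 0 < eps / c by rewrite divr_gt0.
have [d1 d10 dJ] := fJ _ ec; have L1 : 0 < L + 1 by rewrite ltr_wpDl.
exists (Num.min d0 (d1 / (L + 1))); first by rewrite lt_min d00 divr_gt0.
move=> y; rewrite lt_min => /andP[yd0 yd1]; have [fgy gyL] := gL y yd0.
set k := y - f x in yd0 yd1 gyL *; set h := g y - x in gyL.
have h_d1 : enorm h < d1.
  apply: le_lt_trans gyL (le_lt_trans _ (_ : (L + 1) * enorm k < d1)).
    by rewrite ler_wpM2r ?enorm_ge0 // lerDl.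
  by rewrite mulrC -ltr_pdivlMr.
have := dJ _ h_d1; rewrite fgy -/k -/h => hk.
rewrite gx -/h; have -> : h - k *m J' = - ((k - h *m J) *m J').
  by rewrite (mulmxBl k (h *m J) J') -(mulmxA h J J') JJ' mulmx1 opprB.
rewrite enormN; apply: le_trans (enorm_mulmx_le _ _) _.
have hk' := le_trans hk (ler_wpM2l (ltW ec) gyL).
have J8 : 0 <= 8 * `|J'| by rewrite mulr_ge0 ?ler0n.
apply: le_trans (ler_wpM2l J8 hk') _.
have -> : 8 * `|J'| * (eps / c * (L * enorm k)) = eps * enorm k * ((c - 1) / c).
  by rewrite /c; ring.
rewrite ler_piMr ?mulr_ge0 ?enorm_ge0 ?(ltW eps0) // ler_pdivrMr // mul1r.
by rewrite gerBl.
Qed.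

End Differentiability.

(** * Displacement along the axis *)

Section Shear.
Context {R : realType}.
Implicit Types (x y z h v : 'rV[R]_4).

Definition open_eball (r : R) : set 'rV[R]_4 := [set x | enorm x < r].

Lemma open_open_eball r : open (open_eball r).
Proof.
rewrite openE => x xr; apply/nbhs_enormP; exists (r - enorm x).
  by rewrite subr_gt0.
move=> y yx; rewrite /open_eball /=; have := enormD (y - x) x; rewrite subrK.
by lra.
Qed.

Variables (e : 'rV[R]_4) (w : 'rV[R]_4 -> R) (W : 'rV[R]_4 -> 'rV[R]_4) (r : R).
Hypothesis e1 : dot e e = 1.
Hypothesis w_lip : forall x y, enorm x < r -> enorm y < r ->
  `|w y - w x| <= 1/2 * enorm (y - x).

Definition shear x := x + w x *: e.

Lemma shear_lower x y : enorm x < r -> enorm y < r ->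
  enorm (y - x) <= 2 * enorm (shear y - shear x).
Proof.
move=> xr yr; have wl := w_lip xr yr.
have := enorm_sub (shear y - shear x) ((w y - w x) *: e).
have -> : shear y - shear x - (w y - w x) *: e = y - x.
  by rewrite /shear; apply/rowP => i; rewrite !mxE; ring.
by rewrite (enorm_scale_unit e1); lra.
Qed.

Lemma shear_inj x y : enorm x < r -> enorm y < r -> shear x = shear y -> x = y.
Proof.
move=> xr yr xy; have := shear_lower xr yr; rewrite xy subrr enorm0 mulr0 => yx.
by apply/esym/eqP; rewrite -subr_eq0; apply/eqP/enorm_eq0/eqP; rewrite eq_le yx enorm_ge0.
Qed.

Lemma w_continuous x : enorm x < r -> {for x, continuous w}.
Proof.
move=> xr; apply/continuous_enormP => eps eps0.
have /nbhs_enormP[d d0 dr] := open_nbhs_nbhs (conj (@open_open_eball r) xr).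
exists (Num.min d eps); first by rewrite lt_min d0.
move=> y; rewrite lt_min => /andP[yd ye]; apply: le_trans (w_lip xr (dr y yd)) _.
by have := enorm_ge0 (y - x); lra.
Qed.

(** [shear] preserves horizontal parts, so a preimage of [y] is sought on one line parallel to [e],
    where the intermediate value theorem applies. *)
Lemma shear_onto x y : enorm x < r -> 16 * enorm (y - shear x) < r - enorm x ->
  exists2 z, enorm z < r & shear z = y.
Proof.
move=> xr yx; have [eta etaE] : exists eta, eta = enorm (y - shear x) by eexists.
have [dl dlE] : exists dl, dl = (r - enorm x) / 2 by eexists.
have eta0 : 0 <= eta by rewrite etaE enorm_ge0.
have dl0 : 0 < dl by rewrite dlE divr_gt0 // subr_gt0.
have ed : 8 * eta <= dl by rewrite dlE etaE; lra.
pose z := x + perp e (y - shear x).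
have zx : enorm (z - x) <= eta.
  by rewrite /z addrAC subrr add0r etaE enorm_perp.
have zsx s : enorm (z + s *: e - x) <= eta + `|s|.
  rewrite addrAC; apply: le_trans (enormD _ _) _; rewrite (enorm_scale_unit e1).
  by rewrite lerD2r.
have zsr s : `|s| <= dl -> enorm (z + s *: e) < r.
  move=> sd; have := enormD (z + s *: e - x) x; rewrite subrK.
  by have := zsx s; rewrite dlE in sd dl0 ed; lra.
(* [H s] is the height of [shear (z + s e)] above that of [x]. On [[- dl, dl]] the variation of [w]
   is at most [(eta + dl) / 2], so [8 eta <= dl] makes [H] cross the target [v]. *)
pose H s := s + w (z + s *: e).
have H_cont : {within `[- dl, dl], continuous H}.
  apply: continuous_in_subspaceT => /= s; rewrite inE /= in_itv /= => sd.
  have {}sd : `|s| <= dl by rewrite ler_norml.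
  have zc : {for s, continuous (fun s : R => z + s *: e)}.
    by apply: (cvgD (cvg_cst z)); apply: cvgZr_tmp; exact: cvg_id.
  have wc : {for s, continuous (w \o (fun s : R => z + s *: e))}.
    by apply: continuous_comp zc _; exact: w_continuous (zsr s sd).
  exact: (cvgD cvg_id wc).
pose v := dot y e - dot x e.
have vw : `|v - w x| <= eta.
  have -> : v - w x = dot (y - shear x) e.
    by rewrite /v /shear dotDl dotNl dotDl dotZl e1; ring.
  by rewrite etaE; exact: dot_unit_le.
have w_near s : `|s| <= dl -> `|w (z + s *: e) - w x| <= 1/2 * (eta + dl).
  move=> sd; apply: le_trans (w_lip xr (zsr s sd)) _.
  by have := zsx s; lra.
have dl_abs : `|dl| <= dl /\ `|- dl| <= dl by rewrite normrN gtr0_norm.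
have := w_near dl dl_abs.1; have := w_near (- dl) dl_abs.2; move: vw.
rewrite !ler_norml => /andP[v1 v2] /andP[w1 w2] /andP[w3 w4].
have dd : - dl <= dl by lra.
have [|s] := IVT dd H_cont (v := v).
  by rewrite ge_min le_max /H; apply/andP; split; apply/orP; [left|right];
    lra.
rewrite in_itv /= -ler_norml => sd Hs; exists (z + s *: e); first exact: zsr.
have Pz : perp e (z + s *: e) = perp e y.
  rewrite (perp_add e1) /z perpD (perp_id (dot_perp e1 _)) perpB /shear (perp_add e1).
  by rewrite addrC subrK.
have dz : dot (z + s *: e) e = dot x e + s.
  by rewrite dotDl dotZl e1 mulr1 /z dotDl (dot_perp e1) addr0.
have wz : w (z + s *: e) = dot y e - dot x e - s.
  by move: Hs; rewrite /H /v => <-; ring.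
rewrite /shear wz [in LHS](perpE e (z + s *: e)) Pz dz -addrA -scalerDl.
by rewrite [RHS](perpE e y); congr (_ + _ *: _); ring.
Qed.

Lemma open_shear_image : open (shear @` open_eball r).
Proof.
rewrite openE => _ [x xr <-]; apply/nbhs_enormP; exists ((r - enorm x) / 16).
  by rewrite divr_gt0 // subr_gt0.
move=> y; rewrite ltr_pdivlMr // mulrC => /(shear_onto xr)[z zr zy].
by exists z.
Qed.

Hypothesis w_der : forall x, enorm x < r -> forall eps : R, 0 < eps ->
  exists2 d : R, 0 < d & forall y, enorm (y - x) < d ->
    `|w y - w x - dot (y - x) (W x)| <= eps * enorm (y - x).
Hypothesis W_le : forall x, enorm x < r -> enorm (W x) <= 1/2.
Hypothesis W_cont : forall x, enorm x < r -> {for x, continuous W}.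

Definition shear_jacobian v : 'M[R]_4 := 1%:M + v^T *m e.

(** The Sherman-Morrison inverse of a rank-one perturbation of the identity. *)
Definition shear_jacobian_inv v : 'M[R]_4 :=
  1%:M - (1 + dot v e)^-1 *: (v^T *m e).

Lemma shear_jacobianK v : 1 + dot v e != 0 ->
  shear_jacobian v *m shear_jacobian_inv v = 1%:M.
Proof.
move=> v0; apply: eq_mulmx_rV => u; rewrite mulmx1 mulmxA /shear_jacobian mulmxDr mulmx1.
rewrite mulmx_outer /shear_jacobian_inv mulmxBr mulmx1 -scalemxAr mulmx_outer.
rewrite dotDl dotZl (dotC e v) scalerA.
have -> : (1 + dot v e)^-1 * (dot u v + dot u v * dot v e) = dot u v by field.
by rewrite addrK.
Qed.

Lemma outer_e_norm v : `|v^T *m e| <= enorm v.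
Proof. by apply: le_trans (outer_norm_le _ _) _; rewrite (enorm_unit e1) mulr1. Qed.

Lemma shear_has_jacobian x : enorm x < r -> has_jacobian shear x (shear_jacobian (W x)).
Proof.
move=> xr eps eps0; have [d d0 dw] := w_der xr eps0; exists d => // y /dw.
have -> : shear y - shear x - (y - x) *m shear_jacobian (W x) =
    (w y - w x - dot (y - x) (W x)) *: e.
  rewrite /shear_jacobian mulmxDr mulmx1 mulmx_outer /shear.
  by apply/rowP => i; rewrite !mxE; ring.
by rewrite (enorm_scale_unit e1).
Qed.

Lemma continuous_shear_jacobian_inv v : 1 + dot v e != 0 ->
  {for v, continuous shear_jacobian_inv}.
Proof.
move=> v0.
have dot_cont : continuous (fun v => dot v e).
  apply: (@lipschitz_continuous _ _ _ 1) => x y; rewrite mul1r -dotNl -dotDl.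
  exact: dot_unit_le.
have outer_cont : continuous (fun v : 'rV[R]_4 => v^T *m e).
  apply: (@lipschitz_continuous _ _ _ 1) => x y; rewrite mul1r -mulmxBl -linearB /=.
  exact: outer_e_norm.
have den_cont : {for v, continuous (fun v => 1 + dot v e)}.
  exact: (cvgD (cvg_cst (1 : R)) (dot_cont v)).
have inv_cont : {for v, continuous (fun v => (1 + dot v e)^-1)}.
  exact: (cvgV v0 den_cont).
exact: (cvgB (cvg_cst (1%:M : 'M[R]_4)) (cvgZ inv_cont (outer_cont v))).
Qed.

Lemma continuous_shear_jacobian : continuous shear_jacobian.
Proof.
apply: (@lipschitz_continuous _ _ _ 1) => x y.
rewrite mul1r /shear_jacobian opprD addrACA subrr add0r -mulmxBl -linearB /=.
exact: outer_e_norm.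
Qed.

Lemma C1_on_shear : C1_on (open_eball r) shear.
Proof.
apply: (has_jacobian_C1_on (@open_open_eball r) shear_has_jacobian) => x xr.
exact: (continuous_at_comp (W_cont xr) (@continuous_shear_jacobian (W x))).
Qed.

(** [shear_lower] makes the inverse 2-Lipschitz, hence differentiable, hence continuous; then its
    derivative [shear_jacobian_inv (W (g y))] is continuous in [y]. *)
Lemma shear_inverse : exists2 g : 'rV[R]_4 -> 'rV[R]_4,
  C1_on (shear @` open_eball r) g &
  (forall x, enorm x < r -> g (shear x) = x) /\
  (forall y, (shear @` open_eball r) y -> enorm (g y) < r /\ shear (g y) = y).
Proof.
pose g y := xget 0 [set x | enorm x < r /\ shear x = y].
have gV y : (shear @` open_eball r) y -> enorm (g y) < r /\ shear (g y) = y.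
  by move=> [x xr xy]; rewrite /g; case: xgetP => [z -> //|/(_ x)[]].
have gK x : enorm x < r -> g (shear x) = x.
  move=> xr; have [|gr gx] := gV (shear x); first by exists x.
  exact: shear_inj gr xr gx.
exists g => //.
have g_near x : enorm x < r -> \forall y \near shear x,
    shear (g y) = y /\ enorm (g y - x) <= 2 * enorm (y - shear x).
  move=> xr; have Vx : (shear @` open_eball r) (shear x) by exists x.
  apply: filterS (open_nbhs_nbhs (conj open_shear_image Vx)) => y /gV[gr gy].
  by split => //; rewrite -[in X in _ <= X]gy; exact: shear_lower.
have den x : enorm x < r -> 1 + dot (W x) e != 0.
  move=> xr; have := le_trans (dot_unit_le e1 (W x)) (W_le xr).
  by rewrite ler_norml => /andP[h _]; rewrite gt_eqF //; lra.
have gJ x : enorm x < r -> has_jacobian g (shear x) (shear_jacobian_inv (W x)).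
  move=> xr; apply: (@has_jacobian_inverse R shear g x _ _ 2 _ (shear_has_jacobian xr)) => //.
  - exact: shear_jacobianK (den x xr).
  - exact: gK.
  - exact: g_near.
apply: (has_jacobian_C1_on open_shear_image
    (J := fun y => shear_jacobian_inv (W (g y)))) => _ [x xr <-].
  by rewrite gK //; exact: gJ.
have gc : {for shear x, continuous g}.
  by apply: differentiable_continuous; have [] := has_jacobianP (gJ x xr).
have Wc : {for shear x, continuous (W \o g)}.
  by apply: continuous_at_comp gc _; rewrite gK //; exact: W_cont.
apply: (continuous_at_comp Wc); rewrite /= gK //.
exact: continuous_shear_jacobian_inv (den x xr).
Qed.

End Shear.

(** * Compression of the space to a ball *)

Section Compression.
Context {R : realType}.
Implicit Types (x y z h v : 'rV[R]_4) (M c t b : R).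

(* For [0 < M] this maps the whole space onto the open ball of radius [M^-1];
   its inverse is the same map with [- M] in place of [M]. *)
Definition compress M x : 'rV[R]_4 := (1 + M * enorm x)^-1 *: x.

(* At [x = 0] the inverse gives [0], the correct continuous extension. *)
Definition radial_sq x : 'M[R]_4 := (enorm x)^-1 *: (x^T *m x).

Definition compress_jacobian M x : 'M[R]_4 :=
  (1 + M * enorm x)^-1 *: 1%:M - (M * (1 + M * enorm x)^-1 ^+ 2) *: radial_sq x.

Lemma enorm_compress M x : 0 < 1 + M * enorm x ->
  enorm (compress M x) = (1 + M * enorm x)^-1 * enorm x.
Proof. by move=> M0; rewrite enormZ ger0_norm // invr_ge0 ltW. Qed.

Lemma compressK M x : 0 < 1 + M * enorm x ->
  0 < 1 + (- M) * enorm (compress M x) /\ compress (- M) (compress M x) = x.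
Proof.
move=> M0; have E : 1 + (- M) * enorm (compress M x) = (1 + M * enorm x)^-1.
  by rewrite enorm_compress //; field; rewrite gt_eqF.
split; first by rewrite E invr_gt0.
by rewrite {1}/compress E invrK /compress scalerA mulfV ?scale1r // gt_eqF.
Qed.

(** Homogeneity of degree 1 makes this hold across 0 as well. With [|y| <= |x|], changing the two
    vectors and then the scalar factor costs [|x - y|] each time. *)
Lemma radial_sq_lipschitz x y : `|radial_sq x - radial_sq y| <= 3 * enorm (x - y).
Proof.
wlog yx : x y / enorm y <= enorm x.
  move=> wl; have [/wl //|/ltW/wl] := leP (enorm y) (enorm x).
  by rewrite distrC enormB.
have [x0|xn] := eqVneq x 0.
  have y0 : y = 0.
    by apply: enorm_eq0; apply/eqP; rewrite eq_le enorm_ge0 andbT -enorm0 -x0.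
  by rewrite x0 y0 !subrr normr0 enorm0 mulr0.
have N0 := enorm_gt0 xn; have d0 := enorm_ge0 (x - y).
have -> : radial_sq x - radial_sq y = (enorm x)^-1 *: ((x - y)^T *m x) +
    ((enorm x)^-1 *: (y^T *m (x - y)) +
     ((enorm x)^-1 - (enorm y)^-1) *: (y^T *m y)).
  by rewrite addrA -scalerDr -outerB scalerBr scalerBl /radial_sq addrA subrK.
have i0 : 0 <= (enorm x)^-1 by rewrite invr_ge0 enorm_ge0.
have h1 : `|(enorm x)^-1 *: ((x - y)^T *m x)| <= enorm (x - y).
  rewrite normrZ (ger0_norm i0) mulrC ler_pdivrMr //; exact: outer_norm_le.
have h2 : `|(enorm x)^-1 *: (y^T *m (x - y))| <= enorm (x - y).
  rewrite normrZ (ger0_norm i0) mulrC ler_pdivrMr //.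
  by apply: le_trans (outer_norm_le _ _) _; rewrite mulrC ler_wpM2l.
have h3 : `|((enorm x)^-1 - (enorm y)^-1) *: (y^T *m y)| <= enorm (x - y).
  have [->|yn] := eqVneq y 0; first by rewrite mulmx0 scaler0 normr0 enorm_ge0.
  have P0 := enorm_gt0 yn; rewrite normrZ.
  have -> : (enorm x)^-1 - (enorm y)^-1 = (enorm y - enorm x) / (enorm x * enorm y).
    by field; apply/andP; split; rewrite gt_eqF.
  have xy0 : 0 < enorm x * enorm y by rewrite mulr_gt0.
  rewrite normrM normfV (gtr0_norm xy0) mulrAC ler_pdivrMr //.
  have := enorm_dist y x; rewrite enormB => hd.
  apply: le_trans (ler_pM (normr_ge0 _) (normr_ge0 _) hd (outer_norm_le y y)) _.
  by rewrite ler_wpM2l // ler_wpM2r // ltW.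
apply: le_trans (ler_normD _ _) _.
have := ler_normD ((enorm x)^-1 *: (y^T *m (x - y)))
  (((enorm x)^-1 - (enorm y)^-1) *: (y^T *m y)).
by clear -h1 h2 h3; lra.
Qed.

Lemma radial_sq_norm_le x : `|radial_sq x| <= enorm x.
Proof.
have [->|xn] := eqVneq x 0.
  by rewrite /radial_sq mulmx0 scaler0 normr0 enorm0.
have N0 := enorm_gt0 xn.
rewrite normrZ normfV (gtr0_norm N0) mulrC ler_pdivrMr //; exact: outer_norm_le.
Qed.

Lemma radial_sqZ c x : 0 <= c -> radial_sq (c *: x) = c *: radial_sq x.
Proof.
rewrite le_eqVlt => /predU1P[<-|c0].
  by rewrite !scale0r /radial_sq mulmx0 scaler0.
have tZ : (c *: x)^T = c *: x^T by apply/matrixP => i j; rewrite !mxE.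
rewrite /radial_sq enormZ (gtr0_norm c0) tZ -scalemxAl -scalemxAr !scalerA.
by congr (_ *: _); rewrite invfM; move: (enorm x)^-1 => i; field; rewrite gt_eqF.
Qed.

Lemma compress_has_jacobian M x : 0 < 1 + M * enorm x ->
  has_jacobian (compress M) x (compress_jacobian M x).
Proof.
move=> Mx eps eps0; have N0 := enorm_ge0 x.
have [nu nuE] : exists nu, nu = (1 + M * enorm x)^-1 by eexists.
have nu0 : 0 < nu by rewrite nuE invr_gt0.
(* The error turns out to be at most [|M| nu nu' (3 + |M| nu |x|) |h| ^ 2], with [nu' <= 2 nu]; the
   final 1 makes [c] a valid divisor. *)
pose c := 2 * `|M| * nu ^+ 2 * (3 + `|M| * nu * enorm x) + 1.
have c0 : 0 < c.
  have k1 : 0 <= `|M| * nu ^+ 2 by rewrite mulr_ge0 ?sqr_ge0.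
  have k2 : 0 <= `|M| * nu * enorm x by rewrite !mulr_ge0 // ltW.
  by have := mulr_ge0 k1 k2; rewrite /c; clear -k1; lra.
have M1 : 0 < `|M| + 1 by rewrite ltr_wpDl.
exists (Num.min (eps / c) ((1 + M * enorm x) / 2 / (`|M| + 1))).
  by rewrite lt_min !divr_gt0.
move=> y; rewrite lt_min => /andP[yd1 yd2].
have [h hE] : exists h, h = y - x by eexists.
have yE : y = x + h by rewrite hE addrC subrK.
rewrite -hE in yd1 yd2 *; have d0 := enorm_ge0 h.
(* Multiplying by [|x|] covers [x = 0], where the norm is not differentiable but [compress] is. *)
have HR : `|enorm y - enorm x - dot h x / enorm x| * enorm x <= 2 * enorm h ^+ 2.
  have [x0|xn] := eqVneq x 0.
    by rewrite x0 enorm0 mulr0 mulr_ge0 ?ler0n ?sqr_ge0.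
  by rewrite -ler_pdivlMr ?enorm_gt0 // yE; exact: enorm_expand.
have uN : `|dot h x / enorm x| <= enorm h.
  have [x0|xn] := eqVneq x 0; first by rewrite x0 dot0r mul0r normr0.
  have Np := enorm_gt0 xn; rewrite normrM normfV (gtr0_norm Np) ler_pdivrMr //.
  exact: dot_le.
have Nd : `|enorm y - enorm x| <= enorm h.
  by apply: le_trans (enorm_dist _ _) _; rewrite yE [x + h]addrC addrK.
have My : (1 + M * enorm x) / 2 <= 1 + M * enorm y.
  have h1 : `|M * (enorm y - enorm x)| <= (1 + M * enorm x) / 2.
    rewrite normrM; apply: le_trans (ler_wpM2l (normr_ge0 M) Nd) _.
    move: yd2; rewrite ltr_pdivlMr //; clear -d0; lra.
  by move: h1; rewrite ler_norml => /andP[h1 _]; clear -h1; lra.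
have My0 : 0 < 1 + M * enorm y by clear -My Mx; lra.
have [nu' nu'E] : exists nu', nu' = (1 + M * enorm y)^-1 by eexists.
have nu'0 : 0 < nu' by rewrite nu'E invr_gt0.
have nu'2 : nu' <= 2 * nu.
  rewrite nu'E nuE; have -> : 2 * (1 + M * enorm x)^-1 = ((1 + M * enorm x) / 2)^-1.
    by rewrite invfM invrK mulrC.
  by rewrite lef_pV2 ?posrE ?divr_gt0.
have dnu : nu' - nu = M * (enorm x - enorm y) * nu * nu'.
  by rewrite nu'E nuE; field; apply/andP; split; rewrite gt_eqF.
have dnu_le : `|nu' - nu| <= `|M| * enorm h * nu * nu'.
  rewrite dnu !normrM (gtr0_norm nu0) (gtr0_norm nu'0) distrC.
  by rewrite !ler_wpM2r ?(ltW nu0) ?(ltW nu'0) // ler_wpM2l.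
pose Rm := enorm y - enorm x - dot h x / enorm x.
have -> : compress M y - compress M x - h *m compress_jacobian M x =
    (nu' - nu) *: h + (M * nu * ((nu - nu') * (dot h x / enorm x) - Rm * nu')) *: x.
  rewrite /compress /compress_jacobian mulmxBr -!scalemxAr mulmx1 mulmx_outer.
  rewrite -nuE -nu'E yE scalerDr opprB !scalerA.
  have -> : M * nu * ((nu - nu') * (dot h x / enorm x) - Rm * nu') =
      (nu' - nu) + M * nu ^+ 2 * (enorm x)^-1 * dot h x.
    by rewrite dnu /Rm; ring.
  by apply/rowP => i; rewrite !mxE; ring.
apply: le_trans (enormD _ _) _; rewrite !enormZ.
have h1 : `|nu' - nu| * enorm h <= `|M| * nu * nu' * enorm h ^+ 2.
  by have := ler_wpM2r d0 dnu_le; clear; lra.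
have h2 : `|M * nu * ((nu - nu') * (dot h x / enorm x) - Rm * nu')| * enorm x <=
    `|M| * nu * (`|M| * nu * nu' * enorm h ^+ 2 * enorm x + 2 * enorm h ^+ 2 * nu').
  rewrite !normrM (gtr0_norm nu0) -!mulrA !ler_wpM2l ?(ltW nu0) //.
  have g1 : `|(nu - nu') * (dot h x / enorm x)| * enorm x <=
      `|M| * nu * nu' * enorm h ^+ 2 * enorm x.
    rewrite ler_wpM2r // normrM distrC.
    have := ler_pM (normr_ge0 _) (normr_ge0 _) dnu_le uN; clear; lra.
  have g2 : `|Rm * nu'| * enorm x <= 2 * enorm h ^+ 2 * nu'.
    rewrite normrM (gtr0_norm nu'0) mulrAC ler_wpM2r ?(ltW nu'0) //.
  apply: le_trans (ler_wpM2r N0 (ler_normB _ _)) _; rewrite mulrDl.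
  by apply: le_trans (lerD g1 g2) _; clear; lra.
apply: le_trans (lerD h1 h2) _.
have Mn0 : 0 <= `|M| * nu by rewrite mulr_ge0 // ltW.
have h3 : `|M| * nu * nu' * (3 + `|M| * nu * enorm x) <= c.
  have k0 : 0 <= `|M| * nu * (3 + `|M| * nu * enorm x).
    by rewrite mulr_ge0 // addr_ge0 ?ler0n // mulr_ge0.
  by have := ler_wpM2l k0 nu'2; rewrite /c; clear; lra.
have h4 := ler_wpM2r (sqr_ge0 (enorm h)) h3.
have h5 : c * enorm h <= eps by move: yd1; rewrite ltr_pdivlMr // mulrC => /ltW.
have h6 := ler_wpM2r d0 h5.
by rewrite expr2 in h4 *; clear -h4 h6; lra.
Qed.

Lemma continuous_compress_jacobian M x : 0 < 1 + M * enorm x ->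
  {for x, continuous (compress_jacobian M)}.
Proof.
move=> Mx.
have N_cont : {for x, continuous (fun x => 1 + M * enorm x)}.
  apply: (@lipschitz_continuous _ _ _ `|M|) => {Mx}x y.
  rewrite opprD addrACA subrr add0r -mulrBr normrM ler_wpM2l //; exact: enorm_dist.
have inv_cont : {for x, continuous (fun x => (1 + M * enorm x)^-1)}.
  by apply: (cvgV _ N_cont); rewrite gt_eqF.
have rad_cont : {for x, continuous radial_sq}.
  by apply: lipschitz_continuous; exact: radial_sq_lipschitz.
have sq_cont : {for x, continuous (fun x => M * (1 + M * enorm x)^-1 ^+ 2)}.
  have := cvgM (cvg_cst M) (cvgM inv_cont inv_cont).
  by apply.
exact: (cvgB (cvgZ inv_cont (cvg_cst (1%:M : 'M[R]_4))) (cvgZ sq_cont rad_cont)).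
Qed.

Section Positive.
Variables (M : R) (M0 : 0 < M).

Lemma compress_den_ge1 x : 1 <= 1 + M * enorm x.
Proof. by rewrite lerDl mulr_ge0 ?enorm_ge0 // ltW. Qed.

Let den_gt0 x : 0 < 1 + M * enorm x.
Proof. exact: lt_le_trans (compress_den_ge1 x). Qed.

Lemma compress_nu_bound x : 0 < (1 + M * enorm x)^-1 <= 1.
Proof. by rewrite invr_gt0 den_gt0 invf_cp1 // compress_den_ge1. Qed.

Lemma compress_nu_lipschitz x y :
  `|(1 + M * enorm x)^-1 - (1 + M * enorm y)^-1| <=
    M * enorm (x - y) * ((1 + M * enorm x)^-1 * (1 + M * enorm y)^-1).
Proof.
have -> : (1 + M * enorm x)^-1 - (1 + M * enorm y)^-1 =
    M * (enorm y - enorm x) * ((1 + M * enorm x)^-1 * (1 + M * enorm y)^-1).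
  by field; apply/andP; split; rewrite gt_eqF.
have /andP[nx _] := compress_nu_bound x; have /andP[ny _] := compress_nu_bound y.
have nxy := mulr_gt0 nx ny.
rewrite normrM (gtr0_norm nxy) normrM (gtr0_norm M0) (ler_wpM2r (ltW nxy)) //.
by rewrite (ler_wpM2l (ltW M0)) // distrC enorm_dist.
Qed.

Lemma compress_lipschitz x y : enorm (compress M x - compress M y) <= 2 * enorm (x - y).
Proof.
have -> : compress M x - compress M y = (1 + M * enorm x)^-1 *: (x - y) +
    ((1 + M * enorm x)^-1 - (1 + M * enorm y)^-1) *: y.
  by rewrite /compress scalerBr scalerBl addrA subrK.
apply: le_trans (enormD _ _) _; rewrite !enormZ.
have /andP[nx nx1] := compress_nu_bound x; have /andP[ny _] := compress_nu_bound y.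
rewrite (gtr0_norm nx); have d0 := enorm_ge0 (x - y).
have h1 := ler_wpM2r d0 nx1.
have h2 := ler_wpM2r (enorm_ge0 y) (compress_nu_lipschitz x y).
have h3 : M * enorm y * (1 + M * enorm y)^-1 <= 1.
  by rewrite ler_pdivrMr // mul1r lerDr.
have h4 := ler_wpM2l (mulr_ge0 d0 (ltW nx)) h3.
by clear -h1 h2 h4; lra.
Qed.

Lemma compress_lt x : M * enorm (compress M x) < 1.
Proof.
by rewrite enorm_compress // mulrCA mulrC ltr_pdivrMr // mul1r ltrDr.
Qed.

(** Rewriting [radial_sq x] at the compressed point, of norm below [M^-1], yields bounds uniform on
    the whole space. *)
Lemma compress_jacobianE x : compress_jacobian M x =
  (1 + M * enorm x)^-1 *: (1%:M - M *: radial_sq (compress M x)).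
Proof.
have /andP[nx _] := compress_nu_bound x.
rewrite /compress_jacobian /compress (radial_sqZ _ (ltW nx)) scalerBr !scalerA.
congr (_ - _ *: _).
by rewrite expr2; ring.
Qed.

Lemma norm_one_mx : `|1%:M : 'M[R]_4| <= 1.
Proof.
by apply: mx_norm_le => // i j; rewrite mxE; case: eqP; rewrite ?normr1 ?normr0.
Qed.

Lemma compress_factor_le x : `|1%:M - M *: radial_sq (compress M x)| <= 2.
Proof.
apply: le_trans (ler_normB _ _) _; rewrite normrZ (gtr0_norm M0).
have := ler_wpM2l (ltW M0) (radial_sq_norm_le (compress M x)).
by have := compress_lt x; have := norm_one_mx; clear; lra.
Qed.

Lemma compress_jacobian_le x : `|compress_jacobian M x| <= 2.
Proof.
have /andP[nx nx1] := compress_nu_bound x.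
rewrite compress_jacobianE normrZ (gtr0_norm nx).
have := ler_pM (ltW nx) (normr_ge0 _) nx1 (compress_factor_le x).
by rewrite mul1r.
Qed.

Lemma compress_jacobian_lipschitz x y :
  `|compress_jacobian M x - compress_jacobian M y| <= 8 * M * enorm (x - y).
Proof.
rewrite !compress_jacobianE.
set A := 1%:M - M *: radial_sq (compress M x).
set B := 1%:M - M *: radial_sq (compress M y).
have -> : (1 + M * enorm x)^-1 *: A - (1 + M * enorm y)^-1 *: B =
    ((1 + M * enorm x)^-1 - (1 + M * enorm y)^-1) *: A +
    (1 + M * enorm y)^-1 *: (A - B).
  by rewrite (scalerBr _ A B) (scalerBl _ _ A) addrA subrK.
have AB : `|A - B| <= 6 * M * enorm (x - y).
  have -> : A - B = M *: (radial_sq (compress M y) - radial_sq (compress M x)).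
    rewrite /A /B; move: (radial_sq _) (radial_sq _) => P Q.
    by apply/matrixP => i j; rewrite !mxE; ring.
  rewrite normrZ (gtr0_norm M0).
  have := radial_sq_lipschitz (compress M y) (compress M x).
  have := compress_lipschitz y x; rewrite (enormB y x) => h1 h2.
  by have := ler_wpM2l (ltW M0) (le_trans h2 (ler_wpM2l (ler0n _ 3) h1)); clear; lra.
have /andP[nx nx1] := compress_nu_bound x; have /andP[ny ny1] := compress_nu_bound y.
apply: le_trans (ler_normD _ _) _; rewrite !normrZ (gtr0_norm ny).
have Md0 : 0 <= M * enorm (x - y) by rewrite mulr_ge0 ?enorm_ge0 // ltW.
have n1 : (1 + M * enorm x)^-1 * (1 + M * enorm y)^-1 <= 1.
  by rewrite -[leRHS](mul1r 1) ler_pM // ltW.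
have g0 := le_trans (compress_nu_lipschitz x y) (ler_wpM2l Md0 n1).
have g1 := ler_pM (normr_ge0 _) (normr_ge0 _) g0 (compress_factor_le x).
have g2 := ler_pM (ltW ny) (normr_ge0 _) ny1 AB.
by clear -g1 g2; lra.
Qed.

(** A global estimate is required, since [U] is the whole space: the Lipschitz bound serves at
    distances up to 1, boundedness ([4 = 2 + 2]) beyond. *)
Lemma compress_jacobian_hoelder b x y : 0 < b <= 1 ->
  `|compress_jacobian M x - compress_jacobian M y| <=
     (8 * M + 4) * enorm (x - y) `^ b.
Proof.
move=> /andP[b0 b1]; have t0 := enorm_ge0 (x - y); have tb := powR_ge0 (enorm (x - y)) b.
have [t1|t1] := leP (enorm (x - y)) 1.
  have h : enorm (x - y) <= enorm (x - y) `^ b.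
    by rewrite -{1}(powRr1 t0) ler_powRr ?t0 // b0.
  apply: le_trans (compress_jacobian_lipschitz x y) _.
  by have := ler_wpM2l (ltW M0) h; clear -tb; lra.
have h := powR_ge1 (ltW b0) (ltW t1).
apply: le_trans (ler_normB _ _) _.
have h1 := compress_jacobian_le x; have h2 := compress_jacobian_le y.
by have := mulr_ge0 (ltW M0) tb; clear -h h1 h2; lra.
Qed.

End Positive.
End Compression.

(** * Planes and distances *)

Section Distances.
Context {R : realType}.
Implicit Types (x y z v n : 'rV[R]_4) (r t : R) (A B S L : set 'rV[R]_4).

(** The centre [x] competes in every infimum, which is therefore at most [r]: this makes the
    supremum a genuine one. *)
Lemma excess_lt x r t A B y : 0 < r -> B x -> excess x r A B < t ->
  A y -> enorm (y - x) <= r ->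
  exists2 b, B b & enorm (b - x) <= r /\ enorm (y - b) < t * r.
Proof.
move=> r0 Bx ext Ay yr.
pose D a := [set enorm (a - b) | b in B `&` eball x r].
have Bxr : (B `&` eball x r) x.
  by split => //; rewrite /eball /= subrr enorm0 ltW.
have D_le a : inf (D a) <= enorm (a - x).
  by apply: ge_inf; [exists 0 => _ [b _ <-]; exact: enorm_ge0|exists x].
have [_ [b [Bb br] <-] yb] : exists2 d, D y d & d < t * r.
  apply: inf_lt; first by exists (enorm (y - x)), x.
  apply: (@le_lt_trans _ _ (sup [set inf (D a) | a in A `&` eball x r])).
    apply: ub_le_sup; last by exists y.
    by exists r => _ [a [_ ar] <-]; exact: le_trans (D_le a) ar.
  by move: ext; rewrite /excess mulrC ltr_pdivrMr.
by exists b.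
Qed.

Lemma thetaP_lt S x r t : thetaP S x r < t ->
  exists L, [/\ affine_3plane L, L x & bidist x r S L < t].
Proof.
move=> /inf_lt[|_ [L [aL Lx] <-] Lt]; last by exists L.
(* Some plane through [x] has to be exhibited, because [inf] of an empty set is a default value. *)
pose d : 'rV[R]_4 := delta_mx 0 0.
pose V : {vspace 'rV[R]_4} := (<[d]>^C)%VS.
exists (bidist x r S [set x + v | v in [set` V]]), [set x + v | v in [set` V]] => //.
split; last by exists 0; rewrite /= ?addr0 ?mem0v.
exists x, V; split => //.
have d0 : d != 0.
  by apply/eqP => /rowP/(_ 0)/eqP; rewrite !mxE eqxx oner_eq0.
by rewrite dimv_compl dimvf dim_vline d0.
Qed.

(** Three basis vectors cannot span the four columns, so some [m] is orthogonal to all of them. [V]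
    is then contained in the kernel of [<_, m>], whose dimension is at most 3 because [m] is not in
    it. *)
Lemma hyperplane_normal (V : {vspace 'rV[R]_4}) : \dim V = 3%N ->
  exists2 n, dot n n = 1 & forall v, (v \in V) = (dot v n == 0).
Proof.
move=> V3; pose B : 'M[R]_(\dim V, 4) := \matrix_(i < \dim V) (vbasis V)`_i.
have /rowV0Pn[m /sub_kermxP mB m0] : kermx B^T != 0.
  rewrite -mxrank_eq0 mxrank_ker -lt0n subn_gt0.
  by apply: leq_ltn_trans (rank_leq_col _) _; rewrite V3.
have M0 := enorm_gt0 m0; exists ((enorm m)^-1 *: m).
  by rewrite !dotE -sqr_enorm; field; rewrite gt_eqF.
pose f := linfun (mulmxr m^T : {linear 'rV[R]_4 -> 'rV[R]_1}).
have fE v : (v \in lker f) = (dot v m == 0).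
  have dotE0 : (v *m m^T) 0 0 = dot v m.
    by rewrite mxE; apply: eq_bigr => j _; rewrite mxE.
  rewrite memv_ker lfunE /=; apply/eqP/eqP => [vm|vm].
    by rewrite -dotE0 vm mxE.
  by apply/rowP => i; rewrite (ord1 i) dotE0 vm mxE.
suff -> : V = lker f.
  by move=> v; rewrite fE dotZr mulf_eq0 invr_eq0 (gt_eqF M0).
apply/eqP; rewrite eqEdim; apply/andP; split.
  rewrite -(span_basis (vbasisP V)); apply/span_subvP => v vV.
  rewrite fE; have /(nthP 0)[i] := vV; rewrite size_tuple => iV <-.
  move/rowP: mB => /(_ (Ordinal iV)); rewrite !mxE => mB; apply/eqP; rewrite -[RHS]mB.
  by apply: eq_bigr => j _; rewrite !mxE mulrC.
have := limg_ker_dim f fullv; rewrite capfv dimvf dim_matrix V3 => dims.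
have : (0 < \dim (f @: fullv))%N.
  rewrite lt0n dimv_eq0; apply/eqP => f0.
  have : f m \in (f @: fullv)%VS by rewrite memv_img ?memvf.
  rewrite f0 memv0 => /eqP fm; have : m \in lker f by rewrite memv_ker fm.
  by rewrite fE -sqr_enorm sqrf_eq0 gt_eqF.
have key d k : (d + k = 4)%N -> (0 < k)%N -> (d <= 3)%N.
  by move=> dk k0; rewrite -ltnS -[X in (_ < X)%N]dk -addn1 leq_add2l.
exact: key dims.
Qed.

Lemma plane_normal L x : affine_3plane L -> L x ->
  exists2 n, dot n n = 1 & forall y, L y <-> dot (y - x) n = 0.
Proof.
move=> [p [V [V3 LE]]]; rewrite {1}LE => -[u uV <-].
have [n nn nV] := hyperplane_normal V3; exists n => // y.
rewrite LE; split => [[v vV <-]|/eqP].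
  rewrite opprD addrACA subrr add0r; apply/eqP; rewrite -nV.
  by apply: memvB.
rewrite -nV => yV; exists (y - p); last by rewrite addrC subrK.
have -> : y - p = (y - (p + u)) + u by rewrite opprD addrA subrK.
exact: memvD.
Qed.

(** The axis is the last column of [Q]. As [Q] preserves lengths, the first three coordinates have
    square sum [|P z| ^ 2]. *)
Lemma kp_cone_unit C : kp_cone_at 0 C ->
  exists2 e : 'rV[R]_4, dot e e = 1 &
    forall z, C z <-> `|dot z e| = enorm (perp e z).
Proof.
move=> [Q [QQ CE]]; pose e : 'rV[R]_4 := (col 3 Q)^T.
have eE z : (z *m Q) 0 3 = dot z e.
  by rewrite mxE; apply: eq_bigr => i _; rewrite !mxE.
have e1 : dot e e = 1.
  have := mulmx1C QQ => /matrixP/(_ 3 3); rewrite !mxE eqxx; apply: etrans.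
  by apply: eq_bigr => i _; rewrite !mxE.
exists e => // z; rewrite CE /= subr0.
have E : dot z z = (z *m Q) 0 0 ^+ 2 + (z *m Q) 0 1 ^+ 2 + (z *m Q) 0 2 ^+ 2 + (z *m Q) 0 3 ^+ 2.
  have -> : dot z z = dot (z *m Q) (z *m Q) by rewrite dot_mul_rV -mulmxA QQ mulmx1.
  rewrite /dot !big_ord_recl big_ord0 addr0 -!expr2 !addrA.
  by congr (_ ^+ 2 + _ ^+ 2 + _ ^+ 2 + _ ^+ 2); congr ((_ *m _) _ _); apply: val_inj.
have P := pythagoras e1 z; rewrite sqr_enorm E eE in P.
have abs2 : `|dot z e| ^+ 2 = dot z e ^+ 2 by rewrite real_normK ?num_real.
rewrite eE; split => [h|h].
  apply/eqP; rewrite -(eqrXn2 (n := 2)) ?enorm_ge0 // abs2 h; apply/eqP; lra.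
by move: P; rewrite -h abs2; lra.
Qed.

End Distances.

(** * Charts *)

Section NearCone.
Context {R : realType}.
Implicit Types (x y z v n e : 'rV[R]_4) (r t : R) (S C : set 'rV[R]_4).

Lemma perpN e x : perp (- e) x = perp e x.
Proof. by rewrite /perp dotNr scaleNr scalerN opprK. Qed.

Lemma perp_slope_lipschitz e x y : dot e e = 1 ->
  `| (`|dot x e| - enorm (perp e x)) - (`|dot y e| - enorm (perp e y))|
    <= 2 * enorm (x - y).
Proof.
move=> e1.
have -> : (`|dot x e| - enorm (perp e x)) - (`|dot y e| - enorm (perp e y)) =
  (`|dot x e| - `|dot y e|) - (enorm (perp e x) - enorm (perp e y)) by ring.
apply: le_trans (ler_normB _ _) _; rewrite mulr_natl mulr2n; apply: lerD.
  apply: le_trans (ler_dist_dist _ _) _; rewrite -dotNl -dotDl.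
  exact: dot_unit_le.
apply: le_trans (enorm_dist _ _) _; rewrite -perpB; exact: enorm_perp.
Qed.

(* All constants are absorbed by slightly lowering the exponents. *)
Lemma near_cone_exists (gamma beta1 beta2 g a C1 C2 A r0 : R) S C e :
    0 < gamma -> gamma < g -> 0 < a -> g + a < beta1 -> a < beta2 ->
    0 < C1 -> 0 < C2 -> 0 < A -> 0 < r0 ->
    closed S -> S 0 -> dot e e = 1 ->
    (forall z, C z <-> `|dot z e| = enorm (perp e z)) ->
    (forall r : R, 0 < r <= 2 * r0 -> bidist 0 r S C <= C1 * r `^ beta1) ->
    (forall x r, S x -> x != 0 -> enorm x <= r0 ->
       0 < r <= 16 * (enorm x `^ (1 + gamma) / A) -> thetaP S x r <= C2 * r `^ beta2) ->
  exists2 rho, 0 < rho <= 1 &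
    forall rho', 0 < rho' <= rho -> near_cone S e g a rho'.
Proof.
move=> gm0 gmg a0 gab ab2 C10 C20 A0 r00 cS S0 e1 CE E1 E2.
have g0 : 0 < g := lt_trans gm0 gmg.
have [k1 kE1] : exists k1, k1 = beta1 - (g + a) by eexists.
have k10 : 0 < k1 by rewrite kE1 subr_gt0.
have [||rho1 /andP[rho10 rho11] rho1P] :=
  @powR_small _ k1 (8 * C1 * 2 `^ (1 + beta1)) 1 k10.
- by rewrite mulr_ge0 ?powR_ge0 // mulr_ge0 ?ler0n // ltW.
- by [].
have [|||rho2 /andP[rho20 rho21] rho2P] := @powR_small _ (beta2 - a) (4 * C2) 1.
- by rewrite subr_gt0.
- by rewrite mulr_ge0 ?ler0n // ltW.
- by [].
(* Below [rho3] the scale [|x| ^ (1 + g)] is within the range [16 |x| ^ (1 + gamma) / A] of (E2). *)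
have [|||rho3 /andP[rho30 rho31] rho3P] := @powR_small _ (g - gamma) A 16.
- by rewrite subr_gt0.
- exact: ltW.
- by [].
exists (Num.min (Num.min rho1 rho2) (Num.min rho3 r0)).
  by rewrite !lt_min rho10 rho20 rho30 r00 /= !ge_min rho11.
move=> rho /andP[rho0]; rewrite !le_min => /andP[/andP[rr1 rr2] /andP[rr3 rr0]].
have C0 : C 0 by apply/CE; rewrite dot0l normr0 (perp_id (dot0l e)) enorm0.
have E1_lt r : 0 < r <= rho -> 0 < C1 * (2 * r) `^ beta1 /\
    2 * C1 * (2 * r) `^ beta1 * (2 * r) <= r `^ (1 + g + a) / 2.
  move=> /andP[rp rr]; have r2 : 0 < 2 * r by rewrite mulr_gt0.
  split; first by rewrite mulr_gt0 // powR_gt0.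
  have b10 : 0 < beta1 by clear -g0 a0 gab; lra.
  have -> : 2 * C1 * (2 * r) `^ beta1 * (2 * r) = 2 * C1 * (2 * r) `^ (1 + beta1).
    by rewrite (powR1D (ltW r2) b10); ring.
  have -> : (2 * r) `^ (1 + beta1) = 2 `^ (1 + beta1) * (r `^ (1 + g + a) * r `^ k1).
    rewrite (powRM _ (ler0n _ 2) (ltW rp)) -powRDp //; last first.
      by clear -g0 a0; lra.
    by congr (_ * _ `^ _); rewrite kE1; ring.
  have rk : 0 <= r <= rho1 by rewrite (ltW rp) (le_trans rr).
  have D0 := powR_ge0 r (1 + g + a).
  by have := ler_wpM2l D0 (rho1P r rk); clear -D0; lra.
(* The radius is doubled to contain the points of norm up to [2 r], and the constant to obtain the
   strict inequality needed by [excess_lt]. *)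
have E1r r : 0 < r <= rho -> bidist 0 (2 * r) S C < 2 * C1 * (2 * r) `^ beta1.
  move=> hr; have [p _] := E1_lt r hr; have /andP[rp rr] := hr.
  apply: le_lt_trans (E1 (2 * r) _) _; last by clear -p; lra.
  by rewrite mulr_gt0 //= ler_pM2l // (le_trans rr).
split => //.
- move=> x r Sx hr x2; have := E1r r hr; rewrite /bidist gt_max => /andP[ex _].
  have /andP[rp _] := hr; have r2 : 0 < 2 * r by rewrite mulr_gt0.
  have [|c Cc [_ xc]] := excess_lt r2 C0 ex Sx; first by rewrite subr0.
  have cc : `|dot c e| - enorm (perp e c) = 0 by have /CE -> := Cc; rewrite subrr.
  have := perp_slope_lipschitz x c e1; rewrite cc subr0 => h.
  by have [_ h2] := E1_lt r hr; clear -h h2 xc; lra.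
- move=> z ze hz; have /andP[z0 _] := hz.
  have := E1r _ hz; rewrite /bidist gt_max => /andP[_ ex].
  have r2 : 0 < 2 * enorm z by rewrite mulr_gt0.
  have Cz : C (z + enorm z *: e).
    apply/CE; rewrite (perp_add e1) (perp_id ze) dotDl dotZl ze e1 add0r mulr1.
    by rewrite ger0_norm ?enorm_ge0.
  have [|x Sx [_ xc]] := excess_lt r2 S0 ex Cz.
    rewrite subr0; apply: le_trans (enormD _ _) _.
    by rewrite (enorm_scale_unit e1) ger0_norm ?enorm_ge0 //; clear; lra.
  exists x => //; rewrite enormB; have [_ h2] := E1_lt _ hz.
  by have := powR_ge0 (enorm z) (1 + g + a); clear -h2 xc; lra.
move=> x r Sx /andP[x0 xr] /andP[rp rx].
have xn : x != 0 by apply/eqP => E; move: x0; rewrite E enorm0 ltxx.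
have x1 : enorm x <= 1 by apply: le_trans xr (le_trans rr1 rho11).
have gm1 : 0 < 1 + gamma by rewrite addr_gt0.
have rA : r <= 16 * (enorm x `^ (1 + gamma) / A).
  apply: le_trans rx _; rewrite mulrA ler_pdivlMr //.
  have -> : 1 + g = (1 + gamma) + (g - gamma) by ring.
  rewrite powRDp ?subr_gt0 //.
  have hx : 0 <= enorm x <= rho3 by rewrite enorm_ge0 (le_trans xr).
  by have := ler_wpM2l (powR_ge0 (enorm x) (1 + gamma)) (rho3P _ hx); clear; lra.
have rrho : r <= rho.
  apply: le_trans rx (le_trans _ xr); rewrite -[leRHS]powRr1 ?enorm_ge0 //.
  by apply: ler_powRr; rewrite ?enorm_ge0 // ltr01 lerDl ltW.
have rb0 : 0 < C2 * r `^ beta2 by rewrite mulr_gt0 // powR_gt0.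
have tl : thetaP S x r < 2 * C2 * r `^ beta2.
  apply: le_lt_trans (E2 x r Sx xn (le_trans xr rr0) _) _; first by rewrite rp.
  by clear -rb0; lra.
have [L [aL Lx]] := thetaP_lt tl; rewrite /bidist gt_max => /andP[SL LS].
have [n nn nL] := plane_normal aL Lx; exists n => //.
have rb : 2 * C2 * r `^ beta2 * r <= r `^ (1 + a).
  have -> : beta2 = a + (beta2 - a) by ring.
  rewrite powRDp ?subr_gt0 // (powR1D (ltW rp) a0).
  have hr : 0 <= r <= rho2 by rewrite (ltW rp) (le_trans rrho).
  have ra0 : 0 <= r * r `^ a by rewrite mulr_ge0 ?powR_ge0 // ltW.
  by have := ler_wpM2l ra0 (rho2P r hr); clear -ra0; lra.
split=> [y Sy yx|v vn vr].
  have [b Lb [_ yb]] := excess_lt rp Lx SL Sy yx.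
  have -> : dot (y - x) n = dot (y - b) n.
    have bn : dot (b - x) n = 0 := (nL b).1 Lb.
    have -> : y - x = (y - b) + (b - x) by rewrite addrA subrK.
    by rewrite dotDl bn addr0.
  by apply: le_trans (dot_unit_le nn _) (le_trans (ltW yb) rb).
have Lv : L (x + v) by apply/nL; rewrite addrAC subrr add0r.
have [|y Sy [yx yv]] := excess_lt rp Sx LS Lv; first by rewrite addrAC subrr add0r.
exists y => //; split => //; have -> : y - x - v = y - (x + v) by rewrite opprD addrA.
by rewrite enormB; exact: le_trans (ltW yv) rb.
Qed.

End NearCone.

Section Chart.
Context {R : realType}.
Implicit Types (x y z v n e : 'rV[R]_4) (r t : R) (S C : set 'rV[R]_4).

Lemma cosine_cone e x : dot e e = 1 -> x != 0 -> `|dot x e| = enorm (perp e x) ->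
  cosine e x = Num.sg (dot x e) / Num.sqrt 2.
Proof.
move=> e1 xn xe; have x0 := enorm_gt0 xn.
have s0 : 0 < Num.sqrt 2 :> R by rewrite sqrtr_gt0.
have E : enorm x = Num.sqrt 2 * `|dot x e|.
  have abs2 : `|dot x e| ^+ 2 = dot x e ^+ 2 by rewrite real_normK ?num_real.
  have P := pythagoras e1 x; rewrite -xe abs2 in P.
  have s2 : Num.sqrt 2 ^+ 2 = 2 :> R by rewrite sqr_sqrtr ?ler0n.
  apply/eqP; rewrite -(eqrXn2 (n := 2)) ?enorm_ge0 ?mulr_ge0 ?(ltW s0) //.
  by rewrite exprMn s2 abs2 P; apply/eqP; ring.
have d0 : dot x e != 0.
  by apply/eqP => d0; move: x0; rewrite E d0 normr0 mulr0 ltxx.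
rewrite /cosine E {1}[dot x e]numEsg; field.
by rewrite normr_eq0 d0 gt_eqF.
Qed.

Lemma chart_exists (S C : set 'rV[R]_4) e g a rho :
    small_cone S e g a rho -> small_cone S (- e) g a rho ->
    (forall z, C z <-> `|dot z e| = enorm (perp e z)) ->
  exists (w : 'rV[R]_4 -> R) (W : 'rV[R]_4 -> 'rV[R]_4) (K r : R),
    [/\ 0 < r, 0 <= K, w 0 = 0 /\ W 0 = 0, taylor_on r (a / (1 + g)) K w W &
        (forall x, enorm x <= r -> C x -> S (shear e w x)) /\
        (forall y, S y -> enorm y <= r -> exists x,
           [/\ C x, enorm x <= 2 * enorm (perp e y) & shear e w x = y])].
Proof.
move=> sc1 sc2 CE; have [nc /andP[a0 a1] ag /andP[rho0 rho1] tiny] := sc1.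
have e1 := nc_unit nc; have perp0 : perp e 0 = 0 by rewrite (perp_id (dot0l e)).
have [f1 [G1 [K1 [f1_perp f1S f1U [f10 G10] [K10 T1]]]]] := sheet_function sc1.
have [f2 [G2 [K2 [f2_perp f2S f2U [f20 G20] [K20 T2]]]]] := sheet_function sc2.
have b01 : 0 < a / (1 + g) <= 1.
  have g1 : 0 < 1 + g by clear -a0 ag; lra.
  by rewrite divr_gt0 //= ler_pdivrMr //; clear -ag; lra.
set b := a / (1 + g) in b01 T1 T2 *.
have N2 := taylor_scale (-1) T2.
have TD := taylor_scale (1/2) (taylor_add T1 N2).
have f120 : f1 0 + f2 0 = 0 by rewrite f10 f20 addr0.
have G120 : G1 0 + G2 0 = 0 by rewrite G10 G20 addr0.
have TS := taylor_scale (Num.sqrt 2 / 2) (taylor_cosine e1 b01 (addr_ge0 K10 K20)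
  (taylor_add T1 T2) f120 G120).
have rr : rho / 4 / 4 <= rho / 4 by clear -rho0; lra.
have T := taylor_add (taylor_sub rr TD) TS.
(* The lower half is the upper half for the axis [- e], so its displacement along [e] is [- f2].
   With [cosine = 1 / sqrt 2] the formula gives [f1], and with the opposite sign [- f2]. *)
pose w x := 1/2 * (f1 x + -1 * f2 x) + Num.sqrt 2 / 2 * (cosine e x * (f1 x + f2 x)).
have s0 : 0 < Num.sqrt 2 :> R by rewrite sqrtr_gt0.
have w0 : w 0 = 0 by rewrite /w f10 f20 addr0 mulr0 mulr0 addr0 !mulr0 addr0.
have w_pos x : x != 0 -> `|dot x e| = enorm (perp e x) -> 0 < dot x e -> w x = f1 x.
  move=> xn xc xe; rewrite /w (cosine_cone e1 xn xc) gtr0_sg //; field.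
  by rewrite gt_eqF.
have w_neg x : x != 0 -> `|dot x e| = enorm (perp e x) -> dot x e < 0 -> w x = - f2 x.
  move=> xn xc xe; rewrite /w (cosine_cone e1 xn xc) ltr0_sg //; field.
  by rewrite gt_eqF.
have dot_neq0 x : x != 0 -> `|dot x e| = enorm (perp e x) -> dot x e != 0.
  move=> xn xc; apply: contra_neq xn => xe; rewrite [LHS](perpE e) xe scale0r addr0.
  by apply: enorm_eq0; rewrite -xc xe normr0.
exists w, (fun x => 1/2 *: (G1 x + -1 *: G2 x) +
   (Num.sqrt 2 / 2) *: (cosine e x *: (G1 x + G2 x) + (f1 x + f2 x) *: cosine_grad e x)).
eexists; exists (rho / 4 / 4); split; last 2 first.
- exact: T.
- split=> [x xr /CE xc|y Sy yr].
    have [->|xn] := eqVneq x 0; first by rewrite /shear w0 scale0r addr0; exact: nc_origin nc.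
    have px : 2 * enorm (perp e x) <= rho.
      by have := enorm_perp e1 x; have := enorm_ge0 x; clear -xr rho0; lra.
    rewrite /shear [X in X + _](perpE e x) -addrA -scalerDl.
    have := dot_neq0 x xn xc; case: ltgtP => // xe _.
      have := f2S x; rewrite perpN => /(_ px); rewrite (w_neg x xn xc xe) -xc ltr0_norm //.
      by rewrite scalerN -scaleNr opprD opprK.
    by have := f1S x px; rewrite (w_pos x xn xc xe) -xc gtr0_norm.
  have [y0|yn] := eqVneq y 0.
    exists 0; rewrite enorm0 mulr_ge0 ?enorm_ge0 // /shear w0 y0 scale0r addr0; split => //.
    by apply/CE; rewrite dot0l normr0 perp0 enorm0.
  have yp := enorm_gt0 yn.
  have yr' : 0 < enorm y <= rho by rewrite yp /=; clear -yr yp; lra.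
  have y4 : 4 * enorm y <= rho by clear -yr yp; lra.
  have [_ de pe _] := sheet_near nc a0 ag rho1 tiny Sy yr'.
  have p0 : 0 < enorm (perp e y) by clear -pe yp; lra.
  have ye : dot y e != 0 by rewrite -normr_gt0; clear -de yp; lra.
  have pid : perp e (perp e y) = perp e y := perp_id (dot_perp e1 y).
  (* The point of the cone over [P y], on the half selected by the sign [c]. *)
  have side c : c ^+ 2 = 1 -> let x := perp e y + (c * enorm (perp e y)) *: e in
      [/\ perp e x = perp e y, dot x e = c * enorm (perp e y), x != 0,
          `|dot x e| = enorm (perp e x) & enorm x <= 2 * enorm (perp e y)].
    move=> c2 x; have c1 : `|c| = 1.
      by apply/eqP; rewrite -(eqrXn2 (n := 2)) // real_normK ?num_real // c2 expr1n.
    have px : perp e x = perp e y by rewrite /x (perp_add e1) pid.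
    have dx : dot x e = c * enorm (perp e y).
      by rewrite /x dotDl dotZl e1 (dot_perp e1) add0r mulr1.
    have ax : `|dot x e| = enorm (perp e x).
      by rewrite dx normrM c1 mul1r px ger0_norm ?enorm_ge0.
    split => //.
      by apply/eqP => x0; move: p0; rewrite -px x0 perp0 enorm0 ltxx.
    rewrite /x; apply: le_trans (enormD _ _) _; rewrite (enorm_scale_unit e1).
    by rewrite normrM c1 mul1r ger0_norm ?enorm_ge0 //; clear; lra.
  move: ye; case: ltgtP => // ye _.
    have [|px dx xn ax x2] := side (-1); first by rewrite sqrrN expr1n.
    set x := _ + _ *: e in px dx xn ax x2.
    exists x; split => //; first exact/CE.
    have xe : dot x e < 0 by rewrite dx mulN1r oppr_lt0.
    have := f2U y Sy y4; rewrite dotNr oppr_gt0 perpN => /(_ ye) yE.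
    have f2x : f2 x = f2 y by apply: f2_perp; rewrite !perpN.
    rewrite /shear (w_neg x xn ax xe) f2x [in LHS](perpE e x) px dx -addrA -scalerDl.
    rewrite [RHS](perpE e y); congr (_ + _ *: _).
    by rewrite -[RHS]opprK yE; ring.
  have [px dx xn ax x2] := side 1 (expr1n _ _).
  set x := _ + _ *: e in px dx xn ax x2.
  exists x; split => //; first exact/CE.
  have xe : 0 < dot x e by rewrite dx mul1r.
  have yE := f1U y Sy y4 ye.
  have f1x : f1 x = f1 y by apply: f1_perp.
  rewrite /shear (w_pos x xn ax xe) f1x [in LHS](perpE e x) px dx -addrA -scalerDl.
  by rewrite [RHS](perpE e y) yE mul1r.
- by rewrite !divr_gt0.
- rewrite ?addr_ge0 ?mulr_ge0 ?ler0n ?addr_ge0 ?mulr_ge0 //.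
- split; first exact: w0.
  by rewrite /= G10 G20 f10 f20 !(scaler0, addr0, scale0r).
Qed.

End Chart.

Section SmallBall.
Context {R : realType}.
Implicit Types (x y : 'rV[R]_4).

Lemma taylor_small_ball (w : 'rV[R]_4 -> R) (W : 'rV[R]_4 -> 'rV[R]_4) (b K r : R) :
    0 < b <= 1 -> 0 <= K -> 0 < r -> W 0 = 0 -> taylor_on r b K w W ->
  exists2 r1, 0 < r1 <= r &
    [/\ forall x y, enorm x < r1 -> enorm y < r1 ->
          `|w y - w x| <= 1/2 * enorm (y - x),
        forall x, enorm x < r1 -> forall eps : R, 0 < eps ->
          exists2 d : R, 0 < d & forall y, enorm (y - x) < d ->
            `|w y - w x - dot (y - x) (W x)| <= eps * enorm (y - x),
        forall x, enorm x < r1 -> enorm (W x) <= 1/2,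
        forall x, enorm x < r1 -> {for x, continuous W} &
        forall x y, enorm x < r1 -> enorm y < r1 ->
          enorm (W x - W y) <= 6 * K * enorm (x - y) `^ b].
Proof.
move=> b01 K0 r0 W0 T; have /andP[b0 b1] := b01.
(* [7 K] dominates both [6 K], which bounds [W] through its Hoelder estimate from 0, and the [K] of
   the remainder; each contributes [1/4] to the Lipschitz constant [1/2] of [w]. *)
have [||rho /andP[rho0 _] rhoP] := @powR_small _ b (7 * K) (1/4) b0.
- by rewrite mulr_ge0 ?ler0n.
- by rewrite divr_gt0.
have H := taylor_hoelder b01 K0 T.
exists (Num.min (r / 4) (rho / 2)).
  by rewrite lt_min !divr_gt0 //= ge_min; apply/orP; left; clear -r0; lra.
have in_r x : enorm x < Num.min (r / 4) (rho / 2) ->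
    [/\ 4 * enorm x <= r, enorm x <= r & 2 * enorm x <= rho].
  rewrite lt_min => /andP[h1 h2]; have := enorm_ge0 x.
  by split; clear -h1 h2 r0; lra.
have W_hoelder x y : enorm x < Num.min (r / 4) (rho / 2) ->
    enorm y < Num.min (r / 4) (rho / 2) ->
    enorm (W x - W y) <= 6 * K * enorm (x - y) `^ b.
  by move=> /in_r[x4 _ _] /in_r[y4 _ _]; exact: H.
have z_in : enorm (0 : 'rV[R]_4) < Num.min (r / 4) (rho / 2).
  by rewrite enorm0 lt_min !divr_gt0.
have W_le x : enorm x < Num.min (r / 4) (rho / 2) -> enorm (W x) <= 1/4.
  move=> xr; have := W_hoelder x 0 xr z_in; rewrite W0 !subr0.
  have [_ _ x2] := in_r x xr.
  have hx : 0 <= enorm x <= rho by rewrite enorm_ge0 /=; have := enorm_ge0 x; clear -x2; lra.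
  have := rhoP _ hx; have := mulr_ge0 K0 (powR_ge0 (enorm x) b); clear; lra.
have near_r x : enorm x < Num.min (r / 4) (rho / 2) -> exists2 d : R, 0 < d &
    forall y, enorm (y - x) < d -> enorm y < Num.min (r / 4) (rho / 2).
  move=> xr; have /nbhs_enormP[d d0 dr] :=
    open_nbhs_nbhs (conj (@open_open_eball R (Num.min (r / 4) (rho / 2))) xr).
  by exists d.
split => //.
- move=> x y xr yr; have [_ x1 x2] := in_r x xr; have [_ y1 y2] := in_r y yr.
  have d0 := enorm_ge0 (y - x); have d_le := enorm_sub y x.
  have hd : 0 <= enorm (y - x) <= rho by rewrite d0 /=; clear -x2 y2 d_le; lra.
  have h := T x y x1 y1; rewrite (powR1D d0 b0) in h.
  have Kd := mulr_ge0 K0 (powR_ge0 (enorm (y - x)) b).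
  have h2 : enorm (y - x) * (K * enorm (y - x) `^ b) <= enorm (y - x) * (1 / 4).
    by apply: ler_wpM2l => //; have := rhoP _ hd; clear -Kd; lra.
  have h3 := le_trans (dot_le (y - x) (W x)) (ler_wpM2l d0 (W_le x xr)).
  have -> : w y - w x = (w y - w x - dot (y - x) (W x)) + dot (y - x) (W x) by ring.
  by apply: le_trans (ler_normD _ _) _; clear -h h2 h3; lra.
- move=> x xr eps eps0; have [d dp dr] := near_r x xr.
  have [rho' /andP[rho'0 _] rho'P] := @powR_small _ b K eps b0 K0 eps0.
  exists (Num.min d rho'); first by rewrite lt_min dp.
  move=> y; rewrite lt_min => /andP[yd yr].
  have [_ x1 _] := in_r x xr; have [_ y1 _] := in_r y (dr y yd).
  apply: le_trans (T x y x1 y1) _; have d0 := enorm_ge0 (y - x).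
  rewrite (powR1D d0 b0) mulrCA mulrC ler_wpM2r //.
  by apply: rho'P; rewrite d0 ltW.
- by move=> x /W_le; clear; lra.
move=> x xr; apply/continuous_enormP => eps eps0; have [d dp dr] := near_r x xr.
have [|rho' /andP[rho'0 _] rho'P] := @powR_small _ b (6 * K) eps b0 _ eps0.
  by rewrite mulr_ge0 ?ler0n.
exists (Num.min d rho'); first by rewrite lt_min dp.
move=> y; rewrite lt_min => /andP[yd yr].
apply: le_trans (norm_le_enorm _) (le_trans (W_hoelder y x (dr y yd) xr) _).
by apply: rho'P; rewrite enorm_ge0 ltW.
Qed.

End SmallBall.

Theorem theorem5p1 (R : realType) (gamma beta1 beta2 : R)
    (hgamma : 0 < gamma) (hbeta1 : gamma < beta1) (hbeta2 : 0 < beta2) :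
  exists2 beta : R, 0 < beta &
  forall C1 C2 : R, 0 < C1 -> 0 < C2 ->
  exists2 A0 : R, 1 < A0 &
  forall A : R, A0 <= A ->
  exists eps0 sigma0 delta0 rho0 : R,
    [/\ 0 < eps0, 0 < sigma0, 0 < delta0 & 0 < rho0] /\
  forall eps sigma delta r0 : R,
    0 < eps < eps0 -> 0 < sigma < sigma0 ->
    0 < delta < delta0 -> 0 < r0 < rho0 ->
  forall Sigma C : set 'rV[R]_4,
    closed Sigma -> Sigma 0 -> kp_cone_at 0 C ->
    (forall (x : 'rV[R]_4) (r : R), (eball 0 r0 `&` Sigma) x ->
       0 < r <= 2 * r0 -> varthetaC Sigma x r < eps) ->
    (forall r : R, 0 < r <= 2 * r0 ->
       bidist 0 r Sigma C <= Num.min sigma (C1 * r `^ beta1)) ->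
    (forall (x : 'rV[R]_4) (r : R), ((Sigma `&` eball 0 r0) `\ 0) x ->
       0 < r <= 16 * (enorm x `^ (1 + gamma) / A) ->
       thetaP Sigma x r <= Num.min delta (C2 * r `^ beta2)) ->
  exists (U U' : set 'rV[R]_4) (phi : 'rV[R]_4 -> 'rV[R]_4),
    [/\ open U, U 0, open U' & U' 0] /\
    [/\ C1beta_diffeo beta U U' phi,
        phi @` (C `&` U) = Sigma `&` U',
        phi 0 = 0,
        jacobian phi 0 = 1%:M &
        eball 0 r0 `&` C `<=` U `&` C].
Proof.
have [g gmg gb] : exists2 g, gamma < g & g < beta1.
  by exists ((gamma + beta1) / 2); lra.
have g0 : 0 < g := lt_trans hgamma gmg.
(* The first two upper bounds leave room to absorb [C1] and [C2], [a <= g] absorbs the curvature of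
   the cone, and [a <= 1] keeps the Hoelder exponent at most 1. *)
have [a [a0 gab ab2 ag a1]] :
    exists a, [/\ 0 < a, g + a < beta1, a < beta2, a <= g & a <= 1].
  exists (Num.min (Num.min ((beta1 - g) / 2) (beta2 / 2)) (Num.min g 1)).
  set a := Num.min _ _; have : a <= a by [].
  rewrite {2}/a !le_min => /andP[/andP[a_b1 a_b2] /andP[ag a1]].
  by split; rewrite // ?lt_min ?g0 ?ltr01 ?andbT; lra.
have b01 : 0 < a / (1 + g) <= 1.
  have g1 : 0 < 1 + g by rewrite addr_gt0.
  by rewrite divr_gt0 //= ler_pdivrMr // mul1r (le_trans ag) // lerDr.
have /andP[b0 b1] := b01.
exists (a / (1 + g)) => // C1 C2 C10 C20; exists 2; first by rewrite ltr1n.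
move=> A A2; have A0 : 0 < A by apply: lt_le_trans A2; rewrite ltr0n.
(* Smallness is drawn from the powers of [r] in (E1) and (E2), at radii below a [rho] chosen after
   [r0]; the map, being defined everywhere, still covers the ball of radius [r0]. *)
exists 1, 1, 1, 1; split; first by rewrite ltr01.
move=> eps sigma delta r0 _ _ _ /andP[r00 _] S C cS S0 kpC _ E1 E2.
have [e e1 CE] := kp_cone_unit kpC.
have {}E1 r : 0 < r <= 2 * r0 -> bidist 0 r S C <= C1 * r `^ beta1.
  by move=> /E1; rewrite le_min => /andP[].
have {}E2 x r : S x -> x != 0 -> enorm x <= r0 ->
    0 < r <= 16 * (enorm x `^ (1 + gamma) / A) -> thetaP S x r <= C2 * r `^ beta2.
  move=> Sx xn xr hr; have := E2 x r; rewrite le_min => /(_ _ hr) h.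
  have /h/andP[] // : ((S `&` eball 0 r0) `\ 0) x.
  by split; [split => //; rewrite /eball /= subr0|apply/eqP].
have Ne1 : dot (- e) (- e) = 1 by rewrite !dotE opprK.
have CEN z : C z <-> `|dot z (- e)| = enorm (perp (- e) z).
  by rewrite perpN dotNr normrN.
have [rho1 /andP[rho10 rho11] nc1] :=
  near_cone_exists hgamma gmg a0 gab ab2 C10 C20 A0 r00 cS S0 e1 CE E1 E2.
have [rho2 /andP[rho20 _] nc2] :=
  near_cone_exists hgamma gmg a0 gab ab2 C10 C20 A0 r00 cS S0 Ne1 CEN E1 E2.
have [||rho3 /andP[rho30 _] rho3P] := @powR_small _ a (lam a) (1/10/10/10/10/10) a0.
- exact: ltW (lam_gt0 a0).
- by rewrite !divr_gt0.
pose rho := Num.min rho1 (Num.min rho2 rho3).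
have rho0 : 0 < rho by rewrite !lt_min rho10 rho20.
have [rr1 rr2 rr3] : [/\ rho <= rho1, rho <= rho2 & rho <= rho3].
  by rewrite /rho !ge_min !lexx !orbT.
have sc e' : near_cone S e' g a rho -> small_cone S e' g a rho.
  move=> nc; split => //; first by rewrite a0.
    by rewrite rho0 (le_trans rr1).
  by apply: rho3P; rewrite (ltW rho0).
have hr1 : 0 < rho <= rho1 by rewrite rho0.
have hr2 : 0 < rho <= rho2 by rewrite rho0.
have [w [W [K [r [r_gt0 K0 [w0 W0] T [CS SC]]]]]] :=
  chart_exists (sc _ (nc1 _ hr1)) (sc _ (nc2 _ hr2)) CE.
have [R1 /andP[R10 R1r] [w_lip w_der W_le W_cont W_hoelder]] :=
  taylor_small_ball b01 K0 r_gt0 W0 T.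
(* The point of [C] that corresponds to the image of a point of the ball of
   radius [r1] lies in the ball of radius [R1], where [shear] is injective. *)
pose r1 := R1 / 2; have r10 : 0 < r1 by rewrite divr_gt0.
have r1R x : enorm x < r1 -> enorm x < R1.
  by move=> xr; apply: lt_trans xr _; rewrite /r1; lra.
have w_lip1 x y : enorm x < r1 -> enorm y < r1 -> `|w y - w x| <= 1/2 * enorm (y - x).
  by move=> /r1R xr /r1R; exact: w_lip.
have w_der1 x (xr : enorm x < r1) := w_der x (r1R x xr).
have W_le1 x (xr : enorm x < r1) := W_le x (r1R x xr).
have W_cont1 x (xr : enorm x < r1) := W_cont x (r1R x xr).
have F_C1 := C1_on_shear e1 w_der1 W_cont1.
have [G G_C1 [GK KG]] := shear_inverse e1 w_lip1 w_der1 W_le1 W_cont1.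
have F_open := open_shear_image e1 w_lip1.
pose F := shear e w; pose M := r1^-1; have M0 : 0 < M by rewrite invr_gt0.
have F0 : F 0 = 0 by rewrite /F /shear w0 scale0r addr0.
have k_in x : enorm (compress M x) < r1.
  by have := compress_lt M0 x; rewrite mulrC ltr_pdivrMr // mul1r.
have M_den x : 0 < 1 + M * enorm x := lt_le_trans ltr01 (compress_den_ge1 M0 x).
have NM_den x : enorm x < r1 -> 0 < 1 + (- M) * enorm x.
  by move=> xr; rewrite mulNr subr_gt0 mulrC ltr_pdivrMr // mul1r.
have kK x : compress (- M) (compress M x) = x by have [] := compressK (M_den x).
have Kk x : enorm x < r1 -> compress M (compress (- M) x) = x.
  by move=> xr; have [_] := compressK (NM_den x xr); rewrite opprK.
have k0 : compress M 0 = 0 by rewrite /compress scaler0.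
have coneZ c x : C x -> C (c *: x).
  move=> /CE xC; apply/CE; rewrite dotZl normrM xC.
  have -> : perp e (c *: x) = c *: perp e x.
    by rewrite /perp dotZl scalerBr scalerA.
  by rewrite enormZ.
pose phi := F \o compress M.
have k_jac x := compress_has_jacobian (M_den x).
have k_C1 : C1_on setT (compress M).
  apply: (has_jacobian_C1_on openT (fun x _ => k_jac x)) => x _.
  exact: continuous_compress_jacobian.
have k_inv_C1 : C1_on (open_eball r1) (compress (- M)).
  apply: (has_jacobian_C1_on (@open_open_eball R r1)
    (fun x xr => compress_has_jacobian (NM_den x xr))) => x xr.
  exact: continuous_compress_jacobian (NM_den x xr).
have phi_jac x : jacobian phi x =
    compress_jacobian M x *m shear_jacobian e (W (compress M x)).
  have [dk <-] := has_jacobianP (k_jac x).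
  have [dF <-] := has_jacobianP (shear_has_jacobian e1 w_der1 (k_in x)).
  exact: jacobian_comp.
exists setT, (F @` open_eball r1), phi; split.
  split; [exact: openT|by []|exact: F_open|].
  by exists 0 => //; rewrite /open_eball /= enorm0.
split; last by move=> x [_ Cx].
- split.
    exists (compress (- M) \o G); split.
    + exact: C1_on_comp openT k_C1 F_C1 (fun x _ => k_in x).
    + by apply: (C1_on_comp F_open G_C1 k_inv_C1) => y /KG[].
    + move=> x _; split; first by exists (compress M x) => //; exact: k_in.
      by rewrite /phi /= GK ?kK.
    + by move=> y /KG[yr yE]; split => //; rewrite /phi /= Kk.
  (* A product of matrices of size 4 costs a factor 4. The variation of the first factor contributes
     [4 * 2 * (8 M + 4)], at most half the term allotted to it, and that of the second
     [4 * 2 * 12 K]. *)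
  exists (16 * (8 * M + 4) + 96 * K) => x y _ _.
  rewrite !phi_jac; set kx := compress M x; set ky := compress M y.
  rewrite mulmx_subE.
  apply: le_trans (ler_normD _ _) _.
  have t0 := enorm_ge0 (x - y); have tb := powR_ge0 (enorm (x - y)) (a / (1 + g)).
  have h1 : `|shear_jacobian e (W kx)| <= 2.
    apply: le_trans (ler_normD _ _) _; have := norm_one_mx (R := R).
    by have := outer_e_norm e1 (W kx); have := W_le1 kx (k_in x); clear; lra.
  have h2 : `|shear_jacobian e (W kx) - shear_jacobian e (W ky)| <=
      12 * K * enorm (x - y) `^ (a / (1 + g)).
    have -> : shear_jacobian e (W kx) - shear_jacobian e (W ky) = (W kx - W ky)^T *m e.
      by rewrite /shear_jacobian opprD addrACA subrr add0r linearB /= mulmxBl.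
    apply: le_trans (outer_e_norm e1 _) _.
    apply: le_trans (W_hoelder kx ky (r1R _ (k_in x)) (r1R _ (k_in y))) _.
    have two1 : 1 <= 2 :> R by rewrite ler1n.
    have b01' : 0 <= a / (1 + g) <= 1 by rewrite b1 ltW.
    have h3 := le_trans (ler_powRl (ltW b0) (enorm_ge0 _) (compress_lipschitz M0 x y))
      (powR1_scale_le two1 t0 b01').
    have K6 : 0 <= 6 * K by rewrite mulr_ge0 ?ler0n.
    have -> : 12 * K = 6 * K * 2 by ring.
    by apply: le_trans (ler_wpM2l K6 h3) _; rewrite mulrA.
  have g1 := mulmx_norm_le (compress_jacobian M x - compress_jacobian M y)
    (shear_jacobian e (W kx)).
  have g2 := mulmx_norm_le (compress_jacobian M y)
    (shear_jacobian e (W kx) - shear_jacobian e (W ky)).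
  have g3 := ler_pM (normr_ge0 _) (normr_ge0 _) (compress_jacobian_hoelder M0 x y b01) h1.
  have g4 := ler_pM (normr_ge0 _) (normr_ge0 _) (compress_jacobian_le M0 y) h2.
  have p1 := mulr_ge0 (ltW M0) tb.
  by clear -g1 g2 g3 g4 p1 tb; lra.
- apply/seteqP; split=> [_ [x [Cx _] <-]|y [Sy [x xr xy]]].
    split; last by exists (compress M x) => //; exact: k_in.
    apply: CS; last exact: coneZ.
    by apply: le_trans (ltW (r1R _ (k_in x))) R1r.
  have xR := r1R x xr; have z_in : enorm (0 : 'rV[R]_4) < R1 by rewrite enorm0.
  have y_le : enorm y <= r.
    rewrite -xy /shear; apply: le_trans (enormD _ _) _; rewrite (enorm_scale_unit e1).
    have := w_lip 0 x z_in xR; rewrite w0 !subr0.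
    by move: xr R1r R10; rewrite /open_eball /= /r1; clear; lra.
  have [z [Cz z_le zy]] := SC y Sy y_le.
  have Py : perp e y = perp e x by rewrite -xy /F /shear (perp_add e1).
  (* [|z| <= 2 |P y| = 2 |P x| < 2 r1 = R1], because the displacement along [e] does not change
     [P]. *)
  have zR : enorm z < R1.
    apply: le_lt_trans z_le _; rewrite Py.
    by have := enorm_perp e1 x; move: xr; rewrite /open_eball /= /r1; clear; lra.
  have xz : x = z by apply: (shear_inj e1 w_lip xR zR); rewrite zy.
  exists (compress (- M) x); last by rewrite /phi /= Kk.
  by split => //; apply: coneZ; rewrite xz.
- by rewrite /phi /= k0.
rewrite phi_jac k0 W0 /shear_jacobian trmx0 mul0mx addr0 mulmx1.
by rewrite /compress_jacobian /radial_sq enorm0 mulr0 addr0 invr1 scale1r mulmx0 !scaler0 subr0.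
Qed.
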